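(* Let $k$ be a real number with $0<k^2<1$. If the series $$\sum_{n=0}^{\infty} (-1)^{\lfloor n/2\rfloor}(2n+1)^3\,\operatorname{csch}^2\!\left(\frac{2n+1}{2}\,\frac{K'}{K}\,\pi\right)$$ converges, then its sum equals $$\frac{4k'K^4\,\bigl(6A\,E+B\,K\bigr)}{\pi^4\,(k'+1)\,\bigl(K'(E-K)+E'K\bigr)},$$ where $$A = k\Bigl(k\bigl(\sqrt{1-k}+\sqrt{1+k}\bigr)-3\sqrt{1-k}+3\sqrt{1+k}\Bigr)-6\bigl(\sqrt{1-k}+\sqrt{1+k}\bigr)$$ and $$B = 36\bigl(\sqrt{1-k}+\sqrt{1+k}\bigr)+k\Bigl(18\bigl(\sqrt{1-k}-\sqrt{1+k}\bigr)+k\Bigl(k\bigl(k(\sqrt{1-k}+\sqrt{1+k})-8\sqrt{1-k}+8\sqrt{1+k}\bigr)-23\bigl(\sqrt{1-k}+\sqrt{1+k}\bigr)\Bigr)\Bigr).$$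
   Context: For the elliptic modulus $k$ (with $0<k^2<1$), write $k'=\sqrt{1-k^2}$. The complete elliptic integrals of the first and second kind are $K=K(k)=\int_0^{\pi/2}\frac{d\theta}{\sqrt{1-k^2\sin^2\theta}}$ and $E=E(k)=\int_0^{\pi/2}\sqrt{1-k^2\sin^2\theta}\,d\theta$; also $K'=K(k')$ and $E'=E(k')$. Here $\operatorname{csch} x = 1/\sinh x$. *)

(* Defs.v *)
(* Stdlib reals with Coquelicot's integrals and series. *)
From Stdlib Require Export Reals.
From Coquelicot Require Export Coquelicot.
Open Scope R_scope.

(** The argument of the elliptic integrals is the modulus [k], not the
    parameter [m = k^2]. For [k ^ 2 < 1] the integrands are continuous on the
    interval of integration, so [RInt] is the Riemann integral. *)
Definition ellipticK (k : R) : R :=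
  RInt (fun t => 1 / sqrt (1 - k ^ 2 * sin t ^ 2)) 0 (PI / 2).

Definition ellipticE (k : R) : R :=
  RInt (fun t => sqrt (1 - k ^ 2 * sin t ^ 2)) 0 (PI / 2).

Definition compl_modulus (k : R) : R := sqrt (1 - k ^ 2).

Definition csch (x : R) : R := 1 / sinh x.

Definition coefA (k : R) : R :=
  k * (k * (sqrt (1 - k) + sqrt (1 + k)) - 3 * sqrt (1 - k) + 3 * sqrt (1 + k))
  - 6 * (sqrt (1 - k) + sqrt (1 + k)).

Definition coefB (k : R) : R :=
  36 * (sqrt (1 - k) + sqrt (1 + k))
  + k * (18 * (sqrt (1 - k) - sqrt (1 + k))
         + k * (k * (k * (sqrt (1 - k) + sqrt (1 + k))
                     - 8 * sqrt (1 - k) + 8 * sqrt (1 + k))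
                - 23 * (sqrt (1 - k) + sqrt (1 + k)))).

(* Main.v *)
Require Import Defs.
From Stdlib Require Import Lra Lia Psatz Arith.

(** Put [y = PI * K' / K], [chi n = (-1) ^ (n / 2)] and
[G y = sum of chi n * (2 n + 1)^2 / (exp ((2 n + 1) y) - 1)], an Eisenstein
series of weight three. Differentiating term by term, [G' y] is [- 1 / 4] times
the series to be summed ([is_derive_eisenstein]). So it is enough to know [G]
as a function of the modulus,
[G = 3/2 - (sqrt 2 / 4) (2 K / PI)^3 k' (2 + k') sqrt (1 + k')]
([eisenstein_closed_form]), and to differentiate both sides in [k]. The
derivative of [y] is where [W = K' (E - K) + E' K] comes from: it equals
[- PI W / (k k'^2 K^2)] ([is_derive_period_ratio]). Comparing the integrals gives
[W > 0] ([legendre_pos]), so that one may divide by it.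

The closed form comes from the elliptic function
[f z = sum over all integers m of csc (z + i m y)], a multiple of Jacobi's ns.
Since [chi n = sqrt 2 * sin ((2 n + 1) PI / 4)], the Fourier expansion of [f]
shows that [G] is, up to constants, [f''] at [PI / 4]
([octant_sum_eisenstein]). The theory of [f] is derived from this sum of simple
poles alone, together with its companions [d], the alternating sum of csc, and
[c], the alternating sum of cot. Grouping [m] with [- m] turns all three into
partial fractions in [x = - (sin z)^2] with poles at the [sinh (m y)^2], and
[x = (sinh t)^2] is the imaginary direction [z = i t]; hence one computation
with real series covers both axes. In the product of two such series, the
coefficient of each simple pole is a sum of an odd kernel over the integers with
one value missing, so it telescopes ([odd_kernel_series]), and the product is
the third function up to differentiation ([partial_fractions_product]). This
gives [f' = - c d], [c' = - f d], [d' = - f c].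

Consequently [f^2 - c^2] and [f^2 - d^2] are constants [al^2] and [be^2], the
same on the two axes because they are regular at [x = 0]. The angle
[PI / 2 - atan (c / al)] then moves so that the elliptic integral of modulus
[k = be / al] grows at the constant rate [al] ([amplitude]). Reaching
[z = PI / 2] gives [K = al PI / 2]; the same argument on the imaginary axis, up
to the half period, gives [K' = al y / 2]; so [y = PI K' / K] ([uniformisation]).
Every modulus in (0, 1) arises because [K' / K] is strictly monotone
([period_ratio_inj]). At [z = PI / 4] half of the integral has been covered, and
the involution [tan s * tan t = 1 / k'], which reverses the integral, locates the
angle there ([ellF_half]); the differential system then yields [f'']. *)

(** * Series: domination, termwise differentiation, interchange of summations *)

Lemma Rabs_Series_le (a M : nat -> R) :
  (forall n, Rabs (a n) <= M n) -> ex_series M -> Rabs (Series a) <= Series M.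
Proof.
  intros H HM.
  assert (Ha : ex_series (fun n => Rabs (a n))).
  { apply (@ex_series_le R_AbsRing R_CompleteNormedModule _ M); auto.
    intros n. change (norm (Rabs (a n))) with (Rabs (Rabs (a n))).
    rewrite Rabs_Rabsolu; auto. }
  apply Rle_trans with (1 := Series_Rabs _ Ha).
  apply Series_le; auto. intros n; split; auto. apply Rabs_pos.
Qed.

Lemma ex_series_dominated (a M : nat -> R) :
  (forall n, Rabs (a n) <= M n) -> ex_series M -> ex_series a.
Proof.
  intros H HM.
  apply (@ex_series_le R_AbsRing R_CompleteNormedModule _ M); auto.
Qed.

Lemma Series_split (a : nat -> R) (N : nat) :
  ex_series a -> Series a = sum_f_R0 a N + Series (fun k => a (S N + k)%nat).
Proof.
  intros Ha. rewrite (Series_incr_n a (S N)); auto. lia.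
Qed.

Lemma filterlim_sum_f_R0 (T : Type) (F : (T -> Prop) -> Prop) {FF : Filter F}
  (u : T -> nat -> R) (l : nat -> R) (N : nat) :
  (forall n, filterlim (fun t => u t n) F (locally (l n))) ->
  filterlim (fun t => sum_f_R0 (u t) N) F (locally (sum_f_R0 l N)).
Proof.
  intros H; induction N as [|N IH]; simpl; auto.
  eapply filterlim_comp_2. apply IH. apply (H (S N)).
  apply (@filterlim_plus R_AbsRing R_NormedModule).
Qed.

(** Dominated convergence: the tails are uniformly small by the majorant, and the
    remaining finite sum converges termwise. Derivatives of series, interchanges of
    summations and limits of partial sums are all deduced from it. *)
Lemma filterlim_Series_dominated (T : Type) (F : (T -> Prop) -> Prop)
  {FF : ProperFilter F} (u : T -> nat -> R) (l M : nat -> R) :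
  ex_series M ->
  (forall n, filterlim (fun t => u t n) F (locally (l n))) ->
  F (fun t => forall n, Rabs (u t n) <= M n) ->
  filterlim (fun t => Series (u t)) F (locally (Series l)).
Proof.
  intros HM Hl HF.
  assert (HlM : forall n, Rabs (l n) <= M n).
  { intros n. apply (@filterlim_le T F _ (fun t => Rabs (u t n)) (fun _ => M n)
      (Finite (Rabs (l n))) (Finite (M n))).
    - revert HF. apply filter_imp. auto.
    - eapply filterlim_comp. apply Hl. apply (continuous_Rabs (l n)).
    - apply filterlim_const. }
  apply filterlim_locally. intros eps.
  assert (Htail : exists N, Rabs (Series (fun k => M (S N + k)%nat)) < eps / 3).
  { destruct HM as [s Hs].
    assert (Hlim : is_lim_seq (sum_n M) s) by exact Hs.
    apply is_lim_seq_spec in Hlim.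
    assert (He : 0 < eps / 3) by (destruct eps as [e He]; simpl; lra).
    destruct (Hlim (mkposreal _ He)) as [N HN]. exists N.
    specialize (HN N (Nat.le_refl N)). simpl in HN.
    rewrite sum_n_Reals in HN.
    rewrite <- (is_series_unique _ _ Hs) in HN.
    rewrite (Series_split M N) in HN by (exists s; auto).
    rewrite <- Rabs_Ropp. 
    replace (- _) with (sum_f_R0 M N - (sum_f_R0 M N + Series (fun k => M (S N + k)%nat))) by lra.
    exact HN. }
  destruct Htail as [N HN].
  assert (Htl : ex_series (fun k => M (S N + k)%nat)).
  { apply (ex_series_incr_n M (S N)); auto. }
  pose proof (filterlim_sum_f_R0 T F u l N Hl) as Hsum.
  assert (He : 0 < eps / 3) by (destruct eps as [e He]; simpl; lra).
  pose proof (proj1 (filterlim_locally _ _) Hsum (mkposreal _ He)) as Hs3.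
  generalize (filter_and _ _ HF Hs3). apply filter_imp.
  intros t [Ht1 Ht2].
  change (Rabs (Series (u t) - Series l) < eps).
  change (Rabs (sum_f_R0 (u t) N - sum_f_R0 l N) < eps / 3) in Ht2.
  rewrite (Series_split (u t) N) by (eapply ex_series_dominated; eauto).
  rewrite (Series_split l N) by (eapply ex_series_dominated; eauto).
  assert (H1 : Rabs (Series (fun k => u t (S N + k)%nat)) <= Series (fun k => M (S N + k)%nat)).
  { apply Rabs_Series_le; auto. }
  assert (H2 : Rabs (Series (fun k => l (S N + k)%nat)) <= Series (fun k => M (S N + k)%nat)).
  { apply Rabs_Series_le; auto. }
  apply Rabs_lt_between in HN. apply Rabs_lt_between in Ht2.
  apply Rabs_le_between in H1. apply Rabs_le_between in H2.
  apply Rabs_lt_between. lra.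
Qed.

(** The difference quotients are dominated by [M] because of the mean value theorem.
    *)
Lemma is_derive_Series (u du : nat -> R -> R) (M : nat -> R) (x r : R) :
  0 < r -> ex_series M ->
  (forall t, Rabs (t - x) < r -> ex_series (fun n => u n t)) ->
  (forall n t, Rabs (t - x) < r -> is_derive (u n) t (du n t)) ->
  (forall n t, Rabs (t - x) < r -> Rabs (du n t) <= M n) ->
  is_derive (fun t => Series (fun n => u n t)) x (Series (fun n => du n x)).
Proof.
  intros Hr HM Hex Hd Hb.
  assert (Hx : Rabs (x - x) < r) by (rewrite Rminus_diag, Rabs_R0; auto).
  apply is_derive_Reals.
  assert (Hlim : filterlim (fun h => Series (fun n => (u n (x + h) - u n x) / h))
                   (locally' 0) (locally (Series (fun n => du n x)))).
  { apply (@filterlim_Series_dominated R (locally' 0) (Rbar_locally'_filter 0) _ _ M); auto.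
    - intros n. specialize (Hd n x Hx). apply is_derive_Reals in Hd.
      apply filterlim_locally. intros eps.
      destruct (Hd eps (cond_pos eps)) as [del Hdel].
      exists del. intros h Hh Hh0. apply Hdel; auto.
      change (Rabs (h - 0) < del) in Hh. rewrite Rminus_0_r in Hh. auto.
    - exists (mkposreal _ Hr). intros h Hh Hh0 n.
      change (Rabs (h - 0) < r) in Hh. rewrite Rminus_0_r in Hh.
      apply Rabs_lt_between in Hh.
      destruct (MVT_gen (u n) x (x + h) (du n)) as [c [Hc Hceq]].
      + intros t Ht. apply Hd. apply Rabs_lt_between.
        unfold Rmin, Rmax in Ht; destruct (Rle_dec x (x + h)); lra.
      + intros t Ht. apply continuity_pt_filterlim.
        apply (@ex_derive_continuous R_AbsRing R_NormedModule). exists (du n t). apply Hd. apply Rabs_lt_between.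
        unfold Rmin, Rmax in Ht; destruct (Rle_dec x (x + h)); lra.
      + rewrite Hceq. replace (du n c * (x + h - x) / h) with (du n c) by (field; auto).
        apply Hb. apply Rabs_lt_between.
        unfold Rmin, Rmax in Hc; destruct (Rle_dec x (x + h)); lra. }
  intros eps Heps.
  pose proof (proj1 (filterlim_locally _ _) Hlim (mkposreal _ Heps)) as [del Hdel].
  assert (Hdr : 0 < Rmin del r) by (apply Rmin_pos; auto; apply cond_pos).
  exists (mkposreal _ Hdr). intros h Hh0 Hh. simpl in Hh.
  assert (Hh1 : Rabs h < del) by (eapply Rlt_le_trans; [apply Hh|apply Rmin_l]).
  assert (Hh2 : Rabs h < r) by (eapply Rlt_le_trans; [apply Hh|apply Rmin_r]).
  assert (Hb' : ball 0 del h) by (change (Rabs (h - 0) < del); rewrite Rminus_0_r; auto).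
  specialize (Hdel h Hb' Hh0). change (Rabs (Series (fun n => (u n (x + h) - u n x) / h) - Series (fun n => du n x)) < eps) in Hdel.
  rewrite <- Series_minus.
  2:{ apply Hex. replace (x + h - x) with h by ring. auto. }
  2:{ apply Hex; auto. }
  unfold Rdiv at 1. rewrite <- Series_scal_r. exact Hdel.
Qed.

Lemma ex_series_scal_R (c : R) (a : nat -> R) : ex_series a -> ex_series (fun n => c * a n).
Proof. intros H. apply (ex_series_scal c a H). Qed.

Lemma ex_series_plus_R (a b : nat -> R) :
  ex_series a -> ex_series b -> ex_series (fun n => a n + b n).
Proof. intros Ha Hb. apply (ex_series_plus a b Ha Hb). Qed.

Lemma Series_sum_f_R0_swap (u : nat -> nat -> R) (N : nat) :
  (forall m, ex_series (u m)) ->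
  ex_series (fun n => sum_f_R0 (fun m => u m n) N) /\
  sum_f_R0 (fun m => Series (u m)) N = Series (fun n => sum_f_R0 (fun m => u m n) N).
Proof.
  intros H; induction N as [|N [IH1 IH2]]; simpl; auto.
  split. apply ex_series_plus_R; auto.
  rewrite IH2, Series_plus; auto.
Qed.

Lemma Series_as_limit (a : nat -> R) (s : R) :
  filterlim (fun N => sum_f_R0 a N) Hierarchy.eventually (locally s) -> Series a = s.
Proof.
  intros H. apply is_series_unique.
  change (is_lim_seq (sum_n a) s).
  apply is_lim_seq_ext with (fun N => sum_f_R0 a N).
  intros n; symmetry; apply sum_n_Reals. exact H.
Qed.

Lemma is_lim_Series (a : nat -> R) :
  ex_series a -> filterlim (fun N => sum_f_R0 a N) Hierarchy.eventually (locally (Series a)).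
Proof.
  intros [s Hs]. rewrite (is_series_unique _ _ Hs).
  apply (is_lim_seq_ext (sum_n a) (fun N => sum_f_R0 a N) s).
  intros n; apply sum_n_Reals. exact Hs.
Qed.

(** A product majorant suffices for every double series below, and it makes Fubini's
    theorem an instance of dominated convergence along the partial sums. *)
Lemma Series_swap (u : nat -> nat -> R) (A B : nat -> R) :
  (forall m n, Rabs (u m n) <= A m * B n) -> (forall n, 0 <= A n) ->
  ex_series A -> ex_series B ->
  Series (fun m => Series (fun n => u m n)) = Series (fun n => Series (fun m => u m n)).
Proof.
  intros Hu HA0 HA HB.
  assert (Hrow : forall m, ex_series (u m)).
  { intros m. apply ex_series_dominated with (fun n => A m * B n); auto.
    apply ex_series_scal_R; auto. }
  assert (Hcol : forall n, ex_series (fun m => u m n)).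
  { intros n. apply ex_series_dominated with (fun m => B n * A m).
    intros m; rewrite Rmult_comm; auto. apply ex_series_scal_R; auto. }
  apply Series_as_limit.
  apply filterlim_ext with (fun N => Series (fun n => sum_f_R0 (fun m => u m n) N)).
  { intros N. symmetry. apply Series_sum_f_R0_swap; auto. }
  apply (filterlim_Series_dominated nat Hierarchy.eventually _ _ (fun n => Series A * B n)).
  - apply ex_series_scal_R; auto.
  - intros n. apply (is_lim_Series (fun m => u m n)); auto.
  - exists 0%nat. intros N _ n.
    apply Rle_trans with (sum_f_R0 (fun m => A m * B n) N).
    { apply Rle_trans with (sum_f_R0 (fun m => Rabs (u m n)) N).
      apply Rsum_abs. apply sum_Rle. auto. }
    rewrite <- scal_sum, Rmult_comm.
    assert (0 <= B n \/ forall m, A m = 0) as [H0|H0].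
    { destruct (Rle_dec 0 (B n)); auto. right. intros m.
      specialize (Hu m n). pose proof (Rabs_pos (u m n)). specialize (HA0 m).
      nra. }
    + apply Rmult_le_compat_r; auto.
      rewrite (Series_split A N); auto.
      assert (0 <= Series (fun k => A (S N + k)%nat)).
      { replace 0 with (Series (fun k => 0 * A (S N + k)%nat)) by (rewrite Series_scal_l; ring).
        apply Series_le. intros k; specialize (HA0 (S N + k)%nat). split; lra.
        apply (ex_series_incr_n A (S N)); auto. }
      lra.
    + rewrite (sum_eq _ (fun _ => 0)); [|intros; auto].
      rewrite (Series_ext A (fun k => 0 * A k)); [|intros; rewrite H0; ring].
      rewrite Series_scal_l, sum_cte. lra.
Qed.

Lemma ex_series_ext_R (a b : nat -> R) :
  (forall n, a n = b n :> R) -> ex_series a -> ex_series b.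
Proof. intros H. apply ex_series_ext. exact H. Qed.

Lemma is_series_ext_R (a b : nat -> R) (l : R) :
  (forall n, a n = b n :> R) -> is_series a l -> is_series b l.
Proof. intros H. apply is_series_ext. exact H. Qed.

(** * Residue identities from odd kernels *)

Fixpoint sum_from_1 (f : nat -> R) (N : nat) : R :=
  match N with O => 0 | S n => sum_from_1 f n + f (S n) end.

Lemma sum_f_R0_shift (f : nat -> R) (N : nat) :
  sum_f_R0 (fun n => f (S n)) N = sum_from_1 f (S N).
Proof. induction N as [|N IH]; simpl in *; [ring|rewrite IH; ring]. Qed.

Lemma is_series_from_1 (f : nat -> R) (l : R) :
  is_lim_seq (sum_from_1 f) l -> is_series (fun n => f (S n)) l.
Proof.
  intros H. change (is_lim_seq (sum_n (fun n => f (S n))) l).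
  apply is_lim_seq_ext with (fun N => sum_from_1 f (S N)).
  - intros n. rewrite sum_n_Reals, sum_f_R0_shift; auto.
  - apply (is_lim_seq_incr_1 (sum_from_1 f)). exact H.
Qed.

(** The sum of [kap (m - n) + kap (m + n)] over [n >= 1], [n <> m], for an odd kernel:
    almost everything cancels in pairs, except [kap m] (as [n = 0] is left out) and
    [kap (2 m)] (as [n = m] is left out). At the other end there remains a window of
    [2 m] consecutive indices moving to infinity; as its length is even, a kernel that
    is asymptotically alternating leaves nothing there. Oddness is built into the
    second and third hypotheses, so that [kap] is only needed on natural numbers. *)
Lemma odd_kernel_series (kap u : nat -> R) (m : nat) (s : R) :
  (1 <= m)%nat ->
  (forall n, (1 <= n < m)%nat -> u n = kap (m - n)%nat + kap (m + n)%nat) ->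
  (forall n, (m < n)%nat -> u n = kap (m + n)%nat - kap (n - m)%nat) ->
  u m = 0 ->
  is_lim_seq (fun d => kap d - s * (-1) ^ d) 0 ->
  is_series (fun n => u (S n)) (- kap m - kap (2 * m)%nat).
Proof.
  intros Hm Hlt Hgt Hmm Hlim.
  set (K := sum_from_1 kap).
  assert (HK : forall n, K (S n) = K n + kap (S n)) by reflexivity.
  assert (Hlow : forall i, (i < m)%nat ->
    sum_from_1 u i = K (m + i)%nat - K m + K (m - 1)%nat - K (m - 1 - i)%nat).
  { induction i as [|i IH]; intros Hi.
    - simpl. rewrite Nat.add_0_r, Nat.sub_0_r. ring.
    - simpl. rewrite IH, (Hlt (S i)) by lia.
      replace (m + S i)%nat with (S (m + i)) by lia.
      replace (m - 1 - i)%nat with (S (m - 1 - S i)) by lia.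
      replace (m - S i)%nat with (S (m - 1 - S i)) by lia.
      unfold K; simpl. ring. }
  assert (Hhigh : forall j, sum_from_1 u (m + j) = K (2 * m + j)%nat - K j - kap m - kap (2 * m)%nat).
  { induction j as [|j IH].
    - rewrite !Nat.add_0_r. destruct m as [|m']; [lia|].
      simpl sum_from_1 at 1. rewrite Hlow by lia. rewrite Hmm.
      replace (2 * S m')%nat with (S (S m' + m')) by lia.
      replace (S m' - 1)%nat with m' by lia. rewrite Nat.sub_diag.
      unfold K; simpl. ring.
    - replace (m + S j)%nat with (S (m + j)) by lia. simpl sum_from_1 at 1.
      rewrite IH, Hgt by lia.
      replace (2 * m + S j)%nat with (S (2 * m + j)) by lia.
      replace (m + S (m + j))%nat with (S (2 * m + j)) by lia.
      replace (S (m + j) - m)%nat with (S j) by lia.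
      unfold K; simpl. ring. }
  (* Over an even number of consecutive indices the alternating part cancels. *)
  assert (Hwin : forall i, is_lim_seq (fun j => K (2 * i + j)%nat - K j) 0).
  { induction i as [|i IH].
    - apply is_lim_seq_ext with (fun _ => 0). intros; simpl; ring. apply is_lim_seq_const.
    - apply is_lim_seq_ext with (fun j => (K (2 * i + j)%nat - K j)
        + ((kap (j + S (2 * i))%nat - s * (-1) ^ (j + S (2 * i)))
        + (kap (j + S (S (2 * i)))%nat - s * (-1) ^ (j + S (S (2 * i)))))).
      + intros j. replace (2 * S i + j)%nat with (S (S (2 * i + j))) by lia.
        rewrite !HK.
        replace (S (2 * i + j)) with (j + S (2 * i))%nat by lia.
        replace (S (j + S (2 * i))) with (j + S (S (2 * i)))%nat by lia.
        replace ((-1) ^ (j + S (S (2 * i)))) with (- (-1) ^ (j + S (2 * i))).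
        ring. rewrite !(Nat.add_succ_r j). simpl. ring.
      + replace (Finite 0) with (Finite (0 + (0 + 0))) by (f_equal; ring).
        apply is_lim_seq_plus'; auto. apply is_lim_seq_plus'.
        * apply (is_lim_seq_incr_n (fun d => kap d - s * (-1) ^ d) (S (2 * i)) 0); auto.
        * apply (is_lim_seq_incr_n (fun d => kap d - s * (-1) ^ d) (S (S (2 * i))) 0); auto. }
  apply is_series_from_1. apply (is_lim_seq_incr_n _ m).
  apply is_lim_seq_ext with (fun j => (K (2 * m + j)%nat - K j) + (- kap m - kap (2 * m)%nat)).
  { intros j. replace (j + m)%nat with (m + j)%nat by lia. rewrite Hhigh. ring. }
  replace (Finite (- kap m - kap (2 * m)%nat)) with (Finite (0 + (- kap m - kap (2 * m)%nat))) by (f_equal; ring).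
  apply is_lim_seq_plus'; auto. apply is_lim_seq_const.
Qed.

Definition sinh_sq (y : R) (m : nat) : R := sinh (INR m * y) ^ 2.

(** Half the residues of the three functions at the pole [sinh_sq y m] in the variable
    [x]; the names are those of the Jacobi functions ns, cs, ds. *)
Definition res_ns (y : R) (m : nat) : R := cosh (INR m * y).
Definition res_cs (y : R) (m : nat) : R := (-1) ^ m.
Definition res_ds (y : R) (m : nat) : R := (-1) ^ m * cosh (INR m * y).

(** The powers of [exp y]: in these the identities between hyperbolic functions of
    multiples of [y] become identities of rational functions. *)
Definition exp_nat (y : R) (m : nat) : R := exp (INR m * y).

Lemma exp_nat_pos y m : 0 < exp_nat y m.
Proof. apply exp_pos. Qed.

Lemma exp_nat_incr y m n : 0 < y -> (m < n)%nat -> exp_nat y m < exp_nat y n.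
Proof. intros Hy H. apply exp_increasing. apply Rmult_lt_compat_r; auto. apply lt_INR; auto. Qed.

Lemma exp_nat_0 y : exp_nat y 0 = 1.
Proof. unfold exp_nat; simpl. rewrite Rmult_0_l. apply exp_0. Qed.

Lemma exp_nat_gt_1 y m : 0 < y -> (1 <= m)%nat -> 1 < exp_nat y m.
Proof. intros Hy H. rewrite <- (exp_nat_0 y). apply exp_nat_incr; auto. Qed.

Lemma exp_nat_add y m n : exp_nat y (m + n) = exp_nat y m * exp_nat y n.
Proof. unfold exp_nat. rewrite <- exp_plus, plus_INR. f_equal; ring. Qed.

Lemma exp_nat_sub y m n : (n <= m)%nat -> exp_nat y (m - n) = exp_nat y m / exp_nat y n.
Proof.
  intros H. replace (exp_nat y m) with (exp_nat y (m - n) * exp_nat y n).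
  field. apply Rgt_not_eq, exp_nat_pos. rewrite <- exp_nat_add. f_equal; lia.
Qed.

Lemma cosh_exp_nat y m : cosh (INR m * y) = (exp_nat y m + / exp_nat y m) / 2.
Proof. unfold cosh. rewrite exp_Ropp. reflexivity. Qed.

Lemma sinh_sq_exp_nat y m : sinh_sq y m = ((exp_nat y m - / exp_nat y m) / 2) ^ 2.
Proof. unfold sinh_sq, sinh. rewrite exp_Ropp. reflexivity. Qed.

Lemma sign_cases n : (-1) ^ n = 1 \/ (-1) ^ n = -1.
Proof. induction n as [|n [H|H]]; simpl; [left; auto| |]; rewrite H; [right|left]; ring. Qed.

Lemma sign_add m n : (-1) ^ (m + n) = (-1) ^ m * (-1) ^ n.
Proof. apply pow_add. Qed.

Lemma sign_sub m n : (n <= m)%nat -> (-1) ^ (m - n) = (-1) ^ m * (-1) ^ n.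
Proof.
  intros H. replace ((-1) ^ m) with ((-1) ^ (m - n) * (-1) ^ n).
  destruct (sign_cases n) as [Hn|Hn]; rewrite Hn; ring.
  rewrite <- pow_add. f_equal; lia.
Qed.

Lemma sign_double m : (-1) ^ (2 * m) = 1.
Proof. apply pow_1_even. Qed.

Lemma is_lim_seq_inv_exp_nat y : 0 < y -> is_lim_seq (fun n => / exp_nat y n) 0.
Proof.
  intros Hy. apply is_lim_seq_ext with (fun n => (exp (- y)) ^ n).
  - intros n. unfold exp_nat. rewrite <- exp_Ropp. induction n as [|n IH].
    + simpl. rewrite Rmult_0_l, Ropp_0, exp_0; auto.
    + rewrite S_INR. simpl pow. rewrite IH, <- exp_plus. f_equal; ring.
  - apply is_lim_seq_geom. rewrite Rabs_pos_eq by (left; apply exp_pos).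
    rewrite <- exp_0. apply exp_increasing. lra.
Qed.

(** The contribution of the pole [n] to the coefficient of the simple pole [m] in a
    product of two pole series with coefficients [a] and [b]. *)
Definition cross_term (y : R) (a b : nat -> R) (m n : nat) : R :=
  if Nat.eqb m n then 0 else 2 * (a m * b n + b m * a n) / (sinh_sq y m - sinh_sq y n).

(** This is what makes the product of the functions with coefficients [a] and [b] have
    a simple-pole part with coefficients [c]; the terms [a m + b m] balance the
    contribution of the pole at the origin. *)
Definition residue_triple (y : R) (a b c : nat -> R) : Prop :=
  forall m, (1 <= m)%nat ->
  is_series (fun n => cross_term y a b m (S n)) (- (a m + b m + c m) / sinh_sq y m).

(** In each of the three cases the cross terms are, up to a factor depending on [m]
    only, differences and sums of an odd kernel at [m - n] and [m + n]. *)
Lemma residue_triple_of_kernel (y : R) (a b c kap F : nat -> R) (s : R) :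
  (forall m n, (1 <= n)%nat -> (n < m)%nat ->
     2 * (a m * b n + b m * a n) / (sinh_sq y m - sinh_sq y n)
     = F m * (kap (m - n)%nat + kap (m + n)%nat)) ->
  (forall m n, (1 <= m)%nat -> (m < n)%nat ->
     2 * (a m * b n + b m * a n) / (sinh_sq y m - sinh_sq y n)
     = F m * (kap (m + n)%nat - kap (n - m)%nat)) ->
  (forall m, (1 <= m)%nat -> F m * (- kap m - kap (2 * m)%nat) = - (a m + b m + c m) / sinh_sq y m) ->
  (forall m, (1 <= m)%nat -> F m <> 0) ->
  is_lim_seq (fun d => kap d - s * (-1) ^ d) 0 ->
  residue_triple y a b c.
Proof.
  intros H1 H2 H3 HF Hl m Hm.
  rewrite <- H3 by auto.
  apply is_series_ext with (fun n => F m * (cross_term y a b m (S n) / F m)).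
  { intros n.
    assert (E : F m * (cross_term y a b m (S n) / F m) = cross_term y a b m (S n))
      by (field; auto).
    exact E. }
  apply (is_series_scal (F m) (fun n => cross_term y a b m (S n) / F m)).
  apply (odd_kernel_series kap (fun n => cross_term y a b m n / F m) m s); auto.
  - intros n Hn. unfold cross_term.
    replace (Nat.eqb m n) with false by (symmetry; apply Nat.eqb_neq; lia).
    rewrite H1 by lia. field; auto.
  - intros n Hn. unfold cross_term.
    replace (Nat.eqb m n) with false by (symmetry; apply Nat.eqb_neq; lia).
    rewrite H2 by lia. field; auto.
  - unfold cross_term. rewrite Nat.eqb_refl. unfold Rdiv; ring.
Qed.


Lemma sinh_sq_diff y m n :
  sinh_sq y m - sinh_sq y n
  = (exp_nat y m - exp_nat y n) * (exp_nat y m + exp_nat y n) * (exp_nat y m * exp_nat y n - 1)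
    * (exp_nat y m * exp_nat y n + 1) / (4 * exp_nat y m ^ 2 * exp_nat y n ^ 2).
Proof.
  rewrite !sinh_sq_exp_nat. pose proof (exp_nat_pos y m). pose proof (exp_nat_pos y n).
  field; split; apply Rgt_not_eq; auto.
Qed.

Lemma sinh_sq_factor y m :
  sinh_sq y m = (exp_nat y m - 1) ^ 2 * (exp_nat y m + 1) ^ 2 / (4 * exp_nat y m ^ 2).
Proof. rewrite sinh_sq_exp_nat. pose proof (exp_nat_pos y m). field; apply Rgt_not_eq; auto. Qed.

Lemma is_lim_seq_alternating_part (y s : R) (kap eps : nat -> R) :
  (forall d, (1 <= d)%nat -> Rabs (kap d - s * (-1) ^ d) <= eps d) ->
  is_lim_seq eps 0 -> is_lim_seq (fun d => kap d - s * (-1) ^ d) 0.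
Proof.
  intros H He. apply is_lim_seq_abs_0.
  apply is_lim_seq_le_le_loc with (fun _ => 0) eps; auto.
  - exists 1%nat. intros n Hn. split; [apply Rabs_pos|auto].
  - apply is_lim_seq_const.
Qed.

Lemma is_lim_seq_inv_exp_nat_minus_1 (y A : R) : 0 < y -> is_lim_seq (fun d => A * / (exp_nat y d - 1)) 0.
Proof.
  intros Hy. replace (Finite 0) with (Rbar_mult A 0) by (simpl; f_equal; ring).
  apply is_lim_seq_scal_l.
  apply is_lim_seq_le_le_loc with (fun _ => 0) (fun d => / (1 - exp (- y)) * / exp_nat y d).
  - exists 1%nat. intros n Hn.
    pose proof (exp_nat_gt_1 y n Hy Hn) as H1. split.
    + left. apply Rinv_0_lt_compat. lra.
    + assert (He : 0 < 1 - exp (- y)).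
      { rewrite <- exp_0. assert (exp (- y) < exp 0) by (apply exp_increasing; lra). lra. }
      rewrite <- Rinv_mult. apply Rinv_le_contravar. apply Rmult_lt_0_compat; auto; lra.
      assert (H2 : 1 <= exp (- y) * exp_nat y n).
      { unfold exp_nat. rewrite <- exp_plus, <- exp_0.
        assert (Hn1 : 1 <= INR n) by (apply (le_INR 1); auto).
        destruct (Req_dec (- y + INR n * y) 0) as [E|E]. rewrite E; lra.
        left. apply exp_increasing. nra. }
      lra.
  - apply is_lim_seq_const.
  - replace (Finite 0) with (Rbar_mult (/ (1 - exp (- y))) 0) by (simpl; f_equal; ring).
    apply is_lim_seq_scal_l. apply is_lim_seq_inv_exp_nat; auto.
Qed.

Ltac kernel_identity y m n H1 H2 :=
  unfold res_cs, res_ds, res_ns; cbv beta;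
  rewrite ?cosh_exp_nat, sinh_sq_diff, exp_nat_sub, exp_nat_add, ?sign_add, ?sign_sub by lia;
  generalize H1 H2;
  destruct (sign_cases m) as [-> | ->]; destruct (sign_cases n) as [-> | ->];
  generalize (exp_nat y m) (exp_nat y n);
  let p := fresh "p" in let r := fresh "r" in
  intros p r; intros;
  assert (1 < p * r) by nra; assert (1 < r * p) by nra;
  field; repeat split; nra.

Ltac kernel_total y m H1 :=
  unfold res_cs, res_ds, res_ns; cbv beta;
  rewrite ?cosh_exp_nat, sinh_sq_factor, ?sign_double;
  replace (2 * m)%nat with (m + m)%nat by lia;
  rewrite !exp_nat_add, ?sign_add;
  generalize H1;
  destruct (sign_cases m) as [-> | ->];
  generalize (exp_nat y m);
  let p := fresh "p" in
  intros p; intros;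
  assert (1 < p * p) by nra;
  field; repeat split; nra.

(** The kernel is [(-1) ^ d * coth (d y / 2)]. *)
Lemma residue_triple_cs_ds_ns (y : R) : 0 < y -> residue_triple y (res_cs y) (res_ds y) (res_ns y).
Proof.
  intros Hy.
  apply residue_triple_of_kernel with
    (kap := fun d => (-1) ^ d * ((exp_nat y d + 1) / (exp_nat y d - 1)))
    (F := fun m => 2 * exp_nat y m / ((exp_nat y m - 1) * (exp_nat y m + 1))) (s := 1).
  - intros m n Hn Hmn. kernel_identity y m n (exp_nat_gt_1 y n Hy Hn) (exp_nat_incr y n m Hy Hmn).
  - intros m n Hm Hmn. kernel_identity y n m (exp_nat_gt_1 y m Hy Hm) (exp_nat_incr y m n Hy Hmn).
  - intros m Hm. kernel_total y m (exp_nat_gt_1 y m Hy Hm).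
  - intros m Hm. pose proof (exp_nat_gt_1 y m Hy Hm).
    apply Rgt_not_eq. apply Rdiv_lt_0_compat; nra.
  - apply is_lim_seq_alternating_part with (fun d => 2 * / (exp_nat y d - 1)); auto. 2: apply is_lim_seq_inv_exp_nat_minus_1; auto.
    intros d Hd. pose proof (exp_nat_gt_1 y d Hy Hd).
    replace (_ - _) with ((-1) ^ d * (2 * / (exp_nat y d - 1))) by (field; lra).
    rewrite Rabs_mult, pow_1_abs, Rmult_1_l, Rabs_pos_eq. lra.
    apply Rmult_le_pos. lra. left; apply Rinv_0_lt_compat; lra.
Qed.

(** The kernel is [coth (d y / 2)] for even [d] and [- tanh (d y / 2)] for odd [d]. *)
Lemma residue_triple_ns_cs_ds (y : R) : 0 < y -> residue_triple y (res_ns y) (res_cs y) (res_ds y).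
Proof.
  intros Hy.
  apply residue_triple_of_kernel with
    (kap := fun d => (-1) ^ d * ((exp_nat y d + (-1) ^ d) / (exp_nat y d - (-1) ^ d)))
    (F := fun m => (-1) ^ m * (2 * exp_nat y m / ((exp_nat y m - 1) * (exp_nat y m + 1)))) (s := 1).
  - intros m n Hn Hmn. kernel_identity y m n (exp_nat_gt_1 y n Hy Hn) (exp_nat_incr y n m Hy Hmn).
  - intros m n Hm Hmn. kernel_identity y n m (exp_nat_gt_1 y m Hy Hm) (exp_nat_incr y m n Hy Hmn).
  - intros m Hm. kernel_total y m (exp_nat_gt_1 y m Hy Hm).
  - intros m Hm. pose proof (exp_nat_gt_1 y m Hy Hm).
    apply Rmult_integral_contrapositive_currified.
    destruct (sign_cases m); lra.
    apply Rgt_not_eq. apply Rdiv_lt_0_compat; nra.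
  - apply is_lim_seq_alternating_part with (fun d => 2 * / (exp_nat y d - 1)); auto. 2: apply is_lim_seq_inv_exp_nat_minus_1; auto.
    intros d Hd. pose proof (exp_nat_gt_1 y d Hy Hd).
    replace (_ - _) with (2 * / (exp_nat y d - (-1) ^ d)) by
      (destruct (sign_cases d) as [-> | ->]; field; lra).
    rewrite Rabs_pos_eq.
    + apply Rmult_le_compat_l. lra. apply Rinv_le_contravar. lra.
      destruct (sign_cases d); lra.
    + apply Rmult_le_pos. lra. left; apply Rinv_0_lt_compat.
      destruct (sign_cases d); lra.
Qed.

(** The kernel is [2 csch (d y)] for even [d] and vanishes for odd [d]. *)
Lemma residue_triple_ns_ds_cs (y : R) : 0 < y -> residue_triple y (res_ns y) (res_ds y) (res_cs y).
Proof.
  intros Hy.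
  apply residue_triple_of_kernel with
    (kap := fun d => (1 + (-1) ^ d) * (2 * exp_nat y d / ((exp_nat y d - 1) * (exp_nat y d + 1))))
    (F := fun m => (-1) ^ m * ((exp_nat y m + / exp_nat y m) / 2)
                   * (2 * exp_nat y m / ((exp_nat y m - 1) * (exp_nat y m + 1)))) (s := 0).
  - intros m n Hn Hmn. kernel_identity y m n (exp_nat_gt_1 y n Hy Hn) (exp_nat_incr y n m Hy Hmn).
  - intros m n Hm Hmn. kernel_identity y n m (exp_nat_gt_1 y m Hy Hm) (exp_nat_incr y m n Hy Hmn).
  - intros m Hm. kernel_total y m (exp_nat_gt_1 y m Hy Hm).
  - intros m Hm. pose proof (exp_nat_gt_1 y m Hy Hm).
    apply Rmult_integral_contrapositive_currified.
    apply Rmult_integral_contrapositive_currified.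
    destruct (sign_cases m); lra.
    assert (0 < / exp_nat y m) by (apply Rinv_0_lt_compat; lra). lra.
    apply Rgt_not_eq. apply Rdiv_lt_0_compat; nra.
  - apply is_lim_seq_alternating_part with (fun d => 4 * / (exp_nat y d - 1)); auto. 2: apply is_lim_seq_inv_exp_nat_minus_1; auto.
    intros d Hd. pose proof (exp_nat_gt_1 y d Hy Hd).
    assert (H0 : 0 < 2 * exp_nat y d / ((exp_nat y d - 1) * (exp_nat y d + 1)) <= 2 * / (exp_nat y d - 1)).
    { split. apply Rdiv_lt_0_compat; nra.
      replace (2 * exp_nat y d / ((exp_nat y d - 1) * (exp_nat y d + 1))) with
        (2 * / (exp_nat y d - 1) * (exp_nat y d / (exp_nat y d + 1))) by (field; lra).
      rewrite <- (Rmult_1_r (2 * / (exp_nat y d - 1))) at 2.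
      apply Rmult_le_compat_l. apply Rmult_le_pos. lra. left; apply Rinv_0_lt_compat; lra.
      apply Rle_div_l; lra. }
    rewrite Rmult_0_l, Rminus_0_r.
    rewrite Rabs_pos_eq; destruct (sign_cases d) as [-> | ->]; lra.
Qed.

(** * Pole series: size estimates and derivatives *)

(** The powers of the nome [q = exp (- y)], which measure the decay of all the series.
    *)
Definition nome_pow (y : R) (m : nat) : R := / exp_nat y m.

Lemma nome_pow_pos y m : 0 < nome_pow y m.
Proof. apply Rinv_0_lt_compat, exp_nat_pos. Qed.

Lemma nome_pow_exp_nat y m : nome_pow y m * exp_nat y m = 1.
Proof. apply Rinv_l. apply Rgt_not_eq, exp_nat_pos. Qed.

Lemma nome_pow_add y m n : nome_pow y (m + n) = nome_pow y m * nome_pow y n.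
Proof. unfold nome_pow. rewrite exp_nat_add, Rinv_mult. auto. Qed.

Lemma nome_pow_decr y m n : 0 < y -> (m <= n)%nat -> nome_pow y n <= nome_pow y m.
Proof.
  intros Hy H. apply Rinv_le_contravar. apply exp_nat_pos.
  destruct (Nat.eq_dec m n) as [->|Hne]. lra. left. apply exp_nat_incr; auto; lia.
Qed.

Lemma nome_pow_pow y m : nome_pow y m = exp (- y) ^ m.
Proof.
  unfold nome_pow, exp_nat. rewrite <- exp_Ropp. induction m as [|m IH].
  - simpl. rewrite Rmult_0_l, Ropp_0, exp_0; auto.
  - rewrite S_INR. simpl pow. rewrite <- IH, <- exp_plus. f_equal; ring.
Qed.

Lemma ex_series_nome_pow y : 0 < y -> ex_series (nome_pow y).
Proof.
  intros Hy. apply ex_series_ext with (fun n => exp (- y) ^ n).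
  intros n; symmetry; apply nome_pow_pow.
  exists (/ (1 - exp (- y))). apply is_series_geom.
  rewrite Rabs_pos_eq by (left; apply exp_pos).
  rewrite <- exp_0. apply exp_increasing; lra.
Qed.

Lemma ex_series_nome_pow_S y : 0 < y -> ex_series (fun n => nome_pow y (S n)).
Proof. intros Hy. apply (ex_series_incr_1 (nome_pow y)). apply ex_series_nome_pow; auto. Qed.

Lemma nome_pow_le_1 y m : 0 < y -> nome_pow y m <= 1.
Proof.
  intros Hy. replace 1 with (nome_pow y 0). apply nome_pow_decr; auto; lia.
  unfold nome_pow. rewrite exp_nat_0. field.
Qed.

Definition sinh_const (y : R) : R := (1 - exp (- (2 * y))) / 2.

Lemma sinh_const_pos y : 0 < y -> 0 < sinh_const y.
Proof.
  intros Hy. unfold sinh_const. assert (exp (- (2 * y)) < exp 0) by (apply exp_increasing; lra).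
  rewrite exp_0 in H. lra.
Qed.

Lemma sinh_lower y d : 0 < y -> (1 <= d)%nat -> sinh_const y * exp_nat y d <= sinh (INR d * y).
Proof.
  intros Hy Hd. unfold sinh, sinh_const. fold (exp_nat y d). rewrite (exp_Ropp (INR d * y)). fold (exp_nat y d). fold (nome_pow y d).
  assert (nome_pow y d <= exp (- (2 * y)) * exp_nat y d); [|lra].
  replace (nome_pow y d) with (nome_pow y d * nome_pow y d * exp_nat y d).
  2:{ rewrite Rmult_assoc, nome_pow_exp_nat. apply Rmult_1_r. }
  apply Rmult_le_compat_r. left; apply exp_nat_pos.
  rewrite <- nome_pow_add. replace (exp (- (2 * y))) with (nome_pow y 2).
  apply nome_pow_decr; auto; lia.
  unfold nome_pow, exp_nat. rewrite <- exp_Ropp. f_equal; simpl; ring.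
Qed.

Lemma sinh_sq_lower y m : 0 < y -> (1 <= m)%nat -> sinh_const y ^ 2 * exp_nat y m ^ 2 <= sinh_sq y m.
Proof.
  intros Hy Hm. unfold sinh_sq. rewrite <- Rpow_mult_distr. apply pow_incr. split.
  apply Rmult_le_pos. left; apply sinh_const_pos; auto. left; apply exp_nat_pos.
  apply sinh_lower; auto.
Qed.

Lemma sinh_sq_pos y m : 0 < y -> (1 <= m)%nat -> 0 < sinh_sq y m.
Proof.
  intros Hy Hm. apply Rlt_le_trans with (2 := sinh_sq_lower y m Hy Hm).
  apply Rmult_lt_0_compat; apply pow_lt. apply sinh_const_pos; auto. apply exp_nat_pos.
Qed.

Lemma sinh_le_compat a b : a <= b -> sinh a <= sinh b.
Proof. intros [H| ->]. left; apply sinh_lt; auto. lra. Qed.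

Lemma sinh_sq_incr y m n : 0 < y -> (m <= n)%nat -> sinh_sq y m <= sinh_sq y n.
Proof.
  intros Hy H. apply pow_incr. split.
  - rewrite <- sinh_0. apply sinh_le_compat. apply Rmult_le_pos. apply pos_INR. lra.
  - apply sinh_le_compat. apply Rmult_le_compat_r. lra. apply le_INR; auto.
Qed.

Lemma sinh_sq_diff_sinh y m n : (n <= m)%nat ->
  sinh_sq y m - sinh_sq y n = sinh (INR (m - n) * y) * sinh (INR (m + n) * y).
Proof.
  intros H. rewrite minus_INR, plus_INR by auto. unfold sinh_sq.
  rewrite Rmult_minus_distr_r, Rmult_plus_distr_r. unfold sinh.
  unfold Rminus. rewrite !Ropp_plus_distr, !exp_plus, !Ropp_involutive, !exp_Ropp.
  pose proof (exp_pos (INR m * y)). pose proof (exp_pos (INR n * y)).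
  field; split; apply Rgt_not_eq; auto.
Qed.

Definition nat_dist (m n : nat) : nat := (m - n) + (n - m).

(** The factor [exp_nat y (nat_dist m n)] cannot be dropped: it is what makes the
    double series of the product absolutely convergent after splitting into simple
    poles. *)
Lemma sinh_sq_diff_lower y m n : 0 < y -> m <> n ->
  sinh_const y ^ 2 * exp_nat y (m + n) * exp_nat y (nat_dist m n) <= Rabs (sinh_sq y m - sinh_sq y n).
Proof.
  intros Hy Hne.
  assert (Hgen : forall i j, (j < i)%nat ->
    sinh_const y ^ 2 * exp_nat y (i + j) * exp_nat y (i - j) <= sinh_sq y i - sinh_sq y j).
  { intros i j Hij. rewrite sinh_sq_diff_sinh by lia.
    replace (sinh_const y ^ 2 * exp_nat y (i + j) * exp_nat y (i - j))
      with ((sinh_const y * exp_nat y (i - j)) * (sinh_const y * exp_nat y (i + j))) by ring.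
    pose proof (sinh_const_pos y Hy). pose proof (exp_nat_pos y (i - j)). pose proof (exp_nat_pos y (i + j)).
    apply Rmult_le_compat. nra. nra. apply sinh_lower; auto; lia. apply sinh_lower; auto; lia. }
  unfold nat_dist. destruct (lt_dec n m) as [H|H].
  - replace (n - m)%nat with 0%nat by lia. rewrite Nat.add_0_r.
    apply Rle_trans with (1 := Hgen m n H). apply Rle_abs.
  - replace (m - n)%nat with 0%nat by lia. rewrite Nat.add_0_l.
    rewrite Rabs_minus_sym, (Nat.add_comm m n).
    apply Rle_trans with (1 := Hgen n m ltac:(lia)). apply Rle_abs.
Qed.

Lemma sinh_sq_diff_neq y m n : 0 < y -> m <> n -> sinh_sq y m - sinh_sq y n <> 0.
Proof.
  intros Hy Hne E. pose proof (sinh_sq_diff_lower y m n Hy Hne) as H. rewrite E, Rabs_R0 in H.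
  assert (0 < sinh_const y ^ 2 * exp_nat y (m + n) * exp_nat y (nat_dist m n)); [|lra].
  pose proof (sinh_const_pos y Hy). pose proof (exp_nat_pos y (m+n)). pose proof (exp_nat_pos y (nat_dist m n)).
  apply Rmult_lt_0_compat; auto. apply Rmult_lt_0_compat; auto. apply pow_lt; auto.
Qed.

(** The common growth condition of the three residue sequences. *)
Definition exp_bounded (y : R) (a : nat -> R) : Prop := forall m, Rabs (a m) <= exp_nat y m.

Lemma exp_nat_ge_1 y m : 0 < y -> 1 <= exp_nat y m.
Proof.
  intros Hy. destruct m. rewrite exp_nat_0; lra. left; apply exp_nat_gt_1; auto; lia.
Qed.

Lemma cosh_le_exp_nat y m : 0 < y -> cosh (INR m * y) <= exp_nat y m.
Proof.
  intros Hy. rewrite cosh_exp_nat. fold (nome_pow y m). pose proof (nome_pow_le_1 y m Hy).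
  pose proof (exp_nat_ge_1 y m Hy). lra.
Qed.

Lemma cosh_ge_1 x : 1 <= cosh x.
Proof.
  unfold cosh. rewrite exp_Ropp. pose proof (exp_pos x).
  replace ((exp x + / exp x) / 2) with (1 + (exp x - 1) ^ 2 / (2 * exp x)) by (field; lra).
  assert (0 <= (exp x - 1) ^ 2 / (2 * exp x)); [|lra].
  apply Rmult_le_pos. apply pow2_ge_0. left; apply Rinv_0_lt_compat; lra.
Qed.

Lemma exp_bounded_ns y : 0 < y -> exp_bounded y (res_ns y).
Proof.
  intros Hy m. unfold res_ns. rewrite Rabs_pos_eq. apply cosh_le_exp_nat; auto.
  pose proof (cosh_ge_1 (INR m * y)); lra.
Qed.

Lemma exp_bounded_cs y : 0 < y -> exp_bounded y (res_cs y).
Proof. intros Hy m. unfold res_cs. rewrite pow_1_abs. apply exp_nat_ge_1; auto. Qed.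

Lemma exp_bounded_ds y : 0 < y -> exp_bounded y (res_ds y).
Proof.
  intros Hy m. unfold res_ds. rewrite Rabs_mult, pow_1_abs, Rmult_1_l. apply exp_bounded_ns; auto.
Qed.

Lemma pole_bound y X : 0 < y -> X < sinh_sq y 1 -> exists C, 0 < C /\
  forall x m, x <= X -> (1 <= m)%nat ->
  0 < sinh_sq y m - x /\ / (sinh_sq y m - x) <= C * nome_pow y m ^ 2.
Proof.
  intros Hy HX.
  set (t := Rmax X 0 / sinh_sq y 1).
  assert (H1 : 0 < sinh_sq y 1) by (apply sinh_sq_pos; auto).
  assert (Ht : 0 <= t < 1).
  { unfold t. split. apply Rmult_le_pos. apply Rmax_r. left; apply Rinv_0_lt_compat; auto.
    apply Rlt_div_l; auto. rewrite Rmult_1_l. apply Rmax_lub_lt; auto. }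
  pose proof (sinh_const_pos y Hy) as Hk.
  exists (/ ((1 - t) * sinh_const y ^ 2)). split.
  { apply Rinv_0_lt_compat. apply Rmult_lt_0_compat. lra. apply pow_lt; auto. }
  intros x m Hx Hm.
  assert (Hge : (1 - t) * sinh_sq y m <= sinh_sq y m - x).
  { assert (x <= t * sinh_sq y 1).
    { unfold t. replace (Rmax X 0 / sinh_sq y 1 * sinh_sq y 1) with (Rmax X 0) by (field; lra).
      pose proof (Rmax_l X 0). lra. }
    assert (t * sinh_sq y 1 <= t * sinh_sq y m) by (apply Rmult_le_compat_l; [lra|apply sinh_sq_incr; auto]).
    lra. }
  pose proof (sinh_sq_pos y m Hy Hm) as Hs.
  assert (Hpos : 0 < (1 - t) * sinh_sq y m) by (apply Rmult_lt_0_compat; lra).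
  split. lra.
  unfold nome_pow. rewrite pow_inv, <- Rinv_mult.
  pose proof (sinh_sq_lower y m Hy Hm).
  pose proof (exp_nat_pos y m).
  apply Rinv_le_contravar.
  - apply Rmult_lt_0_compat. apply Rmult_lt_0_compat. lra. apply pow_lt; auto. apply pow_lt; auto.
  - apply Rle_trans with (2 := Hge). rewrite Rmult_assoc. apply Rmult_le_compat_l; lra.
Qed.

(** The poles are at [n >= 1] only; the pole at the origin is treated apart because it
    has half the weight of the others. *)
Definition poles (y : R) (j : nat) (a : nat -> R) (x : R) : R :=
  Series (fun n => a (S n) / (sinh_sq y (S n) - x) ^ j).

(** Uniform on half lines to the left of the first pole, whence uniform convergence
    near any point there, the origin included. *)
Lemma poles_term_bound y X : 0 < y -> X < sinh_sq y 1 -> exists K, 0 <= K /\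
  forall a j x m, exp_bounded y a -> (1 <= j <= 3)%nat -> (1 <= m)%nat -> x <= X ->
  Rabs (a m / (sinh_sq y m - x) ^ j) <= K * nome_pow y m.
Proof.
  intros Hy HX. destruct (pole_bound y X Hy HX) as [C [HC HB]].
  exists (C + C ^ 2 + C ^ 3).
  assert (H2 : 0 < C ^ 2) by (apply pow_lt; auto).
  assert (H3 : 0 < C ^ 3) by (apply pow_lt; auto).
  split. lra.
  intros a j x m Ha Hj Hm Hx.
  destruct (HB x m Hx Hm) as [Hp Hle].
  pose proof (nome_pow_pos y m) as Hq. pose proof (nome_pow_le_1 y m Hy) as Hq1.
  pose proof (nome_pow_exp_nat y m) as Hqe. pose proof (exp_nat_pos y m) as He.
  unfold Rdiv. rewrite Rabs_mult, <- pow_inv, <- RPow_abs.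
  rewrite (Rabs_pos_eq (/ _)) by (left; apply Rinv_0_lt_compat; auto).
  assert (Hi : 0 <= / (sinh_sq y m - x)) by (left; apply Rinv_0_lt_compat; auto).
  assert (Hgen : Rabs (a m) * (/ (sinh_sq y m - x)) ^ j <= exp_nat y m * (C * nome_pow y m ^ 2) ^ j).
  { apply Rmult_le_compat. apply Rabs_pos. apply pow_le; auto. apply Ha. apply pow_incr; auto. }
  apply Rle_trans with (1 := Hgen).
  assert (Hq3 : nome_pow y m ^ 2 <= 1) by nra.
  assert (Hj' : (j = 1 \/ j = 2 \/ j = 3)%nat) by lia.
  destruct Hj' as [-> |[-> | ->]].
  - replace (exp_nat y m * (C * nome_pow y m ^ 2) ^ 1) with (C * nome_pow y m * (nome_pow y m * exp_nat y m)) by ring.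
    rewrite Hqe, Rmult_1_r. nra.
  - replace (exp_nat y m * (C * nome_pow y m ^ 2) ^ 2) with (C ^ 2 * nome_pow y m * (nome_pow y m * exp_nat y m) * nome_pow y m ^ 2) by ring.
    rewrite Hqe, Rmult_1_r.
    apply Rle_trans with (C ^ 2 * nome_pow y m * 1). apply Rmult_le_compat_l; auto. nra. nra.
  - replace (exp_nat y m * (C * nome_pow y m ^ 2) ^ 3) with (C ^ 3 * nome_pow y m * (nome_pow y m * exp_nat y m) * (nome_pow y m ^ 2 * nome_pow y m ^ 2)) by ring.
    rewrite Hqe, Rmult_1_r.
    apply Rle_trans with (C ^ 3 * nome_pow y m * 1). apply Rmult_le_compat_l; auto. nra. nra. nra.
Qed.

Lemma ex_poles y a j x : 0 < y -> exp_bounded y a -> (1 <= j <= 3)%nat -> x < sinh_sq y 1 ->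
  ex_series (fun n => a (S n) / (sinh_sq y (S n) - x) ^ j).
Proof.
  intros Hy Ha Hj Hx. destruct (poles_term_bound y x Hy Hx) as [K [HK HB]].
  apply ex_series_dominated with (fun n => K * nome_pow y (S n)).
  - intros n. apply HB; auto; try lia; lra.
  - apply ex_series_scal_R. apply ex_series_nome_pow_S; auto.
Qed.

Lemma is_derive_poles y a j x : 0 < y -> exp_bounded y a -> (1 <= j <= 2)%nat -> x < sinh_sq y 1 ->
  is_derive (poles y j a) x (INR j * poles y (S j) a x).
Proof.
  intros Hy Ha Hj Hx.
  set (X := (x + sinh_sq y 1) / 2). assert (HX : X < sinh_sq y 1) by (unfold X; lra).
  destruct (poles_term_bound y X Hy HX) as [K [HK HB]].
  unfold poles at 2. rewrite <- Series_scal_l.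
  apply (is_derive_Series (fun n t => a (S n) / (sinh_sq y (S n) - t) ^ j)
    (fun n t => INR j * (a (S n) / (sinh_sq y (S n) - t) ^ (S j)))
    (fun n => INR j * (K * nome_pow y (S n))) x (X - x)).
  - unfold X; lra.
  - apply ex_series_scal_R, ex_series_scal_R, ex_series_nome_pow_S; auto.
  - intros t Ht. apply Rabs_lt_between in Ht. apply ex_poles; auto; try lia; lra.
  - intros n t Ht. apply Rabs_lt_between in Ht.
    assert (Hp : 0 < sinh_sq y (S n) - t).
    { pose proof (sinh_sq_incr y 1 (S n) Hy ltac:(lia)). lra. }
    assert (Hj' : (j = 1 \/ j = 2)%nat) by lia.
    destruct Hj' as [-> | ->]; auto_derive; simpl; try (field; lra); 
     repeat split; apply Rgt_not_eq; nra.
  - intros n t Ht. apply Rabs_lt_between in Ht.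
    rewrite Rabs_mult, (Rabs_pos_eq (INR j)) by apply pos_INR.
    apply Rmult_le_compat_l. apply pos_INR. apply HB; auto; try lia; lra.
Qed.

(** * Products of partial fractions *)

Lemma ratio_bound y : 0 < y -> exists K, 0 <= K /\
  forall a m, exp_bounded y a -> (1 <= m)%nat -> Rabs (a m / sinh_sq y m) <= K * nome_pow y m.
Proof.
  intros Hy. destruct (poles_term_bound y 0 Hy (sinh_sq_pos y 1 Hy (le_n 1))) as [K [HK HB]].
  exists K. split; auto. intros a m Ha Hm.
  specialize (HB a 1%nat 0 m Ha ltac:(lia) Hm ltac:(lra)).
  simpl in HB. rewrite Rminus_0_r, Rmult_1_r in HB. exact HB.
Qed.

Lemma ex_ratio y a : 0 < y -> exp_bounded y a -> ex_series (fun n => a (S n) / sinh_sq y (S n)).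
Proof.
  intros Hy Ha. destruct (ratio_bound y Hy) as [K [HK HB]].
  apply ex_series_dominated with (fun n => K * nome_pow y (S n)).
  intros n. apply HB; auto; lia.
  apply ex_series_scal_R, ex_series_nome_pow_S; auto.
Qed.

Lemma exp_bounded_const_1 y : 0 < y -> exp_bounded y (fun _ => 1).
Proof. intros Hy m. rewrite Rabs_R1. apply exp_nat_ge_1; auto. Qed.

Lemma sinh_sq_double y j : sinh_sq y (2 * j) = 4 * sinh_sq y j * cosh (INR j * y) ^ 2.
Proof.
  replace (2 * j)%nat with (j + j)%nat by lia.
  rewrite !sinh_sq_exp_nat, cosh_exp_nat, exp_nat_add. pose proof (exp_nat_pos y j). field. lra.
Qed.

(** With [u j] the square of [csch (j y)], the terms of index [2 j] are [u j - u (2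
    j)] and those of odd index [j] are [- u j], so the first [2 N] terms add up to
    minus the sum of [u] from [N + 1] to [2 N]. This removes an additive constant from
    the product formula. *)
Lemma residue_sum_zero y : 0 < y ->
  Series (fun n => (res_ns y (S n) + res_cs y (S n) + res_ds y (S n)) / sinh_sq y (S n)) = 0.
Proof.
  intros Hy.
  set (t := fun m => (res_ns y m + res_cs y m + res_ds y m) / sinh_sq y m).
  set (c := fun m => 1 / sinh_sq y m).
  assert (Hex : ex_series (fun n => t (S n))).
  { apply ex_series_ext_R with (fun n => res_ns y (S n) / sinh_sq y (S n)
       + (res_cs y (S n) / sinh_sq y (S n) + res_ds y (S n) / sinh_sq y (S n))).
    - intros n. unfold t. field. apply Rgt_not_eq, sinh_sq_pos; auto; lia.
    - apply ex_series_plus_R. apply ex_ratio; auto; apply exp_bounded_ns; auto.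
      apply ex_series_plus_R; apply ex_ratio; auto. apply exp_bounded_cs; auto. apply exp_bounded_ds; auto. }
  assert (Hc : ex_series (fun n => c (S n))) by (apply (ex_ratio y (fun _ => 1)); auto; apply exp_bounded_const_1; auto).
  assert (Hpart : forall N, sum_from_1 t (2 * N) = sum_from_1 c N - sum_from_1 c (2 * N)).
  { induction N as [|N IH]. simpl; ring.
    replace (2 * S N)%nat with (S (S (2 * N))) by lia.
    change (sum_from_1 t (2 * N) + t (S (2 * N)) + t (S (S (2 * N)))
      = (sum_from_1 c N + c (S N))
        - (sum_from_1 c (2 * N) + c (S (2 * N)) + c (S (S (2 * N))))).
    rewrite IH.
    assert (H1 : t (S (2 * N)) = - c (S (2 * N))).
    { unfold t, c, res_ns, res_cs, res_ds. rewrite pow_1_odd. field.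
      apply Rgt_not_eq, sinh_sq_pos; auto; lia. }
    assert (H2 : t (S (S (2 * N))) = c (S N) - c (S (S (2 * N)))).
    { unfold t, c, res_ns, res_cs, res_ds.
      replace (S (S (2 * N))) with (2 * S N)%nat by lia.
      rewrite pow_1_even, sinh_sq_double.
      assert (Hs : sinh_sq y (S N) = cosh (INR (S N) * y) ^ 2 - 1).
      { rewrite sinh_sq_exp_nat, cosh_exp_nat. pose proof (exp_nat_pos y (S N)). field. lra. }
      replace (cosh (INR (2 * S N) * y)) with (2 * cosh (INR (S N) * y) ^ 2 - 1).
      - pose proof (sinh_sq_pos y (S N) Hy ltac:(lia)). pose proof (cosh_ge_1 (INR (S N) * y)).
        rewrite Hs in *. field. split; nra.
      - replace (2 * S N)%nat with (S N + S N)%nat by lia. rewrite !cosh_exp_nat, exp_nat_add.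
        pose proof (exp_nat_pos y (S N)). field. lra. }
    rewrite H1, H2. ring. }
  assert (Hlim : forall f, ex_series (fun n => f (S n)) ->
     is_lim_seq (sum_from_1 f) (Series (fun n => f (S n)))).
  { intros f Hf. apply is_lim_seq_incr_1.
    apply is_lim_seq_ext with (fun N => sum_f_R0 (fun n => f (S n)) N).
    intros; apply sum_f_R0_shift. apply (is_lim_Series _ Hf). }
  pose proof (Hlim t Hex) as Ht. pose proof (Hlim c Hc) as Hcl.
  (* The two limits agree along the even partial sums. *)
  assert (Hphi : filterlim (fun N : nat => (2 * N)%nat) Hierarchy.eventually Hierarchy.eventually).
  { apply eventually_subseq. intros n. lia. }
  pose proof (is_lim_seq_subseq _ _ _ Hphi Ht) as Ht2.
  pose proof (is_lim_seq_subseq _ _ _ Hphi Hcl) as Hc2.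
  pose proof (is_lim_seq_minus' _ _ _ _ Hcl Hc2) as Hd.
  pose proof (is_lim_seq_ext _ _ _ Hpart Ht2) as Ht3.
  assert (E : Finite (Series (fun n => t (S n))) =
     Finite (Series (fun n => c (S n)) - Series (fun n => c (S n)))).
  { rewrite <- (is_lim_seq_unique _ _ Ht3). apply is_lim_seq_unique. exact Hd. }
  injection E. intros E'. change (Series (fun n => t (S n)) = 0). rewrite E'. ring.
Qed.

(** With the coefficients of ns and at [x = - (sin z)^2], multiplication by [- sin z]
    gives the sum of [csc (z + i m y)] over all integers [m]. *)
Definition partial_fractions (y : R) (a : nat -> R) (x : R) : R := 1 / x - 2 * poles y 1 a x.

(** One of the two simple poles into which a product of two distinct poles splits; the
    other one is [off_diag y b a x n m]. *)
Definition off_diag (y : R) (a b : nat -> R) (x : R) (m n : nat) : R :=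
  - (2 * x / (sinh_sq y m - x)) *
  (if Nat.eqb m n then 0 else 2 * (a m * b n) / (sinh_sq y m - sinh_sq y n)).

Lemma off_diag_bound y X : 0 < y -> X < sinh_sq y 1 -> exists K, 0 <= K /\
  forall a b m n, exp_bounded y a -> exp_bounded y b -> (1 <= m)%nat -> (1 <= n)%nat ->
  Rabs (off_diag y a b X m n) <= K * nome_pow y m * nome_pow y n.
Proof.
  intros Hy HX. destruct (pole_bound y X Hy HX) as [C [HC HB]].
  pose proof (sinh_const_pos y Hy) as Hk.
  assert (Hk2 : 0 < sinh_const y ^ 2) by (apply pow_lt; auto).
  exists (4 * Rabs X * C * / sinh_const y ^ 2).
  assert (HK : 0 <= 4 * Rabs X * C * / sinh_const y ^ 2).
  { apply Rmult_le_pos. pose proof (Rabs_pos X); nra. left; apply Rinv_0_lt_compat; auto. }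
  split; auto. intros a b m n Ha Hb Hm Hn. unfold off_diag.
  destruct (Nat.eqb_spec m n) as [E|Hne].
  - rewrite Rmult_0_r, Rabs_R0. pose proof (nome_pow_pos y m). pose proof (nome_pow_pos y n).
    apply Rmult_le_pos; [apply Rmult_le_pos|]; lra.
  - destruct (HB X m (Rle_refl X) Hm) as [Hp Hle].
    pose proof (nome_pow_pos y m) as Hqm. pose proof (nome_pow_pos y n) as Hqn.
    pose proof (exp_nat_pos y m) as Hem. pose proof (exp_nat_pos y n) as Hen.
    pose proof (sinh_sq_diff_lower y m n Hy Hne) as Hd.
    pose proof (exp_nat_pos y (m + n)) as Hemn. pose proof (exp_nat_pos y (nat_dist m n)) as Hed.
    assert (Hi : / Rabs (sinh_sq y m - sinh_sq y n) <= / sinh_const y ^ 2 * (nome_pow y m * nome_pow y n * nome_pow y (nat_dist m n))).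
    { rewrite <- nome_pow_add. unfold nome_pow. rewrite <- !Rinv_mult. apply Rinv_le_contravar.
      apply Rmult_lt_0_compat; auto. apply Rmult_lt_0_compat; auto.
      rewrite <- Rmult_assoc; auto. }
    assert (Hq : nome_pow y m * nome_pow y (nat_dist m n) <= nome_pow y n).
    { rewrite <- nome_pow_add. apply nome_pow_decr; auto. unfold nat_dist; lia. }
    assert (Hab : Rabs (a m * b n) <= exp_nat y m * exp_nat y n).
    { rewrite Rabs_mult. apply Rmult_le_compat; auto using Rabs_pos. }
    unfold Rdiv. rewrite Rabs_mult, Rabs_Ropp, !Rabs_mult, !Rabs_inv, (Rabs_pos_eq 2) by lra.
    rewrite (Rabs_pos_eq (sinh_sq y m - X)) by lra.
    rewrite <- (Rabs_mult (a m)).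
    apply Rle_trans with ((2 * Rabs X * (C * nome_pow y m ^ 2)) *
       (2 * (exp_nat y m * exp_nat y n) * (/ sinh_const y ^ 2 * (nome_pow y m * nome_pow y n * nome_pow y (nat_dist m n))))).
    + pose proof (Rabs_pos X). pose proof (Rabs_pos (a m * b n)).
      assert (0 <= / (sinh_sq y m - X)) by (left; apply Rinv_0_lt_compat; auto).
      assert (0 <= / Rabs (sinh_sq y m - sinh_sq y n)).
      { left; apply Rinv_0_lt_compat, Rabs_pos_lt, sinh_sq_diff_neq; auto. }
      apply Rmult_le_compat.
      * apply Rmult_le_pos; auto. lra.
      * apply Rmult_le_pos; auto. lra.
      * apply Rmult_le_compat_l; auto. lra.
      * apply Rmult_le_compat; auto; lra.
    + replace ((2 * Rabs X * (C * nome_pow y m ^ 2)) *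
       (2 * (exp_nat y m * exp_nat y n) * (/ sinh_const y ^ 2 * (nome_pow y m * nome_pow y n * nome_pow y (nat_dist m n)))))
       with ((4 * Rabs X * C * / sinh_const y ^ 2) * (nome_pow y m * (nome_pow y m * exp_nat y m) * (nome_pow y n * exp_nat y n) * (nome_pow y m * nome_pow y (nat_dist m n)))) by ring.
      rewrite !nome_pow_exp_nat, !Rmult_1_r, (Rmult_assoc _ (nome_pow y m)).
      apply Rmult_le_compat_l; auto. apply Rmult_le_compat_l; auto. lra.
Qed.

(** Expand the product, split every term with [m <> n] into two simple poles and sum
    over the other index first. The double poles are the diagonal terms. *)
Lemma partial_fractions_product y a b c x :
  0 < y -> x < sinh_sq y 1 -> x <> 0 ->
  exp_bounded y a -> exp_bounded y b -> exp_bounded y c -> residue_triple y a b c ->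
  Series (fun n => (a (S n) + b (S n) + c (S n)) / sinh_sq y (S n)) = 0 ->
  is_series (fun n => 2 * c (S n) / (sinh_sq y (S n) - x)
                      + 4 * x * (a (S n) * b (S n)) / (sinh_sq y (S n) - x) ^ 2)
    (x * partial_fractions y a x * partial_fractions y b x - 1 / x).
Proof.
  intros Hy Hx Hx0 Ha Hb Hc Htr Hsum.
  assert (Hsp : forall n, 0 < sinh_sq y (S n)) by (intros; apply sinh_sq_pos; auto; lia).
  assert (Hsx : forall n, 0 < sinh_sq y (S n) - x).
  { intros n. pose proof (sinh_sq_incr y 1 (S n) Hy ltac:(lia)). lra. }
  assert (HP : forall f, exp_bounded y f -> ex_series (fun n => f (S n) / (sinh_sq y (S n) - x))).
  { intros f Hf. apply ex_series_ext_R with (fun n => f (S n) / (sinh_sq y (S n) - x) ^ 1).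
    intros n; rewrite pow_1; auto. apply ex_poles; auto. }
  assert (HPe : forall f, poles y 1 f x = Series (fun n => f (S n) / (sinh_sq y (S n) - x))).
  { intros f. apply Series_ext. intros n. rewrite pow_1; auto. }
  destruct (off_diag_bound y x Hy Hx) as [K [HK HB]].
  assert (Hqs : ex_series (fun n => nome_pow y (S n))) by (apply ex_series_nome_pow_S; auto).
  assert (HKq : ex_series (fun n => K * nome_pow y (S n))) by (apply ex_series_scal_R; auto).
  assert (HoB : forall f g m n, exp_bounded y f -> exp_bounded y g ->
      Rabs (off_diag y f g x (S m) (S n)) <= K * nome_pow y (S m) * nome_pow y (S n)).
  { intros; apply HB; auto; lia. }
  assert (Hrow : forall f g m, exp_bounded y f -> exp_bounded y g ->
      ex_series (fun n => off_diag y f g x (S m) (S n))).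
  { intros f g m Hf Hg. apply ex_series_dominated with (fun n => K * nome_pow y (S m) * nome_pow y (S n)).
    intros n; auto. apply ex_series_scal_R; auto. }
  assert (Hcol : forall f g m, exp_bounded y f -> exp_bounded y g ->
      ex_series (fun n => off_diag y f g x (S n) (S m))).
  { intros f g m Hf Hg. apply ex_series_dominated with (fun n => K * nome_pow y (S m) * nome_pow y (S n)).
    intros n. rewrite Rmult_assoc, (Rmult_comm (nome_pow y (S m))), <- Rmult_assoc. auto.
    apply ex_series_scal_R; auto. }
  assert (Hdbl : forall f g, exp_bounded y f -> exp_bounded y g ->
      ex_series (fun m => Series (fun n => off_diag y f g x (S m) (S n)))).
  { intros f g Hf Hg.
    apply ex_series_dominated with (fun m => Series (fun n => nome_pow y (S n)) * (K * nome_pow y (S m))).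
    - intros m. rewrite Rmult_comm, <- Series_scal_l. apply Rabs_Series_le. auto.
      apply ex_series_scal_R; auto.
    - apply ex_series_scal_R; auto. }
  assert (Hdbl' : forall f g, exp_bounded y f -> exp_bounded y g ->
      ex_series (fun m => Series (fun n => off_diag y f g x (S n) (S m)))).
  { intros f g Hf Hg.
    apply ex_series_dominated with (fun m => Series (fun n => K * nome_pow y (S n)) * nome_pow y (S m)).
    - intros m. rewrite <- Series_scal_r. apply Rabs_Series_le. auto.
      apply ex_series_ext_R with (fun n => nome_pow y (S m) * (K * nome_pow y (S n))).
      intros; ring.
      apply ex_series_scal_R; auto.
    - apply ex_series_scal_R; auto. }
  (* With sigma_m the poles, the product of 1 / (sigma_m - x) and 1 / (sigma_n - x) is their
     difference divided by sigma_n - sigma_m; each of the two parts is summed over the other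
     index, for which the order of summation has to be exchanged in one of them. *)
  set (diag := fun m => 4 * x * (a (S m) * b (S m)) / (sinh_sq y (S m) - x) ^ 2).
  assert (Hrowsum : forall m,
     4 * x * (a (S m) / (sinh_sq y (S m) - x)) * Series (fun n => b (S n) / (sinh_sq y (S n) - x))
     = diag m + Series (fun n => off_diag y a b x (S m) (S n) + off_diag y b a x (S n) (S m))).
  { intros m. rewrite <- Series_scal_l.
    set (F := fun n => 4 * x * (a (S m) / (sinh_sq y (S m) - x)) * (b (S n) / (sinh_sq y (S n) - x))).
    set (Gt := fun n => off_diag y a b x (S m) (S n) + off_diag y b a x (S n) (S m)).
    assert (Hdel : is_series (fun n => if Nat.eqb n m then diag m else 0) (diag m)).
    { apply (is_lim_seq_ext_loc (fun _ => diag m) (sum_n (fun n => if Nat.eqb n m then diag m else 0)) (diag m)).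
      2: apply is_lim_seq_const.
      exists m. intros N HN. symmetry. rewrite sum_n_Reals.
      assert (Hlow : forall i, (i < m)%nat -> sum_f_R0 (fun n => if Nat.eqb n m then diag m else 0) i = 0).
      { intros i Hi. rewrite (sum_eq _ (fun _ => 0)). rewrite sum_cte; ring.
        intros j Hj. replace (Nat.eqb j m) with false; auto. symmetry; apply Nat.eqb_neq; lia. }
      induction N as [|N IH].
      - replace m with 0%nat by lia. simpl. auto.
      - rewrite tech5. destruct (Nat.eqb_spec (S N) m) as [E|E].
        + rewrite Hlow by lia. ring.
        + rewrite IH by lia. ring. }
    assert (HF : forall n, F n = (if Nat.eqb n m then diag m else 0) + Gt n).
    { intros n. unfold F, Gt, diag, off_diag.
      pose proof (Hsx m). pose proof (Hsx n).
      destruct (Nat.eqb_spec n m) as [->|Hne].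
      - rewrite Nat.eqb_refl. field. lra.
      - replace (Nat.eqb (S m) (S n)) with false by (symmetry; apply Nat.eqb_neq; lia).
        replace (Nat.eqb (S n) (S m)) with false by (symmetry; apply Nat.eqb_neq; lia).
        assert (sinh_sq y (S m) - sinh_sq y (S n) <> 0) by (apply sinh_sq_diff_neq; auto).
        field. repeat split; lra. }
    rewrite (Series_ext F _ HF), Series_plus.
    - f_equal. apply is_series_unique. exact Hdel.
    - exists (diag m); auto.
    - apply ex_series_plus_R; auto. }
  assert (HexA : ex_series (fun m => 4 * x * (a (S m) / (sinh_sq y (S m) - x)) *
       Series (fun n => b (S n) / (sinh_sq y (S n) - x)))).
  { apply ex_series_ext_R with (fun m => (4 * x * Series (fun n => b (S n) / (sinh_sq y (S n) - x)))
       * (a (S m) / (sinh_sq y (S m) - x))). intros; ring.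
    apply ex_series_scal_R; auto. }
  assert (Hexod : ex_series (fun m => Series (fun n => off_diag y a b x (S m) (S n) + off_diag y b a x (S n) (S m)))).
  { apply ex_series_ext_R with (fun m => Series (fun n => off_diag y a b x (S m) (S n))
       + Series (fun n => off_diag y b a x (S n) (S m))).
    intros m. rewrite Series_plus; auto. apply ex_series_plus_R; auto. }
  assert (Hexd : ex_series diag).
  { apply ex_series_ext_R with (fun m => 4 * x * (a (S m) / (sinh_sq y (S m) - x)) *
       Series (fun n => b (S n) / (sinh_sq y (S n) - x)) + (-1) *
       Series (fun n => off_diag y a b x (S m) (S n) + off_diag y b a x (S n) (S m))).
    intros m. rewrite Hrowsum. unfold diag; ring.
    apply ex_series_plus_R; auto. apply ex_series_scal_R; auto. }
  assert (Hprod : 4 * x * poles y 1 a x * poles y 1 b x =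
     Series diag + Series (fun m => Series (fun n => off_diag y a b x (S m) (S n) + off_diag y b a x (S n) (S m)))).
  { rewrite <- Series_plus by auto.
    rewrite <- (Series_ext _ _ Hrowsum). rewrite Series_scal_r, Series_scal_l, !HPe. ring. }
  assert (Hod : Series (fun m => Series (fun n => off_diag y a b x (S m) (S n) + off_diag y b a x (S n) (S m)))
     = 2 * poles y 1 a x + 2 * poles y 1 b x + 2 * poles y 1 c x).
  { transitivity (Series (fun m => Series (fun n => off_diag y a b x (S m) (S n)))
       + Series (fun m => Series (fun n => off_diag y b a x (S n) (S m)))).
    { rewrite <- Series_plus by auto. apply Series_ext. intros m. apply Series_plus; auto. }
    rewrite <- (Series_swap (fun n m => off_diag y b a x (S n) (S m)) (fun n => K * nome_pow y (S n)) (fun n => nome_pow y (S n))); auto.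
    2:{ intros n. pose proof (nome_pow_pos y (S n)). apply Rmult_le_pos; lra. }
    rewrite <- Series_plus by auto.
    transitivity (Series (fun m => 2 * (a (S m) / (sinh_sq y (S m) - x)) + (2 * (b (S m) / (sinh_sq y (S m) - x))
       + (2 * (c (S m) / (sinh_sq y (S m) - x)) + (-2) * ((a (S m) + b (S m) + c (S m)) / sinh_sq y (S m)))))).
    - apply Series_ext. intros m. rewrite <- Series_plus by auto.
      transitivity (Series (fun n => - (2 * x / (sinh_sq y (S m) - x)) * cross_term y a b (S m) (S n))).
      + apply Series_ext. intros n. unfold off_diag, cross_term.
        destruct (Nat.eqb_spec (S m) (S n)) as [E|E]. ring.
        assert (sinh_sq y (S m) - sinh_sq y (S n) <> 0) by (apply sinh_sq_diff_neq; auto).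
        pose proof (Hsx m). field. split; lra.
      + rewrite Series_scal_l, (is_series_unique _ _ (Htr (S m) ltac:(lia))).
        pose proof (Hsx m). pose proof (Hsp m). field. split; lra.
    - assert (Hz : ex_series (fun m => (-2) * ((a (S m) + b (S m) + c (S m)) / sinh_sq y (S m)))).
      { apply ex_series_scal_R.
        apply ex_series_ext_R with (fun n => a (S n) / sinh_sq y (S n)
          + (b (S n) / sinh_sq y (S n) + c (S n) / sinh_sq y (S n))).
        intros n. pose proof (Hsp n). field. lra.
        apply ex_series_plus_R. apply ex_ratio; auto. apply ex_series_plus_R; apply ex_ratio; auto. }
      assert (H3 : forall f, exp_bounded y f -> ex_series (fun m => 2 * (f (S m) / (sinh_sq y (S m) - x)))).
      { intros f Hf. apply ex_series_scal_R; auto. }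
      rewrite !Series_plus; auto using ex_series_plus_R.
      rewrite !Series_scal_l, Hsum, !HPe. ring. }
  assert (Hval : x * partial_fractions y a x * partial_fractions y b x - 1 / x = 2 * poles y 1 c x + Series diag).
  { unfold partial_fractions.
    transitivity (4 * x * poles y 1 a x * poles y 1 b x - 2 * poles y 1 a x - 2 * poles y 1 b x).
    field; auto. rewrite Hprod, Hod. ring. }
  rewrite Hval.
  apply (is_series_ext_R (fun n => 2 * (c (S n) / (sinh_sq y (S n) - x)) + diag n)).
  { intros n. unfold diag. assert (E : 2 * (c (S n) / (sinh_sq y (S n) - x)) = 2 * c (S n) / (sinh_sq y (S n) - x)).
    unfold Rdiv; ring. rewrite E. reflexivity. }
  rewrite HPe, <- Series_scal_l.
  apply (is_series_plus (fun n => 2 * (c (S n) / (sinh_sq y (S n) - x))) diag);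
    apply Series_correct; auto using ex_series_scal_R.
Qed.

(** * The differential system and its first integrals *)

Ltac rewrite_Derive f x l H :=
  replace (Derive (fun u : R => f u) x) with l
    by (symmetry; apply is_derive_unique; exact H).

Definition partial_fractions_deriv (y : R) (a : nat -> R) (x : R) : R :=
  - (1 / x ^ 2) - 2 * poles y 2 a x.

Lemma is_derive_partial_fractions y a x :
  0 < y -> exp_bounded y a -> x < sinh_sq y 1 -> x <> 0 ->
  is_derive (partial_fractions y a) x (partial_fractions_deriv y a x).
Proof.
  intros Hy Ha Hx Hx0. unfold partial_fractions, partial_fractions_deriv.
  assert (Hd : is_derive (poles y 1 a) x (poles y 2 a x)).
  { pose proof (is_derive_poles y a 1 x Hy Ha ltac:(lia) Hx) as H.
    simpl INR in H. rewrite Rmult_1_l in H. exact H. }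
  auto_derive.
  - repeat split; auto. exists (poles y 2 a x); auto.
  - replace (Derive (fun x0 => poles y 1 a x0) x) with (poles y 2 a x)
      by (symmetry; apply is_derive_unique; exact Hd).
    field; auto.
Qed.

Lemma poles_1 y a x : poles y 1 a x = Series (fun n => a (S n) / (sinh_sq y (S n) - x)).
Proof. apply Series_ext. intros n. rewrite pow_1; auto. Qed.

Lemma sinh_sq_gt y x n : 0 < y -> x < sinh_sq y 1 -> 0 < sinh_sq y (S n) - x.
Proof. intros Hy Hx. pose proof (sinh_sq_incr y 1 (S n) Hy ltac:(lia)). lra. Qed.

Lemma product_poles y a b c x (s t : R) :
  0 < y -> x < sinh_sq y 1 -> x <> 0 ->
  exp_bounded y a -> exp_bounded y b -> exp_bounded y c -> residue_triple y a b c ->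
  Series (fun n => (a (S n) + b (S n) + c (S n)) / sinh_sq y (S n)) = 0 ->
  (forall n, 2 * c (S n) / (sinh_sq y (S n) - x)
      + 4 * x * (a (S n) * b (S n)) / (sinh_sq y (S n) - x) ^ 2
     = s * (c (S n) / (sinh_sq y (S n) - x) ^ 1) + t * (c (S n) / (sinh_sq y (S n) - x) ^ 2)) ->
  x * partial_fractions y a x * partial_fractions y b x = 1 / x + s * poles y 1 c x + t * poles y 2 c x.
Proof.
  intros Hy Hx Hx0 Ha Hb Hc Ht Hs Hterm.
  pose proof (is_series_unique _ _ (partial_fractions_product y a b c x Hy Hx Hx0 Ha Hb Hc Ht Hs)) as H.
  assert (E : Series (fun n => 2 * c (S n) / (sinh_sq y (S n) - x)
      + 4 * x * (a (S n) * b (S n)) / (sinh_sq y (S n) - x) ^ 2)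
      = s * poles y 1 c x + t * poles y 2 c x).
  { rewrite (Series_ext _ _ Hterm), Series_plus.
    - rewrite !Series_scal_l. auto.
    - apply ex_series_scal_R, ex_poles; auto.
    - apply ex_series_scal_R, ex_poles; auto. }
  assert (H' : x * partial_fractions y a x * partial_fractions y b x - 1 / x = s * poles y 1 c x + t * poles y 2 c x)
    by (rewrite <- E; symmetry; exact H).
  lra.
Qed.

Definition ns_frac y := partial_fractions y (res_ns y).
Definition ds_frac y := partial_fractions y (res_ds y).
Definition cs_frac y := partial_fractions y (res_cs y).
Definition ns_frac_deriv y := partial_fractions_deriv y (res_ns y).
Definition ds_frac_deriv y := partial_fractions_deriv y (res_ds y).
Definition cs_frac_deriv y := partial_fractions_deriv y (res_cs y).

(** In the variable [z] this is [ns' = - cs * ds]; the factor [x] and the term without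
    derivative come from [x = - (sin z)^2]. *)
Lemma ode_ns_frac y x : 0 < y -> x < sinh_sq y 1 -> x <> 0 ->
  ns_frac y x + 2 * x * ns_frac_deriv y x = - (x * cs_frac y x * ds_frac y x).
Proof.
  intros Hy Hx Hx0. unfold cs_frac, ds_frac.
  rewrite (product_poles y _ _ (res_ns y) x 2 (4 * x)); auto using exp_bounded_cs, exp_bounded_ds, exp_bounded_ns, residue_triple_cs_ds_ns.
  - unfold ns_frac, ns_frac_deriv, partial_fractions, partial_fractions_deriv. field; auto.
  - rewrite <- (residue_sum_zero y Hy). apply Series_ext. intros n. f_equal. ring.
  - intros n. pose proof (sinh_sq_gt y x n Hy Hx). unfold res_cs, res_ds, res_ns.
    destruct (sign_cases (S n)) as [-> | ->]; field; lra.
Qed.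

Lemma ode_ds_frac y x : 0 < y -> x < sinh_sq y 1 -> x <> 0 ->
  ds_frac y x + 2 * x * ds_frac_deriv y x = - (x * ns_frac y x * cs_frac y x).
Proof.
  intros Hy Hx Hx0. unfold ns_frac, cs_frac.
  rewrite (product_poles y _ _ (res_ds y) x 2 (4 * x)); auto using exp_bounded_cs, exp_bounded_ds, exp_bounded_ns, residue_triple_ns_cs_ds.
  - unfold ds_frac, ds_frac_deriv, partial_fractions, partial_fractions_deriv. field; auto.
  - apply residue_sum_zero; auto.
  - intros n. pose proof (sinh_sq_gt y x n Hy Hx). unfold res_cs, res_ds, res_ns.
    destruct (sign_cases (S n)) as [-> | ->]; field; lra.
Qed.

Lemma cosh_sq_nat y m : cosh (INR m * y) ^ 2 = 1 + sinh_sq y m.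
Proof. rewrite sinh_sq_exp_nat, cosh_exp_nat. pose proof (exp_nat_pos y m). field. lra. Qed.

Lemma ode_cs_frac y x : 0 < y -> x < sinh_sq y 1 -> x <> 0 ->
  (1 + 2 * x) * cs_frac y x + 2 * x * (1 + x) * cs_frac_deriv y x = - (x * ns_frac y x * ds_frac y x).
Proof.
  intros Hy Hx Hx0. unfold ns_frac, ds_frac.
  rewrite (product_poles y _ _ (res_cs y) x (2 + 4 * x) (4 * x * (1 + x)));
    auto using exp_bounded_cs, exp_bounded_ds, exp_bounded_ns, residue_triple_ns_ds_cs.
  - unfold cs_frac, cs_frac_deriv, partial_fractions, partial_fractions_deriv. field; auto.
  - rewrite <- (residue_sum_zero y Hy). apply Series_ext. intros n. f_equal. ring.
  - intros n. pose proof (sinh_sq_gt y x n Hy Hx). unfold res_cs, res_ds, res_ns.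
    replace (cosh (INR (S n) * y) * ((-1) ^ S n * cosh (INR (S n) * y)))
      with ((-1) ^ S n * cosh (INR (S n) * y) ^ 2) by ring.
    rewrite cosh_sq_nat. field; lra.
Qed.

(** The value of [ns^2 - ds^2] at [x = 0], where the poles at the origin cancel;
    [alpha_sq] is that of [ns^2 - cs^2]. *)
Definition beta_sq (y : R) : R := 4 * (poles y 1 (res_ns y) 0 - poles y 1 (res_ds y) 0).
Definition alpha_sq (y : R) : R := 1 + 4 * (poles y 1 (res_ns y) 0 - poles y 1 (res_cs y) 0).

Lemma is_derive_poles_1 y a x : 0 < y -> exp_bounded y a -> x < sinh_sq y 1 ->
  is_derive (poles y 1 a) x (poles y 2 a x).
Proof.
  intros Hy Ha Hx. pose proof (is_derive_poles y a 1 x Hy Ha ltac:(lia) Hx) as H.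
  simpl INR in H. rewrite Rmult_1_l in H. exact H.
Qed.

(** The differential equations hold only away from the pole at the origin, but the
    first integrals extend across it; this is what ties the real axis to the imaginary
    one. *)
Lemma constant_through_0 (F dF : R -> R) (s x : R) :
  0 < s -> x < s ->
  (forall t, t < s -> is_derive F t (dF t)) ->
  (forall t, t < s -> t <> 0 -> dF t = 0) -> F x = F 0.
Proof.
  intros Hs Hx Hd H0.
  destruct (MVT_gen F 0 x (fun _ => 0)) as [c [_ Hc]].
  - intros t Ht. assert (Hts : t < s /\ t <> 0).
    { unfold Rmin, Rmax in Ht; destruct (Rle_dec 0 x); lra. }
    rewrite <- (H0 t); try tauto. apply Hd. tauto.
  - intros t Ht. apply continuity_pt_filterlim.
    apply (@ex_derive_continuous R_AbsRing R_NormedModule). exists (dF t). apply Hd.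
    unfold Rmin, Rmax in Ht; destruct (Rle_dec 0 x); lra.
  - lra.
Qed.

Lemma ns_frac_ds_frac_constant y x : 0 < y -> x < sinh_sq y 1 -> x <> 0 ->
  x * (ns_frac y x ^ 2 - ds_frac y x ^ 2) = - beta_sq y.
Proof.
  intros Hy Hx Hx0.
  set (p := poles y 1 (res_ns y)). set (d := poles y 1 (res_ds y)).
  set (p2 := poles y 2 (res_ns y)). set (d2 := poles y 2 (res_ds y)).
  set (F := fun t => - 4 * (p t - d t) + 4 * t * (p t ^ 2 - d t ^ 2)).
  assert (E : forall t, t <> 0 -> t * (ns_frac y t ^ 2 - ds_frac y t ^ 2) = F t).
  { intros t Ht. unfold F, ns_frac, ds_frac, partial_fractions. fold p d. field; auto. }
  rewrite E by auto.
  assert (Hp : forall t, t < sinh_sq y 1 -> is_derive p t (p2 t)) by (intros; apply is_derive_poles_1; auto using exp_bounded_ns).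
  assert (Hdd : forall t, t < sinh_sq y 1 -> is_derive d t (d2 t)) by (intros; apply is_derive_poles_1; auto using exp_bounded_ds).
  replace (- beta_sq y) with (F 0) by (unfold F, beta_sq; fold p d; ring).
  apply (constant_through_0 F (fun t => - 4 * (p2 t - d2 t) + 4 * (p t ^ 2 - d t ^ 2)
      + 8 * t * (p t * p2 t - d t * d2 t)) (sinh_sq y 1)); auto.
  - apply sinh_sq_pos; auto.
  - intros t Ht. specialize (Hp t Ht). specialize (Hdd t Ht). unfold F. auto_derive.
    + repeat split; auto; eexists; eauto.
    + rewrite_Derive p t (p2 t) Hp; rewrite_Derive d t (d2 t) Hdd; ring.
  - intros t Ht Ht0.
    pose proof (ode_ns_frac y t Hy Ht Ht0) as H1. pose proof (ode_ds_frac y t Hy Ht Ht0) as H2.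
    assert (H3 : ns_frac y t * (ns_frac y t + 2 * t * ns_frac_deriv y t) - ds_frac y t * (ds_frac y t + 2 * t * ds_frac_deriv y t) = 0).
    { rewrite H1, H2. ring. }
    rewrite <- H3. unfold ns_frac, ds_frac, ns_frac_deriv, ds_frac_deriv, partial_fractions, partial_fractions_deriv. fold p d p2 d2. field; auto.
Qed.

Lemma ns_frac_cs_frac_constant y x : 0 < y -> x < sinh_sq y 1 -> x <> 0 ->
  x * (ns_frac y x ^ 2 - (1 + x) * cs_frac y x ^ 2) = - alpha_sq y.
Proof.
  intros Hy Hx Hx0.
  set (p := poles y 1 (res_ns y)). set (d := poles y 1 (res_cs y)).
  set (p2 := poles y 2 (res_ns y)). set (d2 := poles y 2 (res_cs y)).
  set (F := fun t => - 4 * p t + 4 * t * p t ^ 2 - 1 + 4 * d t * (1 + t) - 4 * t * (1 + t) * d t ^ 2).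
  assert (E : forall t, t <> 0 -> t * (ns_frac y t ^ 2 - (1 + t) * cs_frac y t ^ 2) = F t).
  { intros t Ht. unfold F, ns_frac, cs_frac, partial_fractions. fold p d. field; auto. }
  rewrite E by auto.
  assert (Hp : forall t, t < sinh_sq y 1 -> is_derive p t (p2 t)) by (intros; apply is_derive_poles_1; auto using exp_bounded_ns).
  assert (Hdd : forall t, t < sinh_sq y 1 -> is_derive d t (d2 t)) by (intros; apply is_derive_poles_1; auto using exp_bounded_cs).
  replace (- alpha_sq y) with (F 0) by (unfold F, alpha_sq; fold p d; ring).
  apply (constant_through_0 F (fun t => - 4 * p2 t + 4 * p t ^ 2 + 8 * t * p t * p2 t
      + 4 * d2 t * (1 + t) + 4 * d t - 4 * (1 + 2 * t) * d t ^ 2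
      - 8 * t * (1 + t) * d t * d2 t) (sinh_sq y 1)); auto.
  - apply sinh_sq_pos; auto.
  - intros t Ht. specialize (Hp t Ht). specialize (Hdd t Ht). unfold F. auto_derive.
    + repeat split; auto; eexists; eauto.
    + rewrite_Derive p t (p2 t) Hp; rewrite_Derive d t (d2 t) Hdd; ring.
  - intros t Ht Ht0.
    pose proof (ode_ns_frac y t Hy Ht Ht0) as H1. pose proof (ode_cs_frac y t Hy Ht Ht0) as H2.
    assert (H3 : ns_frac y t * (ns_frac y t + 2 * t * ns_frac_deriv y t)
       - cs_frac y t * ((1 + 2 * t) * cs_frac y t + 2 * t * (1 + t) * cs_frac_deriv y t) = 0).
    { rewrite H1, H2. ring. }
    rewrite <- H3. unfold ns_frac, cs_frac, ns_frac_deriv, cs_frac_deriv, partial_fractions, partial_fractions_deriv. fold p d p2 d2. field; auto.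
Qed.

Lemma Series_pos (a : nat -> R) : ex_series a -> (forall n, 0 <= a n) -> 0 < a 0%nat -> 0 < Series a.
Proof.
  intros Ha H H0. rewrite (Series_incr_1 a Ha).
  assert (0 <= Series (fun k => a (S k))); [|lra].
  replace 0 with (Series (fun k => 0 * a (S k))) by (rewrite Series_scal_l; ring).
  apply Series_le. intros n; specialize (H (S n)); split; lra.
  apply (ex_series_incr_1 a); auto.
Qed.

Lemma poles_diff_pos y a b : 0 < y -> exp_bounded y a -> exp_bounded y b ->
  (forall m, b (S m) <= a (S m)) -> b 1%nat < a 1%nat ->
  0 < poles y 1 a 0 - poles y 1 b 0.
Proof.
  intros Hy Ha Hb H H1. pose proof (sinh_sq_pos y 1 Hy (le_n 1)) as Hs.
  unfold poles. rewrite <- Series_minus by (apply ex_poles; auto).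
  assert (E : forall n, a (S n) / (sinh_sq y (S n) - 0) ^ 1 - b (S n) / (sinh_sq y (S n) - 0) ^ 1
     = (a (S n) - b (S n)) * / sinh_sq y (S n)).
  { intros n. pose proof (sinh_sq_pos y (S n) Hy ltac:(lia)). field; lra. }
  apply Series_pos.
  - apply ex_series_ext_R with (fun n => a (S n) / (sinh_sq y (S n) - 0) ^ 1 + (-1) * (b (S n) / (sinh_sq y (S n) - 0) ^ 1)).
    intros n; ring. apply ex_series_plus_R; [|apply ex_series_scal_R]; apply ex_poles; auto.
  - intros n. rewrite E. apply Rmult_le_pos. specialize (H n); lra.
    left; apply Rinv_0_lt_compat, sinh_sq_pos; auto; lia.
  - rewrite E. apply Rmult_lt_0_compat. lra. apply Rinv_0_lt_compat; auto.
Qed.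

Lemma beta_sq_pos y : 0 < y -> 0 < beta_sq y.
Proof.
  intros Hy. unfold beta_sq. apply Rmult_lt_0_compat. lra.
  apply poles_diff_pos; auto using exp_bounded_ns, exp_bounded_ds.
  - intros m. unfold res_ns, res_ds. pose proof (cosh_ge_1 (INR (S m) * y)).
    destruct (sign_cases (S m)) as [-> | ->]; lra.
  - unfold res_ns, res_ds. pose proof (cosh_ge_1 (INR 1 * y)). lra.
Qed.

Lemma alpha_sq_pos y : 0 < y -> 0 < alpha_sq y.
Proof.
  intros Hy. unfold alpha_sq.
  assert (0 < poles y 1 (res_ns y) 0 - poles y 1 (res_cs y) 0); [|lra].
  apply poles_diff_pos; auto using exp_bounded_ns, exp_bounded_cs.
  - intros m. unfold res_ns, res_cs. pose proof (cosh_ge_1 (INR (S m) * y)).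
    destruct (sign_cases (S m)) as [-> | ->]; lra.
  - unfold res_ns, res_cs. pose proof (cosh_ge_1 (INR 1 * y)). lra.
Qed.

(** * The incomplete elliptic integral of the first kind *)

Definition ellF (m t : R) : R := RInt (fun s => 1 / sqrt (1 - m * sin s ^ 2)) 0 t.

Lemma modulus_pos m s : m < 1 -> 0 < 1 - m * sin s ^ 2.
Proof.
  intros Hm. pose proof (sin2_cos2 s) as H. unfold Rsqr in H.
  assert (0 <= sin s ^ 2 <= 1) by (pose proof (pow2_ge_0 (cos s)); split; nra).
  destruct (Rle_dec m 0); nra.
Qed.

Lemma continuous_ellF_integrand m s : m < 1 ->
  continuous (fun s => 1 / sqrt (1 - m * sin s ^ 2)) s.
Proof.
  intros Hm. apply (@ex_derive_continuous R_AbsRing R_NormedModule).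
  pose proof (modulus_pos m s Hm) as H.
  auto_derive. simpl in H. split; auto. split; auto.
  apply Rgt_not_eq, sqrt_lt_R0. auto.
Qed.

Lemma is_derive_ellF m t : m < 1 -> is_derive (ellF m) t (1 / sqrt (1 - m * sin t ^ 2)).
Proof.
  intros Hm. unfold ellF.
  apply (is_derive_RInt (fun s => 1 / sqrt (1 - m * sin s ^ 2)) _ 0 t).
  - exists (mkposreal 1 Rlt_0_1). intros b _. apply (@RInt_correct R_CompleteNormedModule).
    apply (@ex_RInt_continuous R_CompleteNormedModule). intros; apply continuous_ellF_integrand; auto.
  - apply continuous_ellF_integrand; auto.
Qed.

Lemma ellF_0 m : ellF m 0 = 0.
Proof. unfold ellF. rewrite RInt_point. reflexivity. Qed.

Lemma ellF_incr m s t : m < 1 -> s < t -> ellF m s < ellF m t.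
Proof.
  intros Hm Hst.
  destruct (MVT_gen (ellF m) s t (fun u => 1 / sqrt (1 - m * sin u ^ 2))) as [c [_ Hc]].
  - intros; apply is_derive_ellF; auto.
  - intros u _. apply continuity_pt_filterlim, (@ex_derive_continuous R_AbsRing R_NormedModule).
    eexists; apply is_derive_ellF; auto.
  - assert (0 < 1 / sqrt (1 - m * sin c ^ 2)).
    { apply Rdiv_lt_0_compat. lra. apply sqrt_lt_R0, modulus_pos; auto. }
    nra.
Qed.

Lemma ellF_bound m t : 0 <= m < 1 -> 0 <= t -> 0 <= ellF m t <= / sqrt (1 - m) * t.
Proof.
  intros Hm Ht.
  destruct (MVT_gen (ellF m) 0 t (fun u => 1 / sqrt (1 - m * sin u ^ 2))) as [c [_ Hc]].
  - intros; apply is_derive_ellF; lra.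
  - intros u _. apply continuity_pt_filterlim, (@ex_derive_continuous R_AbsRing R_NormedModule).
    eexists; apply is_derive_ellF; lra.
  - rewrite ellF_0, !Rminus_0_r in Hc. rewrite Hc.
    assert (H1 : 0 < sqrt (1 - m)) by (apply sqrt_lt_R0; lra).
    pose proof (sin2_cos2 c) as H. unfold Rsqr in H.
    assert (sqrt (1 - m) <= sqrt (1 - m * sin c ^ 2)).
    { apply sqrt_le_1_alt. assert (0 <= cos c * cos c) by nra. nra. }
    assert (0 < / sqrt (1 - m * sin c ^ 2)) by (apply Rinv_0_lt_compat; lra).
    assert (/ sqrt (1 - m * sin c ^ 2) <= / sqrt (1 - m)) by (apply Rinv_le_contravar; auto).
    unfold Rdiv. rewrite Rmult_1_l. split. nra. apply Rmult_le_compat_r; auto.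
Qed.

Lemma atan_le u : 0 <= u -> 0 <= atan u <= u.
Proof.
  intros Hu.
  destruct (MVT_gen atan 0 u (fun x => / (1 + Rsqr x))) as [c [_ Hc]].
  - intros; apply is_derive_atan.
  - intros x _. apply continuity_pt_filterlim, continuous_atan.
  - rewrite atan_0, !Rminus_0_r in Hc. rewrite Hc.
    pose proof (Rle_0_sqr c).
    assert (0 < / (1 + Rsqr c)) by (apply Rinv_0_lt_compat; lra).
    assert (/ (1 + Rsqr c) <= 1) by (rewrite <- Rinv_1; apply Rinv_le_contravar; lra).
    split; nra.
Qed.

(** The angle [PI / 2 - atan (p / al)] starts at [0] where [p] has its pole and solves
    [t' = al * sqrt (1 - m (sin t)^2)] with [m = 1 - mu2 / al^2], so the elliptic
    integral grows at the rate [al]. It is used for cs on the real axis and for ns on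
    the imaginary one. *)
Lemma amplitude (p : R -> R) (b al mu2 : R) :
  0 < al -> 0 < mu2 <= al ^ 2 ->
  (forall z, 0 < z <= b -> is_derive p z (- (sqrt (p z ^ 2 + al ^ 2) * sqrt (p z ^ 2 + mu2)))) ->
  (exists C r, 0 < C /\ 0 < r /\ forall z, 0 < z < r -> C <= z * p z) ->
  forall z, 0 < z <= b -> ellF (1 - mu2 / al ^ 2) (PI / 2 - atan (p z / al)) = al * z.
Proof.
  intros Hal Hmu Hp [C [r [HC [Hr Hinf]]]] z Hz.
  set (m := 1 - mu2 / al ^ 2).
  assert (Hal2 : 0 < al ^ 2) by (apply pow_lt; auto).
  assert (Hm : 0 <= m < 1).
  { unfold m. assert (0 < mu2 / al ^ 2) by (apply Rdiv_lt_0_compat; lra).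
    assert (mu2 / al ^ 2 <= 1) by (apply Rle_div_l; lra). lra. }
  (* G is constant, and it is O(w) at the pole of p. *)
  set (G := fun w => ellF m (PI / 2 - atan (p w / al)) - al * w).
  assert (HG : forall w, 0 < w <= b -> is_derive G w 0).
  { intros w Hw. specialize (Hp w Hw). unfold G.
    pose proof (is_derive_ellF m (PI / 2 - atan (p w / al)) (proj2 Hm)) as HF.
    auto_derive.
    - split; [eexists; exact HF|]. split; auto. eexists; exact Hp.
    - replace (Derive (fun x => ellF m x) (PI / 2 + - atan (p w * / al)))
        with (1 / sqrt (1 - m * sin (PI / 2 - atan (p w / al)) ^ 2))
        by (symmetry; apply is_derive_unique; exact HF).
      replace (Derive (fun x => p x) w) with (- (sqrt (p w ^ 2 + al ^ 2) * sqrt (p w ^ 2 + mu2)))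
        by (symmetry; apply is_derive_unique; exact Hp).
      rewrite sin_shift, cos_atan. unfold Rsqr.
      set (q := p w) in *.
      assert (Hq : 0 <= q ^ 2) by apply pow2_ge_0.
      assert (Hs1 : 0 < sqrt (q ^ 2 + al ^ 2)) by (apply sqrt_lt_R0; lra).
      assert (Hs2 : 0 < sqrt (q ^ 2 + mu2)) by (apply sqrt_lt_R0; lra).
      assert (E1 : sqrt (q ^ 2 + al ^ 2) ^ 2 = q ^ 2 + al ^ 2) by (apply pow2_sqrt; lra).
      assert (E2 : 1 - m * (1 / sqrt (1 + q / al * (q / al))) ^ 2 = (q ^ 2 + mu2) / (q ^ 2 + al ^ 2)).
      { unfold Rdiv at 1. rewrite Rpow_mult_distr, pow_inv, pow2_sqrt.
        unfold m. field. split; lra.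
        assert (0 <= q / al * (q / al)) by apply Rle_0_sqr. lra. }
      rewrite E2, sqrt_div_alt by lra.
      replace (1 / (sqrt (q ^ 2 + mu2) / sqrt (q ^ 2 + al ^ 2)))
        with (sqrt (q ^ 2 + al ^ 2) / sqrt (q ^ 2 + mu2)) by (field; lra).
      replace (1 + q * / al * (q * / al * 1)) with (sqrt (q ^ 2 + al ^ 2) ^ 2 / al ^ 2).
      field. repeat split; lra. rewrite E1. field; lra. }
  set (L := / sqrt (1 - m) * (al / C) + al).
  assert (HL : forall w, 0 < w < Rmin r z -> Rabs (G z) <= L * w).
  { intros w Hw.
    assert (Hwr : w < r) by (pose proof (Rmin_l r z); lra).
    assert (Hwz : w < z) by (pose proof (Rmin_r r z); lra).
    assert (E : G z = G w).
    { destruct (MVT_gen G w z (fun _ => 0)) as [c [_ Hc]].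
      - intros t Ht. apply HG. rewrite Rmin_left, Rmax_right in Ht by lra. lra.
      - intros t Ht. apply continuity_pt_filterlim, (@ex_derive_continuous R_AbsRing R_NormedModule).
        exists 0. apply HG. rewrite Rmin_left, Rmax_right in Ht by lra. lra.
      - lra. }
    rewrite E. unfold G.
    specialize (Hinf w (conj (proj1 Hw) Hwr)).
    assert (Hpw : 0 < p w) by nra.
    assert (Hu : 0 < al / p w) by (apply Rdiv_lt_0_compat; auto).
    replace (PI / 2 - atan (p w / al)) with (atan (al / p w)).
    2:{ rewrite <- atan_inv. f_equal. field; lra. apply Rdiv_lt_0_compat; auto. }
    destruct (atan_le (al / p w) ltac:(lra)) as [Ha1 Ha2].
    destruct (ellF_bound m (atan (al / p w)) Hm Ha1) as [Hb1 Hb2].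
    assert (Huw : al / p w <= al / C * w).
    { apply Rle_div_l; auto. replace (al / C * w * p w) with (al * ((w * p w) / C)) by (field; lra).
      rewrite <- (Rmult_1_r al) at 1. apply Rmult_le_compat_l. lra.
      apply Rle_div_r; lra. }
    assert (Hi : 0 < / sqrt (1 - m)) by (apply Rinv_0_lt_compat, sqrt_lt_R0; lra).
    assert (Hfin : ellF m (atan (al / p w)) <= / sqrt (1 - m) * (al / C * w)).
    { apply Rle_trans with (1 := Hb2). apply Rmult_le_compat_l; lra. }
    unfold L. apply Rabs_le_between. split; nra. }
  assert (HLp : 0 < L).
  { unfold L. assert (0 < / sqrt (1 - m)) by (apply Rinv_0_lt_compat, sqrt_lt_R0; lra).
    assert (0 < al / C) by (apply Rdiv_lt_0_compat; auto). nra. }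
  assert (HG0 : Rabs (G z) <= 0).
  { apply Rnot_lt_le. intros Hpos.
    assert (Hmin : 0 < Rmin r z) by (apply Rmin_pos; lra).
    set (w := Rmin (Rmin r z / 2) (Rabs (G z) / (2 * L))).
    assert (Hw : 0 < w) by (apply Rmin_pos; [lra|apply Rdiv_lt_0_compat; lra]).
    assert (Hw2 : w <= Rabs (G z) / (2 * L)) by apply Rmin_r.
    assert (Hw1 : w <= Rmin r z / 2) by apply Rmin_l.
    specialize (HL w ltac:(lra)).
    assert (L * w <= Rabs (G z) / 2).
    { replace (Rabs (G z) / 2) with (L * (Rabs (G z) / (2 * L))) by (field; lra).
      apply Rmult_le_compat_l; lra. }
    lra. }
  pose proof (Rabs_pos (G z)).
  assert (Hz0 : G z = 0).
  { apply Rabs_eq_0. lra. }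
  unfold G in Hz0. lra.
Qed.

(** The involution [tan s * tan t = 1 / sqrt (1 - m)] exchanges [0] and [PI / 2] and
    reverses the integral; its fixed point therefore halves it. *)
Lemma ellF_half m : 0 <= m < 1 ->
  2 * ellF m (PI / 2 - atan (sqrt (sqrt (1 - m)))) = ellF m (PI / 2).
Proof.
  intros Hm. set (kk := sqrt (1 - m)).
  assert (Hk : 0 < kk) by (apply sqrt_lt_R0; lra).
  assert (Hk2 : kk ^ 2 = 1 - m) by (apply pow2_sqrt; lra).
  (* The integral up to an angle with cotangent u plus the integral up to its image under
     the involution; at u = sqrt kk the two angles agree. *)
  set (M := fun u => ellF m (PI / 2 - atan u) + ellF m (atan (u / kk))).
  assert (HM : forall u, is_derive M u 0).
  { intros u. unfold M.
    pose proof (is_derive_ellF m (PI / 2 - atan u) (proj2 Hm)) as H1.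
    pose proof (is_derive_ellF m (atan (u / kk)) (proj2 Hm)) as H2.
    auto_derive.
    - split; [eexists; exact H1|]. split; [eexists; exact H2|]. auto.
    - replace (Derive (fun x => ellF m x) (PI / 2 + - atan u))
        with (1 / sqrt (1 - m * sin (PI / 2 - atan u) ^ 2))
        by (symmetry; apply is_derive_unique; exact H1).
      replace (Derive (fun x => ellF m x) (atan (u * / kk)))
        with (1 / sqrt (1 - m * sin (atan (u / kk)) ^ 2))
        by (symmetry; apply is_derive_unique; exact H2).
      rewrite sin_shift, cos_atan, sin_atan. unfold Rsqr.
      assert (Hu : 0 <= u ^ 2) by apply pow2_ge_0.
      assert (Hs1 : 0 < sqrt (1 + u ^ 2)) by (apply sqrt_lt_R0; lra).
      assert (Hk2p : 0 < kk ^ 2) by (apply pow_lt; auto).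
      assert (Hs2 : 0 < sqrt (u ^ 2 + kk ^ 2)) by (apply sqrt_lt_R0; lra).
      assert (E1 : 1 - m * (1 / sqrt (1 + u * u)) ^ 2 = (u ^ 2 + kk ^ 2) / (1 + u ^ 2)).
      { unfold Rdiv at 1. rewrite Rpow_mult_distr, pow_inv, pow2_sqrt by nra.
        rewrite Hk2. field. nra. }
      assert (E2 : 1 - m * (u / kk / sqrt (1 + u / kk * (u / kk))) ^ 2
         = (1 + u ^ 2) * kk ^ 2 / (u ^ 2 + kk ^ 2)).
      { unfold Rdiv at 1. rewrite Rpow_mult_distr, pow_inv, pow2_sqrt.
        replace m with (1 - kk ^ 2) by lra. field. split; lra.
        assert (0 <= u / kk * (u / kk)) by apply Rle_0_sqr. lra. }
      rewrite E1, E2, !sqrt_div_alt, sqrt_mult_alt, sqrt_pow2 by lra.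
      replace (1 + u * (u * 1)) with (sqrt (1 + u ^ 2) ^ 2) by (rewrite pow2_sqrt; lra).
      replace (1 + u * / kk * (u * / kk * 1)) with (sqrt (u ^ 2 + kk ^ 2) ^ 2 / kk ^ 2)
        by (rewrite pow2_sqrt by lra; field; lra).
      field. repeat split; lra. }
  destruct (MVT_gen M 0 (sqrt kk) (fun _ => 0)) as [c [_ Hc]].
  - intros; apply HM.
  - intros t _. apply continuity_pt_filterlim, (@ex_derive_continuous R_AbsRing R_NormedModule).
    exists 0; apply HM.
  - unfold M in Hc.
    replace (0 / kk) with 0 in Hc by (field; lra).
    rewrite atan_0, ellF_0, Rminus_0_r in Hc.
    assert (Hsk : 0 < sqrt kk) by (apply sqrt_lt_R0; auto).
    replace (atan (sqrt kk / kk)) with (PI / 2 - atan (sqrt kk)) in Hc.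
    lra.
    rewrite <- atan_inv by auto. f_equal.
    rewrite <- (sqrt_sqrt kk) at 3 by lra. field. lra.
Qed.

(** * The functions on the real and on the imaginary axis *)

(** Up to the factor [al], these three are the Jacobi functions ns, ds, cs with the
    periods normalised so that the real quarter period is [PI / 2]. *)
Definition ns (y z : R) : R := - (sin z * ns_frac y (- sin z ^ 2)).
Definition ds (y z : R) : R := - (sin z * ds_frac y (- sin z ^ 2)).
Definition cs (y z : R) : R := - (sin z * cos z * cs_frac y (- sin z ^ 2)).

(** Up to powers of [i], the same functions at [z = i t]. *)
Definition hns (y t : R) : R := sinh t * ns_frac y (sinh t ^ 2).
Definition hds (y t : R) : R := sinh t * ds_frac y (sinh t ^ 2).
Definition hcs (y t : R) : R := sinh t * cosh t * cs_frac y (sinh t ^ 2).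

Lemma trig_point y z : 0 < y -> 0 < z < PI ->
  0 < sin z /\ - sin z ^ 2 < 0 /\ - sin z ^ 2 < sinh_sq y 1.
Proof.
  intros Hy Hz. assert (Hs : 0 < sin z) by (apply sin_gt_0; tauto).
  pose proof (sinh_sq_pos y 1 Hy (le_n 1)). assert (0 < sin z ^ 2) by (apply pow_lt; auto).
  repeat split; lra.
Qed.

Lemma hyp_point y t : 0 < y -> 0 < t < y ->
  0 < sinh t /\ 0 < sinh t ^ 2 /\ sinh t ^ 2 < sinh_sq y 1.
Proof.
  intros Hy Ht.
  assert (H0 : 0 < sinh t) by (rewrite <- sinh_0; apply sinh_lt; tauto).
  assert (H1 : sinh t < sinh y) by (apply sinh_lt; tauto).
  repeat split; auto. apply pow_lt; auto.
  unfold sinh_sq. simpl INR. rewrite Rmult_1_l. nra.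
Qed.

Lemma is_derive_ns_frac y x : 0 < y -> x < sinh_sq y 1 -> x <> 0 -> is_derive (ns_frac y) x (ns_frac_deriv y x).
Proof. intros. apply is_derive_partial_fractions; auto using exp_bounded_ns. Qed.
Lemma is_derive_ds_frac y x : 0 < y -> x < sinh_sq y 1 -> x <> 0 -> is_derive (ds_frac y) x (ds_frac_deriv y x).
Proof. intros. apply is_derive_partial_fractions; auto using exp_bounded_ds. Qed.
Lemma is_derive_cs_frac y x : 0 < y -> x < sinh_sq y 1 -> x <> 0 -> is_derive (cs_frac y) x (cs_frac_deriv y x).
Proof. intros. apply is_derive_partial_fractions; auto using exp_bounded_cs. Qed.

Lemma cos_sq z : cos z ^ 2 = 1 - sin z ^ 2.
Proof. pose proof (sin2_cos2 z) as H. unfold Rsqr in H. nra. Qed.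

Lemma cosh_sq t : cosh t ^ 2 = 1 + sinh t ^ 2.
Proof.
  unfold cosh, sinh. rewrite exp_Ropp. pose proof (exp_pos t). field. lra.
Qed.

Lemma is_derive_ns y z : 0 < y -> 0 < z < PI -> is_derive (ns y) z (- (cs y z * ds y z)).
Proof.
  intros Hy Hz. destruct (trig_point y z Hy Hz) as [Hs [Hx0 Hx]].
  pose proof (is_derive_ns_frac y _ Hy Hx ltac:(lra)) as Hd.
  pose proof (ode_ns_frac y _ Hy Hx ltac:(lra)) as Ho.
  unfold ns. auto_derive.
  - simpl in Hd. first [split; [eexists; exact Hd | auto] | eexists; exact Hd].
  - replace (- (sin z * (sin z * 1))) with (- sin z ^ 2) by ring.
    rewrite_Derive (ns_frac y) (- sin z ^ 2) (ns_frac_deriv y (- sin z ^ 2)) Hd.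
    unfold cs, ds.
    transitivity (- cos z * (ns_frac y (- sin z ^ 2) + 2 * (- sin z ^ 2) * ns_frac_deriv y (- sin z ^ 2))).
    ring. rewrite Ho. ring.
Qed.

Lemma is_derive_ds y z : 0 < y -> 0 < z < PI -> is_derive (ds y) z (- (ns y z * cs y z)).
Proof.
  intros Hy Hz. destruct (trig_point y z Hy Hz) as [Hs [Hx0 Hx]].
  pose proof (is_derive_ds_frac y _ Hy Hx ltac:(lra)) as Hd.
  pose proof (ode_ds_frac y _ Hy Hx ltac:(lra)) as Ho.
  unfold ds. auto_derive.
  - simpl in Hd. first [split; [eexists; exact Hd | auto] | eexists; exact Hd].
  - replace (- (sin z * (sin z * 1))) with (- sin z ^ 2) by ring.
    rewrite_Derive (ds_frac y) (- sin z ^ 2) (ds_frac_deriv y (- sin z ^ 2)) Hd.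
    unfold cs, ns.
    transitivity (- cos z * (ds_frac y (- sin z ^ 2) + 2 * (- sin z ^ 2) * ds_frac_deriv y (- sin z ^ 2))).
    ring. rewrite Ho. ring.
Qed.

Lemma is_derive_cs y z : 0 < y -> 0 < z < PI -> is_derive (cs y) z (- (ns y z * ds y z)).
Proof.
  intros Hy Hz. destruct (trig_point y z Hy Hz) as [Hs [Hx0 Hx]].
  pose proof (is_derive_cs_frac y _ Hy Hx ltac:(lra)) as Hd.
  pose proof (ode_cs_frac y _ Hy Hx ltac:(lra)) as Ho.
  unfold cs. auto_derive.
  - simpl in Hd. first [split; [eexists; exact Hd | auto] | eexists; exact Hd].
  - replace (- (sin z * (sin z * 1))) with (- sin z ^ 2) by ring.
    rewrite_Derive (cs_frac y) (- sin z ^ 2) (cs_frac_deriv y (- sin z ^ 2)) Hd.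
    unfold ds, ns. pose proof (cos_sq z) as Hc.
    transitivity (- ((1 + 2 * (- sin z ^ 2)) * cs_frac y (- sin z ^ 2)
      + 2 * (- sin z ^ 2) * (1 + (- sin z ^ 2)) * cs_frac_deriv y (- sin z ^ 2))).
    replace (1 + - sin z ^ 2) with (cos z ^ 2) by lra.
    replace (1 + 2 * - sin z ^ 2) with (cos z ^ 2 - sin z ^ 2) by lra. ring.
    rewrite Ho. ring.
Qed.

Lemma is_derive_hns y t : 0 < y -> 0 < t < y -> is_derive (hns y) t (- (hcs y t * hds y t)).
Proof.
  intros Hy Ht. destruct (hyp_point y t Hy Ht) as [Hs [Hx0 Hx]].
  pose proof (is_derive_ns_frac y _ Hy Hx ltac:(lra)) as Hd.
  pose proof (ode_ns_frac y _ Hy Hx ltac:(lra)) as Ho.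
  unfold hns. auto_derive.
  - simpl in Hd. first [split; [eexists; exact Hd | auto] | eexists; exact Hd].
  - replace (sinh t * (sinh t * 1)) with (sinh t ^ 2) by ring.
    rewrite_Derive (ns_frac y) (sinh t ^ 2) (ns_frac_deriv y (sinh t ^ 2)) Hd.
    unfold hcs, hds.
    transitivity (cosh t * (ns_frac y (sinh t ^ 2) + 2 * (sinh t ^ 2) * ns_frac_deriv y (sinh t ^ 2))).
    ring. rewrite Ho. ring.
Qed.

Lemma trig_first_integrals y z : 0 < y -> 0 < z < PI ->
  ns y z ^ 2 = cs y z ^ 2 + alpha_sq y /\ ns y z ^ 2 = ds y z ^ 2 + beta_sq y.
Proof.
  intros Hy Hz. destruct (trig_point y z Hy Hz) as [Hs [Hx0 Hx]].
  pose proof (ns_frac_ds_frac_constant y _ Hy Hx ltac:(lra)) as H1.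
  pose proof (ns_frac_cs_frac_constant y _ Hy Hx ltac:(lra)) as H2.
  pose proof (cos_sq z) as Hc.
  replace (1 + - sin z ^ 2) with (cos z ^ 2) in H2 by lra.
  unfold ns, cs, ds. split; lra.
Qed.

Lemma hyp_first_integrals y t : 0 < y -> 0 < t < y ->
  hcs y t ^ 2 = hns y t ^ 2 + alpha_sq y /\ hds y t ^ 2 = hns y t ^ 2 + beta_sq y.
Proof.
  intros Hy Ht. destruct (hyp_point y t Hy Ht) as [Hs [Hx0 Hx]].
  pose proof (ns_frac_ds_frac_constant y _ Hy Hx ltac:(lra)) as H1.
  pose proof (ns_frac_cs_frac_constant y _ Hy Hx ltac:(lra)) as H2.
  pose proof (cosh_sq t) as Hc. rewrite <- Hc in H2.
  unfold hns, hcs, hds. split; lra.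
Qed.

Lemma ns_pos y z : 0 < y -> 0 < z < PI -> 0 < ns y z.
Proof.
  intros Hy Hz. destruct (trig_point y z Hy Hz) as [Hs [Hx0 Hx]].
  unfold ns. set (x := - sin z ^ 2) in *.
  assert (Hphi : ns_frac y x < 0).
  { unfold ns_frac, partial_fractions.
    assert (0 < poles y 1 (res_ns y) x).
    { apply Series_pos.
      - apply ex_poles; auto using exp_bounded_ns.
      - intros n. left. apply Rdiv_lt_0_compat.
        unfold res_ns. pose proof (cosh_ge_1 (INR (S n) * y)); lra.
        apply pow_lt, sinh_sq_gt; auto.
      - apply Rdiv_lt_0_compat.
        unfold res_ns. pose proof (cosh_ge_1 (INR 1 * y)); lra.
        apply pow_lt, sinh_sq_gt; auto. }
    assert (1 / x < 0).
    { unfold Rdiv. rewrite Rmult_1_l. apply Rinv_lt_0_compat; auto. }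
    lra. }
  nra.
Qed.

(** The residue at the origin is [1]. This fixes the signs of the functions near their
    common pole. *)
Lemma partial_fractions_near_0 y a : 0 < y -> exp_bounded y a ->
  exists r, 0 < r /\ forall x, Rabs x < r -> x <> 0 -> / 2 < x * partial_fractions y a x < 2.
Proof.
  intros Hy Ha. pose proof (sinh_sq_pos y 1 Hy (le_n 1)) as Hs.
  set (h := fun x => 1 - 2 * x * poles y 1 a x).
  assert (Hc : continuous h 0).
  { apply (@ex_derive_continuous R_AbsRing R_NormedModule).
    pose proof (is_derive_poles_1 y a 0 Hy Ha Hs) as Hd. unfold h. auto_derive.
    eexists; exact Hd. }
  assert (Hb : locally (h 0) (fun v => / 2 < v < 2)).
  { exists (mkposreal (/ 2) ltac:(lra)). intros v Hv.
    change (Rabs (v - h 0) < / 2) in Hv. unfold h in Hv. apply Rabs_lt_between in Hv. lra. }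
  destruct (Hc _ Hb) as [r Hr]. exists r. split. apply cond_pos.
  intros x Hx Hx0. specialize (Hr x).
  replace (x * partial_fractions y a x) with (h x).
  apply Hr. change (Rabs (x - 0) < r). rewrite Rminus_0_r; auto.
  unfold h, partial_fractions. field; auto.
Qed.

Lemma sin_sq_small z r : 0 < r -> 0 < z < 1 -> z < r -> Rabs (- sin z ^ 2) < r.
Proof.
  intros Hr Hz Hzr. rewrite Rabs_Ropp, Rabs_pos_eq by apply pow2_ge_0.
  assert (0 < sin z) by (apply sin_gt_0; pose proof PI2_1; lra).
  assert (sin z < z) by (apply sin_lt_x; tauto). nra.
Qed.

Lemma sinh_bounds t : 0 < t < 1 -> t <= sinh t <= 3 * t.
Proof.
  intros Ht.
  destruct (MVT_gen sinh 0 t cosh) as [c [Hc E]].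
  - intros; apply is_derive_Reals, derivable_pt_lim_sinh.
  - intros; apply derivable_continuous_pt, derivable_pt_sinh.
  - rewrite Rmin_left, Rmax_right in Hc by lra.
    rewrite sinh_0, !Rminus_0_r in E. rewrite E.
    pose proof (cosh_ge_1 c).
    assert (cosh c <= 3).
    { unfold cosh. pose proof exp_le_3.
      assert (exp c <= exp 1) by (destruct (Req_dec c 1) as [->|]; [lra|left; apply exp_increasing; lra]).
      assert (exp (- c) <= exp 0) by (destruct (Req_dec c 0) as [->|]; [rewrite Ropp_0; lra|left; apply exp_increasing; lra]).
      rewrite exp_0 in *. lra. }
    split; nra.
Qed.

Lemma ds_near_0 y : 0 < y -> exists r, 0 < r /\ forall z, 0 < z < r -> 0 < ds y z.
Proof.
  intros Hy. destruct (partial_fractions_near_0 y _ Hy (exp_bounded_ds y Hy)) as [r [Hr H]].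
  exists (Rmin r 1). split. apply Rmin_pos; lra.
  intros z Hz. pose proof (Rmin_l r 1). pose proof (Rmin_r r 1).
  destruct (trig_point y z Hy) as [Hs [Hx0 Hx]]. pose proof PI2_1; lra.
  specialize (H (- sin z ^ 2) ltac:(apply sin_sq_small; lra) ltac:(lra)).
  assert (0 < sin z * ds y z); [|nra].
  unfold ds, ds_frac in *. lra.
Qed.

Lemma cs_near_0 y : 0 < y -> exists C r, 0 < C /\ 0 < r /\ forall z, 0 < z < r -> C <= z * cs y z.
Proof.
  intros Hy. destruct (partial_fractions_near_0 y _ Hy (exp_bounded_cs y Hy)) as [r [Hr H]].
  exists (/ 4), (Rmin r 1). split. lra. split. apply Rmin_pos; lra.
  intros z Hz. pose proof (Rmin_l r 1). pose proof (Rmin_r r 1).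
  destruct (trig_point y z Hy) as [Hs [Hx0 Hx]]. pose proof PI2_1; lra.
  specialize (H (- sin z ^ 2) ltac:(apply sin_sq_small; lra) ltac:(lra)).
  assert (Hcos : / 2 <= cos z).
  { replace (/ 2) with (cos (PI / 3)) by (rewrite cos_PI3; lra).
    apply Rlt_le, cos_decreasing_1; try lra.
    - pose proof PI2_1; lra.
    - pose proof PI2_1; lra.
    - pose proof PI2_1; lra.
    - pose proof PI2_3_2. lra. }
  assert (Hsc : / 4 <= sin z * cs y z).
  { unfold cs. fold (cs_frac y (- sin z ^ 2)) in H.
    replace (sin z * - (sin z * cos z * cs_frac y (- sin z ^ 2)))
      with (cos z * (- sin z ^ 2 * cs_frac y (- sin z ^ 2))) by ring. nra. }
  assert (sin z < z) by (apply sin_lt_x; lra).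
  assert (0 < cs y z) by nra. nra.
Qed.

Lemma hyp_near_0 y : 0 < y -> exists C r, 0 < C /\ 0 < r /\ forall t, 0 < t < r ->
  C <= t * hns y t /\ 0 < hds y t /\ 0 < hcs y t.
Proof.
  intros Hy. destruct (partial_fractions_near_0 y _ Hy (exp_bounded_ns y Hy)) as [r1 [Hr1 H1]].
  destruct (partial_fractions_near_0 y _ Hy (exp_bounded_ds y Hy)) as [r2 [Hr2 H2]].
  destruct (partial_fractions_near_0 y _ Hy (exp_bounded_cs y Hy)) as [r3 [Hr3 H3]].
  set (r := Rmin (Rmin r1 r2) r3).
  assert (Hr : 0 < r) by (unfold r; repeat apply Rmin_pos; auto).
  assert (Hrle : r <= r1 /\ r <= r2 /\ r <= r3).
  { unfold r. pose proof (Rmin_l (Rmin r1 r2) r3). pose proof (Rmin_r (Rmin r1 r2) r3).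
    pose proof (Rmin_l r1 r2). pose proof (Rmin_r r1 r2). lra. }
  exists (/ 6), (Rmin 1 (r / 9)). split. lra. split. apply Rmin_pos; lra.
  intros t Ht. pose proof (Rmin_l 1 (r / 9)). pose proof (Rmin_r 1 (r / 9)).
  destruct (sinh_bounds t ltac:(lra)) as [Hl Hu].
  assert (Hsm : Rabs (sinh t ^ 2) < r).
  { rewrite Rabs_pos_eq by apply pow2_ge_0. nra. }
  assert (Hs0 : sinh t ^ 2 <> 0) by (apply pow_nonzero; lra).
  specialize (H1 _ (Rlt_le_trans _ _ _ Hsm (proj1 Hrle)) Hs0).
  specialize (H2 _ (Rlt_le_trans _ _ _ Hsm (proj1 (proj2 Hrle))) Hs0).
  specialize (H3 _ (Rlt_le_trans _ _ _ Hsm (proj2 (proj2 Hrle))) Hs0).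
  fold (ns_frac y (sinh t ^ 2)) in H1. fold (ds_frac y (sinh t ^ 2)) in H2. fold (cs_frac y (sinh t ^ 2)) in H3.
  assert (E1 : / 2 < sinh t * hns y t) by (unfold hns; lra).
  assert (E2 : / 2 < sinh t * hds y t) by (unfold hds; lra).
  assert (E3 : 0 < sinh t * hcs y t).
  { unfold hcs. pose proof (cosh_ge_1 t).
    replace (sinh t * (sinh t * cosh t * cs_frac y (sinh t ^ 2))) with
      (cosh t * (sinh t ^ 2 * cs_frac y (sinh t ^ 2))) by ring. nra. }
  assert (0 < hns y t) by nra.
  repeat split; nra.
Qed.

(** The first integrals give only squares; the sign is carried over from the pole. *)
Lemma positive_by_continuity (h : R -> R) (b : R) :
  (forall z, 0 < z <= b -> continuous h z) ->
  (forall z, 0 < z <= b -> h z <> 0) ->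
  (exists r, 0 < r /\ forall z, 0 < z < r -> 0 < h z) ->
  forall z, 0 < z <= b -> 0 < h z.
Proof.
  intros Hc Hn [r [Hr H0]] z Hz.
  destruct (Rlt_dec 0 (h z)) as [|Hneg]; auto. exfalso.
  assert (Hz0 : h z < 0) by (specialize (Hn z Hz); lra).
  set (w := Rmin r z / 2).
  assert (Hm : 0 < Rmin r z) by (apply Rmin_pos; tauto).
  pose proof (Rmin_l r z). pose proof (Rmin_r r z).
  assert (Hw : 0 < w < r /\ w < z) by (unfold w; lra).
  assert (Hhw : 0 < h w) by (apply H0; tauto).
  destruct (Ranalysis5.IVT_interv (fun u => - h u) w z) as [c [Hc1 Hc2]].
  - intros a Ha. apply continuity_pt_opp. apply continuity_pt_filterlim, Hc. lra.
  - tauto.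
  - lra.
  - lra.
  - apply (Hn c); lra.
Qed.

Lemma continuous_of_derive (f : R -> R) (x l : R) : is_derive f x l -> continuous f x.
Proof.
  intros H. apply (@ex_derive_continuous R_AbsRing R_NormedModule). exists l; auto.
Qed.

Lemma cs_PI2 y : cs y (PI / 2) = 0.
Proof. unfold cs. rewrite cos_PI2. ring. Qed.

(** The difference is the square of [ds] at [PI / 2], so what has to be excluded is a
    zero there. Now [h = cs + ds] solves [h' = - ns * h] and is positive near [0], so
    it never vanishes, and it equals [ds] at [PI / 2]. *)
Lemma modulus_gap y : 0 < y -> 0 < alpha_sq y - beta_sq y.
Proof.
  intros Hy.
  pose proof PI2_1 as HPI.
  destruct (trig_first_integrals y (PI / 2) Hy ltac:(lra)) as [E1 E2].
  rewrite cs_PI2 in E1.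
  assert (Hd : ds y (PI / 2) <> 0); [|nra].
  destruct (ds_near_0 y Hy) as [r1 [Hr1 H1]].
  destruct (cs_near_0 y Hy) as [C [r2 [HC [Hr2 H2]]]].
  set (z0 := Rmin (Rmin r1 r2) 1 / 2).
  assert (Hz0 : 0 < z0 /\ z0 < r1 /\ z0 < r2 /\ z0 < 1).
  { unfold z0. pose proof (Rmin_l (Rmin r1 r2) 1). pose proof (Rmin_r (Rmin r1 r2) 1).
    pose proof (Rmin_l r1 r2). pose proof (Rmin_r r1 r2).
    assert (0 < Rmin (Rmin r1 r2) 1) by (repeat apply Rmin_pos; lra). lra. }
  specialize (H1 z0 ltac:(lra)). specialize (H2 z0 ltac:(lra)).
  assert (Hc0 : 0 < cs y z0) by nra.
  destruct (continuity_ab_maj (ns y) z0 (PI / 2)) as [Mx [HM HMx]].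
  { lra. }
  { intros c Hc. apply continuity_pt_filterlim.
    apply (continuous_of_derive _ _ _ (is_derive_ns y c Hy ltac:(lra))). }
  set (M := ns y Mx) in *.
  set (h := fun z => cs y z + ds y z).
  (* As M bounds ns, E does not decrease; it therefore stays positive up to PI / 2. *)
  set (E := fun z => h z ^ 2 * exp (2 * M * z)).
  assert (HE : forall z, z0 <= z <= PI / 2 ->
     is_derive E z (2 * (M - ns y z) * E z)).
  { intros z Hz. pose proof (is_derive_cs y z Hy ltac:(lra)) as D1.
    pose proof (is_derive_ds y z Hy ltac:(lra)) as D2.
    unfold E, h. auto_derive.
    - split. eexists; exact D1. split; auto. eexists; exact D2.
    - rewrite_Derive (cs y) z (- (ns y z * ds y z)) D1. rewrite_Derive (ds y) z (- (ns y z * cs y z)) D2. ring. }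
  destruct (MVT_gen E z0 (PI / 2) (fun z => 2 * (M - ns y z) * E z)) as [c [Hc Heq]].
  - intros z Hz. rewrite Rmin_left, Rmax_right in Hz by lra. apply HE. lra.
  - intros z Hz. rewrite Rmin_left, Rmax_right in Hz by lra.
    apply continuity_pt_filterlim. apply (continuous_of_derive _ _ _ (HE z Hz)).
  - rewrite Rmin_left, Rmax_right in Hc by lra.
    specialize (HM c Hc).
    assert (HEc : 0 <= E c).
    { apply Rmult_le_pos. apply pow2_ge_0. left; apply exp_pos. }
    assert (HE0 : 0 < E z0).
    { apply Rmult_lt_0_compat. apply pow_lt. unfold h; lra. apply exp_pos. }
    assert (HEP : 0 < E (PI / 2)).
    { assert (0 <= 2 * (M - ns y c) * E c * (PI / 2 - z0)); [|lra].
      apply Rmult_le_pos; [|lra]. apply Rmult_le_pos; lra. }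
    unfold E, h in HEP. rewrite cs_PI2 in HEP. intros E0. rewrite E0 in HEP.
    replace ((0 + 0) ^ 2 * exp (2 * M * (PI / 2))) with 0 in HEP by ring. lra.
Qed.

Lemma ds_pos y z : 0 < y -> 0 < z <= PI / 2 -> 0 < ds y z.
Proof.
  intros Hy. pose proof PI2_1 as HPI. revert z. apply positive_by_continuity.
  - intros z Hz. apply (continuous_of_derive _ _ _ (is_derive_ds y z Hy ltac:(lra))).
  - intros z Hz E. destruct (trig_first_integrals y z Hy ltac:(lra)) as [E1 E2].
    pose proof (modulus_gap y Hy). rewrite E in E2. pose proof (pow2_ge_0 (cs y z)). nra.
  - apply ds_near_0; auto.
Qed.

Lemma continuous_hyp y a (s : R -> R) t : 0 < y -> exp_bounded y a -> 0 < t < y ->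
  continuous s t -> continuous (fun u => s u * partial_fractions y a (sinh u ^ 2)) t.
Proof.
  intros Hy Ha Ht Hs. destruct (hyp_point y t Hy Ht) as [_ [Hx0 Hx]].
  apply (@continuous_mult R_UniformSpace R_AbsRing); auto.
  apply (continuous_comp (fun u => sinh u ^ 2) (partial_fractions y a)).
  - apply (@ex_derive_continuous R_AbsRing R_NormedModule). auto_derive. auto.
  - apply (continuous_of_derive _ _ _ (is_derive_partial_fractions y a _ Hy Ha Hx ltac:(lra))).
Qed.

Lemma hds_hcs_pos y t : 0 < y -> 0 < t <= y / 2 -> 0 < hds y t /\ 0 < hcs y t.
Proof.
  intros Hy Ht. destruct (hyp_near_0 y Hy) as [C [r [_ [Hr H]]]]. split.
  - revert t Ht. apply positive_by_continuity.
    + intros t Ht. apply (continuous_hyp y (res_ds y) sinh); auto using exp_bounded_ds. lra.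
      apply (continuous_of_derive _ _ (cosh t)). apply is_derive_Reals, derivable_pt_lim_sinh.
    + intros t Ht E. destruct (hyp_first_integrals y t Hy ltac:(lra)) as [E1 E2].
      pose proof (beta_sq_pos y Hy). rewrite E in E2. pose proof (pow2_ge_0 (hns y t)). nra.
    + exists r. split; auto. intros z Hz. apply H; auto.
  - revert t Ht. apply positive_by_continuity.
    + intros t Ht. apply (continuous_hyp y (res_cs y) (fun u => sinh u * cosh u)); auto using exp_bounded_cs. lra.
      apply (@ex_derive_continuous R_AbsRing R_NormedModule). auto_derive. auto.
    + intros t Ht E. destruct (hyp_first_integrals y t Hy ltac:(lra)) as [E1 E2].
      pose proof (alpha_sq_pos y Hy). rewrite E in E1. pose proof (pow2_ge_0 (hns y t)). nra.
    + exists r. split; auto. intros z Hz. apply H; auto.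
Qed.

(** * From the period to the modulus *)

Lemma sinh_add a b : sinh (a + b) = sinh a * cosh b + cosh a * sinh b.
Proof.
  unfold sinh, cosh. rewrite Ropp_plus_distr, !exp_plus, !exp_Ropp.
  pose proof (exp_pos a). pose proof (exp_pos b). field. split; lra.
Qed.

Lemma sinh_ge t : 0 <= t -> t <= sinh t.
Proof.
  intros Ht.
  destruct (MVT_gen sinh 0 t cosh) as [c [Hc E]].
  - intros; apply is_derive_Reals, derivable_pt_lim_sinh.
  - intros; apply derivable_continuous_pt, derivable_pt_sinh.
  - rewrite sinh_0, !Rminus_0_r in E. rewrite E.
    pose proof (cosh_ge_1 c). nra.
Qed.

Lemma sinh_opp t : sinh (- t) = - sinh t.
Proof. unfold sinh. rewrite Ropp_involutive. field. Qed.
Lemma cosh_opp t : cosh (- t) = cosh t.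
Proof. unfold cosh. rewrite Ropp_involutive. field. Qed.

(** With [m] and [- m] separated again, the sum of [csch (t + m y)] over all integers
    telescopes at [t = y / 2]. *)
Lemma hns_half_period y : 0 < y -> hns y (y / 2) = 0.
Proof.
  intros Hy. set (t := y / 2).
  destruct (hyp_point y t Hy ltac:(unfold t; lra)) as [Hs [Hx0 Hx]].
  unfold hns, ns_frac, partial_fractions. rewrite poles_1.
  (* The pair of poles m = n + 1 contributes u (n + 1) - u n. *)
  set (u := fun n => 1 / sinh ((INR n + / 2) * y)).
  assert (Hup : forall n, 0 < sinh ((INR n + / 2) * y) /\ INR n * y <= sinh ((INR n + / 2) * y)).
  { intros n. pose proof (pos_INR n).
    assert (0 <= INR n * y) by (apply Rmult_le_pos; lra).
    pose proof (sinh_ge ((INR n + / 2) * y) ltac:(nra)). split; nra. }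
  assert (Hu : is_lim_seq u 0).
  { apply is_lim_seq_incr_1.
    apply is_lim_seq_le_le with (fun _ => 0) (fun n => / y * / INR (S n)).
    - intros n. destruct (Hup (S n)) as [H1 H2].
      assert (0 < INR (S n)) by (apply lt_0_INR; lia). unfold u.
      split. left. apply Rdiv_lt_0_compat; lra.
      unfold Rdiv. rewrite Rmult_1_l, <- Rinv_mult. apply Rinv_le_contravar. nra. lra.
    - apply is_lim_seq_const.
    - replace (Finite 0) with (Rbar_mult (/ y) 0) by (simpl; f_equal; ring).
      apply is_lim_seq_scal_l.
      apply (is_lim_seq_incr_1 (fun n => / INR n)).
      replace (Finite 0) with (Rbar_inv p_infty) by reflexivity.
      apply is_lim_seq_inv. apply is_lim_seq_INR. discriminate. }
  assert (Hser : is_series (fun n => u (S n) - u n) (- u 0%nat)).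
  { apply (is_lim_seq_ext (fun N => u (S N) - u 0%nat) (sum_n (fun n => u (S n) - u n)) (- u 0%nat)).
    - intros N. rewrite sum_n_Reals. induction N as [|N IH]; simpl; auto. rewrite <- IH. ring.
    - replace (Finite (- u 0%nat)) with (Finite (0 - u 0%nat)) by (f_equal; ring).
      apply is_lim_seq_minus'. apply (is_lim_seq_incr_1 u); auto. apply is_lim_seq_const. }
  assert (Hterm : forall n, u (S n) - u n = (- 2 * sinh t) * (res_ns y (S n) / (sinh_sq y (S n) - sinh t ^ 2))).
  { intros n. unfold u, res_ns, sinh_sq. pose proof (Hup n) as [H1 _]. pose proof (Hup (S n)) as [H2 _].
    replace ((INR n + / 2) * y) with (INR (S n) * y + - t) in * by (rewrite S_INR; unfold t; field).
    replace ((INR (S n) + / 2) * y) with (INR (S n) * y + t) in * by (unfold t; field).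
    set (w := INR (S n) * y) in *.
    rewrite !sinh_add, sinh_opp, cosh_opp in *.
    pose proof (cosh_sq t). pose proof (cosh_sq w).
    assert (E : sinh w ^ 2 - sinh t ^ 2 =
       (sinh w * cosh t + cosh w * - sinh t) * (sinh w * cosh t + cosh w * sinh t)).
    { transitivity (sinh w ^ 2 * cosh t ^ 2 - cosh w ^ 2 * sinh t ^ 2); [|ring].
      rewrite H, H0. ring. }
    rewrite E. field. split; lra. }
  assert (HS : - 2 * sinh t * Series (fun n => res_ns y (S n) / (sinh_sq y (S n) - sinh t ^ 2)) = - u 0%nat).
  { rewrite <- Series_scal_l. rewrite <- (Series_ext _ _ Hterm). apply is_series_unique, Hser. }
  assert (Hu0 : u 0%nat = 1 / sinh t).
  { unfold u, t. f_equal. f_equal. simpl. field. }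
  rewrite Hu0 in HS.
  transitivity (1 / sinh t + - 2 * sinh t * Series (fun n => res_ns y (S n) / (sinh_sq y (S n) - sinh t ^ 2))).
  field. lra. rewrite HS. ring.
Qed.

(** A multiple of the second derivative of [ns] at [PI / 4], where [x = - 1 / 2]. *)
Definition octant_sum (y : R) : R :=
  6 - 2 * poles y 1 (res_ns y) (- (1 / 2)) - 4 * poles y 2 (res_ns y) (- (1 / 2))
    + 4 * poles y 3 (res_ns y) (- (1 / 2)).

(** Differentiate the first equation of the system once more and eliminate the
    derivatives of the other two functions: this is [ns'' = ns * (cs^2 + ds^2)] at [PI
    / 4]. *)
Lemma octant_sum_products y : 0 < y ->
  octant_sum y = - (1 / 2) * ns_frac y (- (1 / 2))
     * (ds_frac y (- (1 / 2)) ^ 2 + cs_frac y (- (1 / 2)) ^ 2 / 2).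
Proof.
  intros Hy. set (x := - (1 / 2)).
  pose proof (sinh_sq_pos y 1 Hy (le_n 1)) as Hs.
  assert (Hx : x < sinh_sq y 1) by (unfold x; lra). assert (Hx0 : x <> 0) by (unfold x; lra).
  pose proof (is_derive_ns_frac y x Hy Hx Hx0) as D1.
  pose proof (is_derive_ds_frac y x Hy Hx Hx0) as D2.
  pose proof (is_derive_cs_frac y x Hy Hx Hx0) as D3.
  set (D2phi := 2 / x ^ 3 - 4 * poles y 3 (res_ns y) x).
  assert (D4 : is_derive (ns_frac_deriv y) x D2phi).
  { unfold ns_frac_deriv, partial_fractions_deriv, D2phi.
    pose proof (is_derive_poles y (res_ns y) 2 x Hy (exp_bounded_ns y Hy) ltac:(lia) Hx) as H.
    auto_derive.
    - repeat split; try (eexists; exact H); unfold x; nra.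
    - rewrite_Derive (poles y 2 (res_ns y)) x (INR 2 * poles y 3 (res_ns y) x) H.
      simpl INR. field. auto. }
  (* Hf vanishes identically near x, hence so does its derivative. *)
  set (Hf := fun t => ns_frac y t + 2 * t * ns_frac_deriv y t + t * cs_frac y t * ds_frac y t).
  assert (D5 : is_derive Hf x (3 * ns_frac_deriv y x + 2 * x * D2phi + cs_frac y x * ds_frac y x
      + x * cs_frac_deriv y x * ds_frac y x + x * cs_frac y x * ds_frac_deriv y x)).
  { unfold Hf. auto_derive.
    - repeat split; eexists; eauto.
    - rewrite_Derive (ns_frac y) x (ns_frac_deriv y x) D1. rewrite_Derive (ns_frac_deriv y) x D2phi D4.
      rewrite_Derive (cs_frac y) x (cs_frac_deriv y x) D3. rewrite_Derive (ds_frac y) x (ds_frac_deriv y x) D2. ring. }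
  assert (E0 : 3 * ns_frac_deriv y x + 2 * x * D2phi + cs_frac y x * ds_frac y x
      + x * cs_frac_deriv y x * ds_frac y x + x * cs_frac y x * ds_frac_deriv y x = 0).
  { rewrite <- (is_derive_unique _ _ _ D5).
    rewrite (Derive_ext_loc Hf (fun _ => 0)). apply Derive_const.
    exists (mkposreal (1 / 4) ltac:(lra)). intros t Ht.
    change (Rabs (t - x) < 1 / 4) in Ht. apply Rabs_lt_between in Ht. unfold x in Ht.
    unfold Hf. rewrite ode_ns_frac; auto; try lra. }
  pose proof (ode_ns_frac y x Hy Hx Hx0) as O1. pose proof (ode_ds_frac y x Hy Hx Hx0) as O2.
  pose proof (ode_cs_frac y x Hy Hx Hx0) as O3.
  assert (EV : octant_sum y = ns_frac y x + 2 * ns_frac_deriv y x - D2phi).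
  { unfold octant_sum, ns_frac, ns_frac_deriv, D2phi, partial_fractions, partial_fractions_deriv. fold x.
    replace (1 / x) with (-2) by (unfold x; field).
    replace (1 / x ^ 2) with 4 by (unfold x; field).
    replace (2 / x ^ 3) with (-16) by (unfold x; field). ring. }
  rewrite EV. 
  assert (X : x = - (1 / 2)) by reflexivity. clearbody x. subst x.
  assert (T : cs_frac_deriv y (- (1 / 2)) = - (ns_frac y (- (1 / 2)) * ds_frac y (- (1 / 2)))) by lra.
  assert (Dd : ds_frac_deriv y (- (1 / 2)) = ds_frac y (- (1 / 2)) - / 2 * (ns_frac y (- (1 / 2)) * cs_frac y (- (1 / 2)))) by lra.
  rewrite T, Dd in E0. lra.
Qed.

(** The modulus is [sqrt (beta_sq y / alpha_sq y)]. The last equation is [ns'' = ns *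
    (cs^2 + ds^2)] evaluated with [cs^2 = al^2 k'], [ns^2 = al^2 (1 + k')] and [ds^2 =
    al^2 k' (1 + k')]. *)
Lemma uniformisation y : 0 < y -> exists al k,
  0 < al /\ 0 < k < 1 /\
  ellF (k ^ 2) (PI / 2) = al * (PI / 2) /\
  ellF (compl_modulus k ^ 2) (PI / 2) = al * (y / 2) /\
  octant_sum y = sqrt 2 * al ^ 3 * (compl_modulus k * (2 + compl_modulus k) * sqrt (1 + compl_modulus k)).
Proof.
  intros Hy. pose proof (alpha_sq_pos y Hy) as Ha. pose proof (beta_sq_pos y Hy) as Hb.
  pose proof (modulus_gap y Hy) as Hg. pose proof PI2_1 as HPI.
  set (al := sqrt (alpha_sq y)). set (k := sqrt (beta_sq y / alpha_sq y)).
  assert (Hal : 0 < al) by (apply sqrt_lt_R0; auto).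
  assert (Hal2 : al ^ 2 = alpha_sq y) by (apply pow2_sqrt; lra).
  assert (Hr : 0 < beta_sq y / alpha_sq y < 1).
  { split. apply Rdiv_lt_0_compat; auto. apply Rlt_div_l; lra. }
  assert (Hk2 : k ^ 2 = beta_sq y / alpha_sq y) by (apply pow2_sqrt; lra).
  assert (Hk : 0 < k < 1).
  { split. apply sqrt_lt_R0; lra. rewrite <- sqrt_1. apply sqrt_lt_1; lra. }
  set (kp := compl_modulus k).
  assert (Hkp2 : kp ^ 2 = 1 - k ^ 2) by (apply pow2_sqrt; nra).
  assert (Hkp : 0 < kp) by (apply sqrt_lt_R0; nra).
  exists al, k. fold kp.
  assert (Amp1 : forall z, 0 < z <= PI / 2 -> ellF (k ^ 2) (PI / 2 - atan (cs y z / al)) = al * z).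
  { replace (k ^ 2) with (1 - (alpha_sq y - beta_sq y) / al ^ 2) by (rewrite Hk2, Hal2; field; lra).
    apply amplitude; auto.
    - rewrite Hal2. lra.
    - intros z Hz. destruct (trig_first_integrals y z Hy ltac:(lra)) as [E1 E2].
      rewrite Hal2, <- E1.
      replace (cs y z ^ 2 + (alpha_sq y - beta_sq y)) with (ds y z ^ 2) by lra.
      rewrite !sqrt_pow2. apply is_derive_cs; auto; lra.
      left; apply ds_pos; auto. left; apply ns_pos; auto; lra.
    - apply cs_near_0; auto. }
  assert (Amp2 : forall t, 0 < t <= y / 2 -> ellF (kp ^ 2) (PI / 2 - atan (hns y t / al)) = al * t).
  { replace (kp ^ 2) with (1 - beta_sq y / al ^ 2) by (rewrite Hkp2, Hk2, Hal2; reflexivity).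
    apply amplitude; auto.
    - rewrite Hal2. lra.
    - intros t Ht. destruct (hyp_first_integrals y t Hy ltac:(lra)) as [E1 E2].
      destruct (hds_hcs_pos y t Hy Ht).
      rewrite Hal2, <- E1, <- E2, !sqrt_pow2 by lra. apply is_derive_hns; auto; lra.
    - destruct (hyp_near_0 y Hy) as [C [r [HC [Hr' H]]]]. exists C, r. repeat split; auto.
      intros z Hz. apply H; auto. }
  assert (EK : ellF (k ^ 2) (PI / 2) = al * (PI / 2)).
  { rewrite <- (Amp1 (PI / 2)) by lra. rewrite cs_PI2. f_equal.
    replace (0 / al) with 0 by (field; lra). rewrite atan_0. ring. }
  assert (EK' : ellF (kp ^ 2) (PI / 2) = al * (y / 2)).
  { rewrite <- (Amp2 (y / 2)) by lra. rewrite hns_half_period by auto. f_equal.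
    replace (0 / al) with 0 by (field; lra). rewrite atan_0. ring. }
  split; auto. split; auto. split; auto. split; auto.
  (* At the octant point the amplitude has run through half of the integral. *)
  assert (Hk1 : 0 <= k ^ 2 < 1) by (rewrite Hk2; lra).
  assert (Ecs : cs y (PI / 4) = al * sqrt kp).
  { pose proof (Amp1 (PI / 4) ltac:(lra)) as H4.
    pose proof (ellF_half (k ^ 2) Hk1) as Hh.
    rewrite EK in Hh. change (sqrt (1 - k ^ 2)) with kp in Hh.
    assert (Heq : atan (cs y (PI / 4) / al) = atan (sqrt kp)).
    { destruct (Rtotal_order (atan (cs y (PI / 4) / al)) (atan (sqrt kp))) as [L|[L|L]]; auto;
      exfalso.
      - pose proof (ellF_incr (k ^ 2) (PI / 2 - atan (sqrt kp)) (PI / 2 - atan (cs y (PI / 4) / al)) ltac:(lra) ltac:(lra)).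
        lra.
      - pose proof (ellF_incr (k ^ 2) (PI / 2 - atan (cs y (PI / 4) / al)) (PI / 2 - atan (sqrt kp)) ltac:(lra) ltac:(lra)).
        lra. }
    assert (Hq : cs y (PI / 4) / al = sqrt kp).
    { rewrite <- (tan_atan (cs y (PI / 4) / al)), Heq. apply tan_atan. }
    rewrite <- Hq. field. lra. }
  assert (Hsq : sin (PI / 4) ^ 2 = 1 / 2).
  { rewrite sin_PI4. unfold Rdiv. rewrite Rmult_1_l, pow_inv, pow2_sqrt; lra. }
  assert (Hcq : cos (PI / 4) ^ 2 = 1 / 2) by (rewrite cos_sq; lra).
  assert (Hkk : sqrt kp ^ 2 = kp) by (apply pow2_sqrt; lra).
  destruct (trig_first_integrals y (PI / 4) Hy ltac:(lra)) as [E1 E2].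
  assert (Ecs2 : cs y (PI / 4) ^ 2 = alpha_sq y * kp) by (rewrite Ecs, Rpow_mult_distr, Hkk, Hal2; auto).
  rewrite octant_sum_products by auto.
  pose proof (ns_pos y (PI / 4) Hy ltac:(lra)) as Hns.
  assert (Ens : ns y (PI / 4) = al * sqrt (1 + kp)).
  { rewrite <- (sqrt_pow2 (ns y (PI / 4))) by lra. rewrite E1, Ecs2.
    replace (alpha_sq y * kp + alpha_sq y) with (alpha_sq y * (1 + kp)) by ring. apply sqrt_mult; lra. }
  assert (Hphi : ns_frac y (- (1 / 2)) = - (sqrt 2 * (al * sqrt (1 + kp)))).
  { rewrite <- Ens. unfold ns. rewrite Hsq, sin_PI4.
    pose proof (sqrt_lt_R0 2 ltac:(lra)). field. lra. }
  assert (Htau : cs_frac y (- (1 / 2)) ^ 2 = 4 * (alpha_sq y * kp)).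
  { rewrite <- Ecs2. unfold cs.
    rewrite Hsq. transitivity (4 * (sin (PI / 4) ^ 2 * cos (PI / 4) ^ 2 * cs_frac y (- (1 / 2)) ^ 2)); [|ring].
    rewrite Hsq, Hcq. field. }
  assert (Hdlt : ds_frac y (- (1 / 2)) ^ 2 = 2 * ds y (PI / 4) ^ 2).
  { unfold ds. rewrite Hsq. transitivity (2 * (sin (PI / 4) ^ 2 * ds_frac y (- (1 / 2)) ^ 2)); [|ring].
    rewrite Hsq. field. }
  assert (Eds : ds y (PI / 4) ^ 2 = alpha_sq y * kp * (1 + kp)).
  { assert (beta_sq y = alpha_sq y * (1 - kp ^ 2)).
    { rewrite Hkp2, Hk2. field. lra. }
    rewrite Ecs2 in E1. nra. }
  rewrite Hphi, Htau, Hdlt, Eds, <- Hal2. field.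
Qed.

(** * The Eisenstein series *)

Definition odd_num (n : nat) : R := 2 * INR n + 1.

Lemma odd_num_ge_1 n : 1 <= odd_num n.
Proof. unfold odd_num. pose proof (pos_INR n). lra. Qed.

Lemma odd_num_S n : odd_num (S n) = odd_num n + 2.
Proof. unfold odd_num. rewrite S_INR. ring. Qed.

(** Crude, but it reduces all convergence questions for the Lambert series to the
    geometric series. *)
Lemma cube_le_exp x : 0 <= x -> x ^ 3 <= 27 * exp x.
Proof.
  intros Hx. replace (exp x) with (exp (x / 3) ^ 3).
  2:{ simpl. rewrite Rmult_1_r, <- !exp_plus. f_equal. field. }
  replace (27 * exp (x / 3) ^ 3) with ((3 * exp (x / 3)) ^ 3) by ring.
  apply pow_incr. split; auto. pose proof (exp_ineq1_le (x / 3)). lra.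
Qed.

Lemma ex_series_exp y : 0 < y -> ex_series (fun n => exp (- (odd_num n * y))).
Proof.
  intros Hy. apply ex_series_ext_R with (fun n => exp (- y) * (exp (- (2 * y)) ^ n)).
  - intros n. replace (exp (- (2 * y)) ^ n) with (exp (- (2 * y) * INR n)).
    rewrite <- exp_plus. f_equal. unfold odd_num. ring.
    induction n as [|n IH]. simpl. rewrite Rmult_0_r. apply exp_0.
    rewrite S_INR. simpl pow. rewrite <- IH, <- exp_plus. f_equal; ring.
  - apply ex_series_scal_R. exists (/ (1 - exp (- (2 * y)))). apply is_series_geom.
    rewrite Rabs_pos_eq by (left; apply exp_pos).
    rewrite <- exp_0. apply exp_increasing; lra.
Qed.

Lemma ex_series_cube_exp y : 0 < y -> ex_series (fun n => odd_num n ^ 3 * exp (- (odd_num n * y))).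
Proof.
  intros Hy. set (c := y / 2). assert (Hc : 0 < c) by (unfold c; lra).
  apply ex_series_dominated with (fun n => 27 / c ^ 3 * exp (- (odd_num n * c))).
  - intros n. pose proof (odd_num_ge_1 n).
    assert (0 < c ^ 3) by (apply pow_lt; auto).
    rewrite Rabs_pos_eq.
    2:{ apply Rmult_le_pos. apply pow_le; lra. left; apply exp_pos. }
    replace (exp (- (odd_num n * y))) with (exp (- (odd_num n * c)) * exp (- (odd_num n * c)))
      by (rewrite <- exp_plus; f_equal; unfold c; field).
    rewrite <- Rmult_assoc. apply Rmult_le_compat_r. left; apply exp_pos.
    apply Rle_trans with (27 * exp (odd_num n * c) / c ^ 3 * exp (- (odd_num n * c))).
    + apply Rmult_le_compat_r. left; apply exp_pos. apply (Rle_div_r (odd_num n ^ 3) (27 * exp (odd_num n * c)) (c ^ 3)); auto.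
      rewrite <- Rpow_mult_distr. apply cube_le_exp. nra.
    + rewrite exp_Ropp. pose proof (exp_pos (odd_num n * c)). right. field. split; lra.
  - apply ex_series_scal_R, ex_series_exp; auto.
Qed.

Lemma ex_series_square_exp y : 0 < y -> ex_series (fun n => odd_num n ^ 2 * exp (- (odd_num n * y))).
Proof.
  intros Hy. apply ex_series_dominated with (fun n => odd_num n ^ 3 * exp (- (odd_num n * y))).
  - intros n. pose proof (odd_num_ge_1 n). pose proof (exp_pos (- (odd_num n * y))).
    rewrite Rabs_pos_eq by (apply Rmult_le_pos; [apply pow_le|]; lra).
    apply Rmult_le_compat_r. lra. simpl. nra.
  - apply ex_series_cube_exp; auto.
Qed.

(** The odd primitive Dirichlet character modulo 8, evaluated at [2 n + 1]. *)
Definition chi (n : nat) : R := (-1) ^ (n / 2).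

Lemma chi_abs n : Rabs (chi n) = 1.
Proof. apply pow_1_abs. Qed.

Lemma chi_SS n : chi (S (S n)) = - chi n.
Proof.
  unfold chi. replace (S (S n)) with (n + 1 * 2)%nat by lia.
  rewrite Nat.div_add by lia. rewrite Nat.add_1_r. simpl. ring.
Qed.

(** The sum of [(a + 4 j)^2 (- r)^j] over the natural numbers [j]. *)
Definition block_sum (r a : R) : R :=
  a ^ 2 / (1 + r) - 8 * a * r / (1 + r) ^ 2 - 16 * r * (1 - r) / (1 + r) ^ 3.

Definition chi_power_sum (t : R) : R :=
  t * block_sum (t ^ 4) 1 + t ^ 3 * block_sum (t ^ 4) 3.

Lemma block_sum_step r a : 0 < r -> block_sum r a + r * block_sum r (a + 4) = a ^ 2.
Proof. intros Hr. unfold block_sum. field. lra. Qed.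

Lemma block_sum_bound r a : 0 < r < 1 -> 1 <= a -> Rabs (block_sum r a) <= 25 * a ^ 2.
Proof.
  intros Hr Ha. unfold block_sum.
  assert (H1 : 0 <= / (1 + r) <= 1).
  { split. left; apply Rinv_0_lt_compat; lra. rewrite <- Rinv_1. apply Rinv_le_contravar; lra. }
  set (i := / (1 + r)) in *.
  replace (a ^ 2 / (1 + r)) with (a ^ 2 * i) by reflexivity.
  replace (8 * a * r / (1 + r) ^ 2) with (8 * a * (r * (i * i))) by (unfold i; field; lra).
  replace (16 * r * (1 - r) / (1 + r) ^ 3) with (16 * (r * (1 - r) * (i * i * i))) by (unfold i; field; lra).
  assert (Hi2 : 0 <= i * i <= 1) by nra.
  assert (Hi3 : 0 <= i * i * i <= 1) by nra.
  assert (H2 : 0 <= a ^ 2 * i <= a ^ 2) by (split; nra).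
  assert (Hri : 0 <= r * (i * i) <= 1) by (split; nra).
  assert (H3 : 0 <= 8 * a * (r * (i * i)) <= 8 * a) by (split; nra).
  assert (Hrr : 0 <= r * (1 - r) <= 1) by (split; nra).
  assert (H4 : 0 <= r * (1 - r) * (i * i * i) <= 1) by (split; nra).
  apply Rabs_le_between. split; nra.
Qed.

(** The sign is opposite two places further on, so the terms with even index and those
    with odd index form two series of the type of [block_sum], and the tails are known
    exactly. *)
Lemma chi_power_series y : 0 < y ->
  is_series (fun n => chi n * odd_num n ^ 2 * exp (- (odd_num n * y))) (chi_power_sum (exp (- y))).
Proof.
  intros Hy. set (t := exp (- y)). set (r := t ^ 4).
  assert (Ht : 0 < t < 1).
  { unfold t. split. apply exp_pos. rewrite <- exp_0. apply exp_increasing; lra. }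
  assert (Hr : 0 < r < 1).
  { unfold r. split. apply pow_lt; tauto. simpl. assert (0 < t * t < 1) by nra. nra. }
  (* tail n + tail (n + 1) is the remainder after n terms. *)
  set (tail := fun n => chi n * exp (- (odd_num n * y)) * block_sum r (odd_num n)).
  assert (Hstep : forall n, chi n * odd_num n ^ 2 * exp (- (odd_num n * y)) = tail n - tail (S (S n))).
  { intros n. unfold tail. rewrite chi_SS, !odd_num_S.
    replace (exp (- ((odd_num n + 2 + 2) * y))) with (r * exp (- (odd_num n * y))).
    2:{ unfold r, t. simpl. rewrite Rmult_1_r, <- !exp_plus. f_equal. ring. }
    rewrite <- (block_sum_step r (odd_num n)) by tauto.
    replace (odd_num n + 2 + 2) with (odd_num n + 4) by ring. ring. }
  assert (Htail : is_lim_seq tail 0).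
  { apply is_lim_seq_abs_0.
    apply is_lim_seq_le_le with (fun _ => 0) (fun n => 25 * (odd_num n ^ 2 * exp (- (odd_num n * y)))).
    - intros n. split. apply Rabs_pos. unfold tail.
      rewrite !Rabs_mult, chi_abs, Rmult_1_l, (Rabs_pos_eq (exp _)) by (left; apply exp_pos).
      pose proof (block_sum_bound r (odd_num n) Hr (odd_num_ge_1 n)).
      pose proof (exp_pos (- (odd_num n * y))). nra.
    - apply is_lim_seq_const.
    - replace (Finite 0) with (Rbar_mult 25 0) by (simpl; f_equal; ring).
      apply is_lim_seq_scal_l. apply ex_series_lim_0. apply ex_series_square_exp; auto. }
  assert (H0 : chi_power_sum t = tail 0%nat + tail 1%nat).
  { unfold chi_power_sum, tail, chi, odd_num. fold r. simpl Nat.div. simpl INR. simpl pow at 1 2 3.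
    replace (exp (- ((2 * 0 + 1) * y))) with t by (unfold t; f_equal; ring).
    replace (exp (- ((2 * 1 + 1) * y))) with (t ^ 3).
    2:{ unfold t. simpl. rewrite Rmult_1_r, <- !exp_plus. f_equal. ring. }
    replace (2 * 0 + 1) with 1 by ring. replace (2 * 1 + 1) with 3 by ring. simpl. ring. }
  rewrite H0.
  apply (is_lim_seq_ext (fun N => (tail 0%nat + tail 1%nat) - (tail (S N) + tail (S (S N))))
    (sum_n (fun n => chi n * odd_num n ^ 2 * exp (- (odd_num n * y)))) (tail 0%nat + tail 1%nat)).
  - intros N. rewrite sum_n_Reals. induction N as [|N IH].
    + simpl sum_f_R0. rewrite Hstep. ring.
    + rewrite tech5, <- IH, Hstep. ring.
  - replace (Finite (tail 0%nat + tail 1%nat)) with (Finite ((tail 0%nat + tail 1%nat) - (0 + 0))) by (f_equal; ring).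
    apply is_lim_seq_minus'. apply is_lim_seq_const.
    apply is_lim_seq_plus'. apply (is_lim_seq_incr_1 tail); auto.
    apply (is_lim_seq_incr_n tail 2) in Htail.
    apply is_lim_seq_ext with (2 := Htail). intros n. f_equal. lia.
Qed.

(** A Lambert series: the sum of [chi n (2 n + 1)^2 q^((2 n + 1) m)] over [n >= 0] and
    [m >= 1], where [q = exp (- y)]. *)
Definition eisenstein (y : R) : R := Series (fun n => chi n * odd_num n ^ 2 / (exp (odd_num n * y) - 1)).

Lemma exp_gt_1 x : 0 < x -> 1 < exp x.
Proof. intros Hx. rewrite <- exp_0. apply exp_increasing; auto. Qed.

Lemma geometric_exp b : 0 < b ->
  is_series (fun m => exp (- (INR (S m) * b))) (/ (exp b - 1)).
Proof.
  intros Hb.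
  assert (H : is_series (fun m => exp (- b) * exp (- b) ^ m) (exp (- b) * / (1 - exp (- b)))).
  { apply (is_series_scal (exp (- b)) (fun m => exp (- b) ^ m)). apply is_series_geom.
    rewrite Rabs_pos_eq by (left; apply exp_pos).
    rewrite <- exp_0. apply exp_increasing; lra. }
  replace (/ (exp b - 1)) with (exp (- b) * / (1 - exp (- b))).
  - revert H. apply is_series_ext_R. intros m.
    replace (exp (- (INR (S m) * b))) with (nome_pow b (S m)).
    rewrite nome_pow_pow. reflexivity.
    unfold nome_pow, exp_nat. rewrite exp_Ropp. reflexivity.
  - rewrite exp_Ropp. pose proof (exp_gt_1 b Hb). field. split; lra.
Qed.

(** Summing the double series over [n] first gives a rational function of [q^m], which
    is the second derivative of the pair of terms [csc (z + i m y) + csc (z - i m y)]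
    at [PI / 4] up to a constant. The number [6] is the contribution of [csc z]
    itself. *)
Lemma octant_sum_eisenstein y : 0 < y -> octant_sum y = 6 - 4 * eisenstein y.
Proof.
  intros Hy.
  assert (Hx : - (1 / 2) < sinh_sq y 1) by (pose proof (sinh_sq_pos y 1 Hy (le_n 1)); lra).
  assert (HG : eisenstein y = Series (fun m => chi_power_sum (exp (- (INR (S m) * y))))).
  { unfold eisenstein.
    set (u := fun m n => chi n * odd_num n ^ 2 * exp (- (odd_num n * (INR (S m) * y)))).
    transitivity (Series (fun n => Series (fun m => u m n))).
    - apply Series_ext. intros n. unfold u. rewrite Series_scal_l.
      pose proof (odd_num_ge_1 n).
      unfold Rdiv. f_equal. symmetry. apply is_series_unique.
      apply is_series_ext_R with (fun m => exp (- (INR (S m) * (odd_num n * y)))).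
      intros m. f_equal. ring. apply geometric_exp. nra.
    - rewrite <- (Series_swap u (nome_pow y) (fun n => odd_num n ^ 2 * exp (- (odd_num n * y)))).
      + apply Series_ext. intros m. apply is_series_unique. apply chi_power_series.
        assert (0 < INR (S m)) by (apply lt_0_INR; lia). nra.
      + intros m n. unfold u. pose proof (odd_num_ge_1 n) as Ho.
        rewrite !Rabs_mult, chi_abs, Rmult_1_l, !Rabs_pos_eq.
        2: left; apply exp_pos. 2: apply pow_le; lra.
        replace (nome_pow y m * (odd_num n ^ 2 * exp (- (odd_num n * y))))
          with (odd_num n ^ 2 * (nome_pow y m * exp (- (odd_num n * y)))) by ring.
        apply Rmult_le_compat_l. apply pow_le; lra.
        unfold nome_pow, exp_nat. rewrite <- exp_Ropp, <- exp_plus.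
        assert (Hle : - (odd_num n * (INR (S m) * y)) <= - (INR m * y) + - (odd_num n * y)).
        { rewrite S_INR. pose proof (pos_INR m).
          assert (0 <= (odd_num n - 1) * (INR m * y)) by (apply Rmult_le_pos; [lra|apply Rmult_le_pos; lra]).
          lra. }
        destruct Hle as [Hlt|Heq]. left; apply exp_increasing; auto. rewrite Heq; lra.
      + intros m; left; apply nome_pow_pos.
      + apply ex_series_nome_pow; auto.
      + apply ex_series_square_exp; auto. }
  rewrite HG. unfold octant_sum.
  set (v := - (1 / 2)).
  assert (E : -4 * Series (fun m => chi_power_sum (exp (- (INR (S m) * y))))
    = (-2) * poles y 1 (res_ns y) v + ((-4) * poles y 2 (res_ns y) v + 4 * poles y 3 (res_ns y) v)).
  { unfold poles. rewrite <- !Series_scal_l.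
    rewrite <- !Series_plus.
    1: { apply Series_ext. intros m.
      replace (exp (- (INR (S m) * y))) with (/ exp_nat y (S m)) by (unfold exp_nat; rewrite exp_Ropp; auto).
      unfold res_ns. rewrite cosh_exp_nat, sinh_sq_exp_nat.
      pose proof (exp_nat_pos y (S m)) as Hp. set (p := exp_nat y (S m)) in *. unfold v.
      replace (((p - / p) / 2) ^ 2 - - (1 / 2)) with ((p ^ 4 + 1) / (4 * p ^ 2)) by (field; lra).
      assert (0 < p ^ 4) by (apply pow_lt; auto).
      unfold chi_power_sum, block_sum. field. repeat split; try lra. }
    all: repeat apply ex_series_plus_R; apply ex_series_scal_R, ex_poles; auto using exp_bounded_ns. }
  lra.
Qed.

Lemma csch_exp x : 0 < x -> csch (x / 2) ^ 2 = 4 * exp x / (exp x - 1) ^ 2.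
Proof.
  intros Hx. unfold csch, sinh.
  assert (E : exp x = exp (x / 2) ^ 2).
  { simpl. rewrite Rmult_1_r, <- exp_plus. f_equal; field. }
  rewrite E, exp_Ropp. pose proof (exp_gt_1 (x / 2) ltac:(lra)) as H.
  set (q := exp (x / 2)) in *. field. repeat split; nra.
Qed.

Lemma is_derive_eisenstein y : 0 < y ->
  is_derive eisenstein y
    (- (1 / 4) * Series (fun n => chi n * odd_num n ^ 3 * csch (odd_num n * y / 2) ^ 2)).
Proof.
  intros Hy. rewrite <- Series_scal_l. unfold eisenstein.
  set (du := fun n t => - (1 / 4) * (chi n * odd_num n ^ 3 * csch (odd_num n * t / 2) ^ 2)).
  set (K := / (1 - exp (- (y / 2))) ^ 2).
  assert (Hsmall : exp (- (y / 2)) < 1) by (rewrite <- exp_0; apply exp_increasing; lra).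
  apply (is_derive_Series (fun n t => chi n * odd_num n ^ 2 / (exp (odd_num n * t) - 1)) du
    (fun n => K * (odd_num n ^ 3 * exp (- (odd_num n * (y / 2))))) y (y / 2)).
  - lra.
  - apply ex_series_scal_R, ex_series_cube_exp; lra.
  - intros t Ht. apply Rabs_lt_between in Ht.
    assert (Ht0 : 0 < t) by lra.
    apply ex_series_dominated with (fun n => / (1 - exp (- t)) * (odd_num n ^ 2 * exp (- (odd_num n * t)))).
    + intros n. pose proof (odd_num_ge_1 n) as Ho.
      unfold Rdiv. rewrite !Rabs_mult, chi_abs, Rmult_1_l, Rabs_inv.
      pose proof (exp_gt_1 (odd_num n * t) ltac:(nra)) as He.
      rewrite !Rabs_pos_eq; try lra. 2: apply pow_le; lra.
      replace (/ (1 - exp (- t)) * (odd_num n ^ 2 * exp (- (odd_num n * t))))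
        with (odd_num n ^ 2 * (/ (1 - exp (- t)) * exp (- (odd_num n * t)))) by ring.
      apply Rmult_le_compat_l. apply pow_le; lra.
      assert (H1 : exp (- t) < 1) by (rewrite <- exp_0; apply exp_increasing; lra).
      rewrite (exp_Ropp (odd_num n * t)), <- Rinv_mult. apply Rinv_le_contravar.
      apply Rmult_lt_0_compat; lra.
      assert (1 <= exp (- t) * exp (odd_num n * t)); [|lra].
      rewrite <- exp_plus, <- exp_0.
      destruct (Req_dec (- t + odd_num n * t) 0) as [E|E]. rewrite E; lra.
      left; apply exp_increasing. nra.
    + apply ex_series_scal_R, ex_series_square_exp; auto.
  - intros n t Ht. apply Rabs_lt_between in Ht. pose proof (odd_num_ge_1 n) as Ho.
    pose proof (exp_gt_1 (odd_num n * t) ltac:(nra)) as He.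
    unfold du. rewrite csch_exp by nra.
    auto_derive. lra. field. lra.
  - intros n t Ht. apply Rabs_lt_between in Ht. pose proof (odd_num_ge_1 n) as Ho.
    pose proof (exp_gt_1 (odd_num n * t) ltac:(nra)) as He.
    unfold du. rewrite csch_exp by nra.
    replace (- (1 / 4) * (chi n * odd_num n ^ 3 * (4 * exp (odd_num n * t) / (exp (odd_num n * t) - 1) ^ 2)))
      with (- (chi n) * (odd_num n ^ 3 * (exp (odd_num n * t) / (exp (odd_num n * t) - 1) ^ 2))) by (field; lra).
    rewrite Rabs_mult, Rabs_Ropp, chi_abs, Rmult_1_l, Rabs_pos_eq.
    2:{ apply Rmult_le_pos. apply pow_le; lra.
        left. apply Rdiv_lt_0_compat. lra. apply pow_lt; lra. }
    replace (K * (odd_num n ^ 3 * exp (- (odd_num n * (y / 2)))))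
      with (odd_num n ^ 3 * (K * exp (- (odd_num n * (y / 2))))) by ring.
    apply Rmult_le_compat_l. apply pow_le; lra.
    replace (exp (odd_num n * t) / (exp (odd_num n * t) - 1) ^ 2)
      with (/ (1 - exp (- (odd_num n * t))) ^ 2 * exp (- (odd_num n * t))).
    2:{ rewrite exp_Ropp. field. repeat split; lra. }
    assert (Hy2 : y / 2 <= odd_num n * t) by nra.
    assert (H1 : exp (- (odd_num n * t)) <= exp (- (y / 2))).
    { destruct Hy2 as [H|H]. left; apply exp_increasing; lra. rewrite H; lra. }
    assert (H2 : exp (- (odd_num n * t)) <= exp (- (odd_num n * (y / 2)))).
    { left; apply exp_increasing. nra. }
    apply Rmult_le_compat; auto.
    + left. apply Rinv_0_lt_compat, pow_lt. lra.
    + left; apply exp_pos.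
    + unfold K. apply Rinv_le_contravar. apply pow_lt; lra. apply pow_incr. lra.
Qed.

(** * Complete elliptic integrals and the evaluation of the sum *)

Lemma modulus_sq_pos k t : -1 < k < 1 -> 0 < 1 - k ^ 2 * sin t ^ 2.
Proof. intros Hk. apply modulus_pos. nra. Qed.

Lemma continuous_ellK_integrand k t : -1 < k < 1 ->
  continuous (fun s => 1 / sqrt (1 - k ^ 2 * sin s ^ 2)) t.
Proof. intros Hk. apply continuous_ellF_integrand. nra. Qed.

Lemma continuous_ellE_integrand k t : -1 < k < 1 ->
  continuous (fun s => sqrt (1 - k ^ 2 * sin s ^ 2)) t.
Proof.
  intros Hk. apply (@ex_derive_continuous R_AbsRing R_NormedModule).
  pose proof (modulus_sq_pos k t Hk) as H. auto_derive. auto.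
Qed.

Lemma is_RInt_ellK k : -1 < k < 1 ->
  is_RInt (fun t => 1 / sqrt (1 - k ^ 2 * sin t ^ 2)) 0 (PI / 2) (ellipticK k).
Proof.
  intros Hk. apply (@RInt_correct R_CompleteNormedModule).
  apply (@ex_RInt_continuous R_CompleteNormedModule).
  intros; apply continuous_ellK_integrand; auto.
Qed.

Lemma is_RInt_ellE k : -1 < k < 1 ->
  is_RInt (fun t => sqrt (1 - k ^ 2 * sin t ^ 2)) 0 (PI / 2) (ellipticE k).
Proof.
  intros Hk. apply (@RInt_correct R_CompleteNormedModule).
  apply (@ex_RInt_continuous R_CompleteNormedModule).
  intros; apply continuous_ellE_integrand; auto.
Qed.

Definition dK_integrand (k t : R) : R :=
  k * sin t ^ 2 / ((1 - k ^ 2 * sin t ^ 2) * sqrt (1 - k ^ 2 * sin t ^ 2)).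

Lemma is_derive_ellK_integrand k t : -1 < k < 1 ->
  is_derive (fun u => 1 / sqrt (1 - u ^ 2 * sin t ^ 2)) k (dK_integrand k t).
Proof.
  intros Hk. pose proof (modulus_sq_pos k t Hk) as H.
  assert (Hs : 0 < sqrt (1 - k ^ 2 * sin t ^ 2)) by (apply sqrt_lt_R0; auto).
  unfold dK_integrand. auto_derive.
  - change (1 + - (k * (k * 1) * (sin t * (sin t * 1)))) with (1 - k ^ 2 * sin t ^ 2). repeat split; auto. lra.
  - change (1 + - (k * (k * 1) * (sin t * (sin t * 1)))) with (1 - k ^ 2 * sin t ^ 2).
    assert (E : 1 - k ^ 2 * sin t ^ 2 = sqrt (1 - k ^ 2 * sin t ^ 2) ^ 2)
      by (symmetry; apply pow2_sqrt; lra).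
    set (D := sqrt (1 - k ^ 2 * sin t ^ 2)) in *. rewrite E. field. lra.
Qed.

(** [(1 - w) / (w sqrt w)], with [w = 1 - k^2 (sin t)^2], differs from a combination
    of the two complete integrands by a multiple of the derivative of [k^2 sin t cos t
    / sqrt w], which vanishes at both ends. *)
Lemma is_RInt_dK k : 0 < k < 1 ->
  is_RInt (dK_integrand k) 0 (PI / 2) ((ellipticE k / (1 - k ^ 2) - ellipticK k) / k).
Proof.
  intros Hk. assert (Hk' : -1 < k < 1) by lra.
  assert (Hk2 : 0 < 1 - k ^ 2) by nra.
  set (X := fun t => k ^ 2 * sin t * cos t / sqrt (1 - k ^ 2 * sin t ^ 2)).
  set (dX := fun t => sqrt (1 - k ^ 2 * sin t ^ 2)
       - (1 - k ^ 2) / ((1 - k ^ 2 * sin t ^ 2) * sqrt (1 - k ^ 2 * sin t ^ 2))).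
  assert (HX : forall t, is_derive X t (dX t)).
  { intros t. pose proof (modulus_sq_pos k t Hk') as H.
    assert (Hs : 0 < sqrt (1 - k ^ 2 * sin t ^ 2)) by (apply sqrt_lt_R0; auto).
    pose proof (cos_sq t) as Hc.
    unfold X, dX. auto_derive.
    - change (1 + - (k * (k * 1) * (sin t * (sin t * 1)))) with (1 - k ^ 2 * sin t ^ 2). repeat split; auto. lra.
    - change (1 + - (k * (k * 1) * (sin t * (sin t * 1)))) with (1 - k ^ 2 * sin t ^ 2).
      assert (E : sqrt (1 - k ^ 2 * sin t ^ 2) ^ 2 = 1 - k ^ 2 * sin t ^ 2) by (apply pow2_sqrt; lra).
      set (D := sqrt (1 - k ^ 2 * sin t ^ 2)) in *. rewrite <- E.
      apply Rmult_eq_reg_r with (D ^ 3); [|apply pow_nonzero; lra].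
      transitivity (k ^ 2 * (cos t ^ 2 - sin t ^ 2) * D ^ 2 + k ^ 4 * sin t ^ 2 * cos t ^ 2).
      field; lra.
      transitivity (D ^ 2 * D ^ 2 - (1 - k ^ 2)).
      rewrite Hc, E. ring. field; lra. }
  assert (HdXc : forall t, continuous dX t).
  { intros t. apply (@ex_derive_continuous R_AbsRing R_NormedModule).
    pose proof (modulus_sq_pos k t Hk') as H.
    assert (Hs : 0 < sqrt (1 - k ^ 2 * sin t ^ 2)) by (apply sqrt_lt_R0; auto).
    unfold dX. auto_derive.
    change (1 + - (k * (k * 1) * (sin t * (sin t * 1)))) with (1 - k ^ 2 * sin t ^ 2).
    repeat split; auto. nra. }
  assert (HIX : is_RInt dX 0 (PI / 2) (X (PI / 2) - X 0)).
  { apply (is_RInt_derive X dX 0 (PI / 2)); auto. }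
  assert (EX : X (PI / 2) - X 0 = 0).
  { unfold X. rewrite cos_PI2, sin_0. unfold Rdiv. ring. }
  rewrite EX in HIX.
  pose proof (is_RInt_minus _ _ _ _ _ _ (is_RInt_ellE k Hk') HIX) as H1.
  pose proof (is_RInt_scal _ _ _ (/ (1 - k ^ 2)) _ H1) as H2.
  pose proof (is_RInt_minus _ _ _ _ _ _ H2 (is_RInt_ellK k Hk')) as H3.
  pose proof (is_RInt_scal _ _ _ (/ k) _ H3) as H4.
  replace ((ellipticE k / (1 - k ^ 2) - ellipticK k) / k)
    with (scal (/ k) (minus (scal (/ (1 - k ^ 2)) (minus (ellipticE k) 0)) (ellipticK k))).
  2:{ change (/ k * (/ (1 - k ^ 2) * (ellipticE k - 0) - ellipticK k)
        = (ellipticE k / (1 - k ^ 2) - ellipticK k) / k). field. lra. }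
  refine (is_RInt_ext _ _ _ _ _ _ H4).
  intros t _. unfold dX, dK_integrand.
  pose proof (modulus_sq_pos k t Hk') as H.
  assert (Hs : 0 < sqrt (1 - k ^ 2 * sin t ^ 2)) by (apply sqrt_lt_R0; auto).
  assert (E : sqrt (1 - k ^ 2 * sin t ^ 2) ^ 2 = 1 - k ^ 2 * sin t ^ 2) by (apply pow2_sqrt; lra).
  set (w := 1 - k ^ 2 * sin t ^ 2) in *. set (D := sqrt w) in *.
  assert (Ew : k * sin t ^ 2 = (1 - w) / k) by (unfold w; field; lra). rewrite Ew.
  assert (G : / k * (/ (1 - k ^ 2) * (D - (D - (1 - k ^ 2) / (w * D))) - 1 / D)
     = (1 - w) / k / (w * D)) by (field; lra).
  exact G.
Qed.

Lemma is_derive_ellipticK k : 0 < k < 1 ->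
  is_derive ellipticK k ((ellipticE k / (1 - k ^ 2) - ellipticK k) / k).
Proof.
  intros Hk.
  rewrite <- (is_RInt_unique _ _ _ _ (is_RInt_dK k Hk)).
  set (f := fun u t => 1 / sqrt (1 - u ^ 2 * sin t ^ 2)).
  set (r := Rmin k (1 - k)).
  assert (Hr : 0 < r) by (apply Rmin_pos; lra).
  assert (Hball : forall u, Rabs (u - k) < r -> -1 < u < 1).
  { intros u Hu. apply Rabs_lt_between in Hu. unfold r in Hu.
    pose proof (Rmin_l k (1 - k)). pose proof (Rmin_r k (1 - k)). lra. }
  rewrite <- (RInt_ext (fun t => Derive (fun u => f u t) k)).
  2:{ intros t _. apply is_derive_unique. apply is_derive_ellK_integrand. lra. }
  apply (is_derive_RInt_param f 0 (PI / 2) k).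
  - exists (mkposreal r Hr). intros u Hu t _. eexists. apply is_derive_ellK_integrand. apply Hball, Hu.
  - intros t _.
    apply continuity_2d_pt_ext_loc with dK_integrand.
    { exists (mkposreal r Hr). intros u v Hu _. symmetry. apply is_derive_unique.
      apply is_derive_ellK_integrand. apply Hball, Hu. }
    assert (Hpos : 0 < 1 - k ^ 2 * sin t ^ 2) by (apply modulus_sq_pos; lra).
    assert (Hsin : continuity_2d_pt (fun _ v => sin v) k t).
    { apply (continuity_1d_2d_pt_comp sin (fun _ v => v)). apply continuity_sin.
      apply continuity_2d_pt_id2. }
    assert (Hsin2 : continuity_2d_pt (fun _ v => sin v ^ 2) k t).
    { apply continuity_2d_pt_ext with (fun _ v => sin v * sin v). intros; ring.
      apply continuity_2d_pt_mult; auto. }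
    assert (Hw : continuity_2d_pt (fun u v => 1 - u ^ 2 * sin v ^ 2) k t).
    { apply continuity_2d_pt_minus. apply continuity_2d_pt_const.
      apply continuity_2d_pt_ext with (fun u v => (u * u) * sin v ^ 2). intros; ring.
      apply continuity_2d_pt_mult; auto. apply continuity_2d_pt_mult; apply continuity_2d_pt_id1. }
    unfold dK_integrand, Rdiv. apply continuity_2d_pt_mult.
    + apply continuity_2d_pt_mult; auto. apply continuity_2d_pt_id1.
    + apply continuity_2d_pt_inv.
      * apply continuity_2d_pt_mult; auto.
        apply (continuity_1d_2d_pt_comp sqrt (fun u v => 1 - u ^ 2 * sin v ^ 2)); auto.
        apply continuity_pt_sqrt. lra.
      * apply Rgt_not_eq. apply Rmult_lt_0_compat; auto. apply sqrt_lt_R0; auto.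
  - exists (mkposreal r Hr). intros u Hu. eexists. apply is_RInt_ellK. apply Hball, Hu.
Qed.

Lemma ellipticK_pos k : -1 < k < 1 -> 0 < ellipticK k.
Proof.
  intros Hk. unfold ellipticK. pose proof PI2_1. apply RInt_gt_0. lra.
  - intros t _. apply Rdiv_lt_0_compat. lra. apply sqrt_lt_R0, modulus_sq_pos; auto.
  - intros t _. apply continuous_ellK_integrand; auto.
Qed.

Lemma sin2_interior t : 0 < t < PI / 2 -> 0 < sin t ^ 2 < 1.
Proof.
  intros Ht. pose proof (cos_sq t). pose proof PI2_1.
  assert (0 < sin t) by (apply sin_gt_0; lra).
  assert (0 < cos t) by (apply cos_gt_0; lra).
  assert (0 < cos t ^ 2) by (apply pow_lt; auto). split; [apply pow_lt; auto|lra].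
Qed.

Lemma ellipticK_incr k l : 0 < k -> k < l -> l < 1 -> ellipticK k < ellipticK l.
Proof.
  intros Hk Hkl Hl. unfold ellipticK. pose proof PI2_1. apply RInt_lt. lra.
  - intros t _. apply continuous_ellK_integrand; lra.
  - intros t _. apply continuous_ellK_integrand; lra.
  - intros t Ht. pose proof (sin2_interior t Ht).
    unfold Rdiv. apply Rmult_lt_compat_l. lra.
    pose proof (modulus_sq_pos l t ltac:(lra)). pose proof (modulus_sq_pos k t ltac:(lra)).
    assert (k ^ 2 < l ^ 2) by nra.
    apply Rinv_lt_contravar.
    + apply Rmult_lt_0_compat; apply sqrt_lt_R0; auto.
    + apply sqrt_lt_1_alt. split; [lra|]. nra.
Qed.

(** Applied to [k] and to the complementary modulus, this is what makes [legendre]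
    positive. *)
Lemma ellipticE_gt k : 0 < k < 1 -> (1 - k ^ 2) * ellipticK k < ellipticE k.
Proof.
  intros Hk. pose proof PI2_1.
  assert (HI : is_RInt (fun t => (1 - k ^ 2) * (1 / sqrt (1 - k ^ 2 * sin t ^ 2))) 0 (PI / 2)
     ((1 - k ^ 2) * ellipticK k)).
  { apply (is_RInt_scal (fun t => 1 / sqrt (1 - k ^ 2 * sin t ^ 2)) 0 (PI / 2) (1 - k ^ 2)).
    apply is_RInt_ellK. lra. }
  rewrite <- (is_RInt_unique _ _ _ _ HI). unfold ellipticE. apply RInt_lt. lra.
  - intros t _. apply continuous_ellE_integrand; lra.
  - intros t _. apply (@continuous_scal_r R_UniformSpace R_AbsRing R_NormedModule (1 - k ^ 2)).
    apply continuous_ellK_integrand; lra.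
  - intros t Ht. pose proof (sin2_interior t Ht). pose proof (modulus_sq_pos k t ltac:(lra)) as Hp.
    assert (Hs : 0 < sqrt (1 - k ^ 2 * sin t ^ 2)) by (apply sqrt_lt_R0; auto).
    replace ((1 - k ^ 2) * (1 / sqrt (1 - k ^ 2 * sin t ^ 2)))
      with ((1 - k ^ 2) / sqrt (1 - k ^ 2 * sin t ^ 2)) by (field; lra).
    apply Rlt_div_l; auto. rewrite sqrt_sqrt by lra.
    assert (0 < k ^ 2) by (apply pow_lt; lra). nra.
Qed.

Lemma compl_modulus_facts k : 0 < k < 1 ->
  0 < compl_modulus k < 1 /\ compl_modulus k ^ 2 = 1 - k ^ 2.
Proof.
  intros Hk. assert (E : compl_modulus k ^ 2 = 1 - k ^ 2) by (apply pow2_sqrt; nra).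
  assert (0 < compl_modulus k) by (apply sqrt_lt_R0; nra).
  split; auto. split; auto. nra.
Qed.

(** Up to a factor, the Wronskian of [K] and [K'] as functions of the modulus. *)
Definition legendre (k : R) : R :=
  ellipticK (compl_modulus k) * (ellipticE k - ellipticK k)
  + ellipticE (compl_modulus k) * ellipticK k.

Lemma legendre_pos k : 0 < k < 1 -> 0 < legendre k.
Proof.
  intros Hk. destruct (compl_modulus_facts k Hk) as [Hk' E].
  pose proof (ellipticE_gt k Hk). pose proof (ellipticE_gt _ Hk') as H2.
  pose proof (ellipticK_pos k ltac:(lra)). pose proof (ellipticK_pos (compl_modulus k) ltac:(lra)).
  rewrite E in H2. unfold legendre. nra.
Qed.

Definition period_ratio (k : R) : R := PI * (ellipticK (compl_modulus k) / ellipticK k).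

(** [K] increases with the modulus, and so [K'] decreases. *)
Lemma period_ratio_inj k l : 0 < k < 1 -> 0 < l < 1 -> period_ratio k = period_ratio l -> k = l.
Proof.
  assert (Hd : forall k l, 0 < k < 1 -> 0 < l < 1 -> k < l -> period_ratio l < period_ratio k).
  { intros a b Ha Hb Hab. unfold period_ratio. apply Rmult_lt_compat_l. apply PI_RGT_0.
    destruct (compl_modulus_facts a Ha) as [Ha' Ea]. destruct (compl_modulus_facts b Hb) as [Hb' Eb].
    assert (compl_modulus b < compl_modulus a) by nra.
    pose proof (ellipticK_incr a b ltac:(lra) Hab ltac:(lra)).
    pose proof (ellipticK_incr (compl_modulus b) (compl_modulus a) ltac:(lra) ltac:(lra) ltac:(lra)).
    pose proof (ellipticK_pos a ltac:(lra)). pose proof (ellipticK_pos (compl_modulus b) ltac:(lra)).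
    apply Rlt_div_l; [lra|].
    apply Rlt_trans with (ellipticK (compl_modulus a) / ellipticK a * ellipticK a).
    field_simplify; lra.
    apply Rmult_lt_compat_l; auto. apply Rdiv_lt_0_compat; lra. }
  intros Hk Hl E. destruct (Rtotal_order k l) as [H|[H|H]]; auto; exfalso.
  - pose proof (Hd k l Hk Hl H). lra.
  - pose proof (Hd l k Hl Hk H). lra.
Qed.

Definition eisenstein_value (k : R) : R :=
  3 / 2 - sqrt 2 / 4 * (2 * ellipticK k / PI) ^ 3
    * (compl_modulus k * (2 + compl_modulus k) * sqrt (1 + compl_modulus k)).

(** The function with parameter [y = period_ratio k] has some modulus [l] with the
    same period ratio, and injectivity forces [l = k]. *)
Lemma eisenstein_closed_form k : 0 < k < 1 -> eisenstein (period_ratio k) = eisenstein_value k.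
Proof.
  intros Hk. destruct (compl_modulus_facts k Hk) as [Hk' _].
  pose proof PI_RGT_0 as HPI.
  assert (Hy : 0 < period_ratio k).
  { apply Rmult_lt_0_compat; auto. apply Rdiv_lt_0_compat; apply ellipticK_pos; lra. }
  destruct (uniformisation _ Hy) as [al [l [Hal [Hl [E1 [E2 E3]]]]]].
  change (ellipticK l = al * (PI / 2)) in E1.
  change (ellipticK (compl_modulus l) = al * (period_ratio k / 2)) in E2.
  assert (Hkl : k = l).
  { apply period_ratio_inj; auto. unfold period_ratio at 2. rewrite E1, E2. field. lra. }
  subst l. rewrite octant_sum_eisenstein in E3 by auto.
  unfold eisenstein_value. replace (2 * ellipticK k / PI) with al by (rewrite E1; field; lra). lra.
Qed.

Lemma is_derive_compl_modulus k : 0 < k < 1 ->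
  is_derive compl_modulus k (- k / compl_modulus k).
Proof.
  intros Hk. destruct (compl_modulus_facts k Hk) as [Hk' _]. unfold compl_modulus in *.
  auto_derive. nra. replace (1 + - (k * (k * 1))) with (1 - k ^ 2) by ring. field. lra.
Qed.

(** The derivatives of [K] and [K'] combine to the Wronskian [legendre]. *)
Lemma is_derive_period_ratio k : 0 < k < 1 ->
  is_derive period_ratio k
    (- (PI * legendre k / (k * compl_modulus k ^ 2 * ellipticK k ^ 2))).
Proof.
  intros Hk. destruct (compl_modulus_facts k Hk) as [Hk' E].
  pose proof (ellipticK_pos k ltac:(lra)) as HK.
  pose proof (is_derive_ellipticK k Hk) as D1. pose proof (is_derive_ellipticK _ Hk') as D2.
  pose proof (is_derive_compl_modulus k Hk) as D3.
  unfold period_ratio. auto_derive.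
  - repeat split; try (eexists; eassumption); try lra.
  - rewrite_Derive ellipticK k ((ellipticE k / (1 - k ^ 2) - ellipticK k) / k) D1.
    rewrite_Derive ellipticK (compl_modulus k)
      ((ellipticE (compl_modulus k) / (1 - compl_modulus k ^ 2) - ellipticK (compl_modulus k)) / compl_modulus k) D2.
    rewrite_Derive compl_modulus k (- k / compl_modulus k) D3.
    unfold legendre. rewrite E. replace (1 - (1 - k ^ 2)) with (k ^ 2) by ring. rewrite <- E.
    set (c := compl_modulus k) in *.
    apply Rmult_eq_reg_r with (k * c ^ 2 * ellipticK k ^ 2).
    2:{ apply Rgt_not_eq. repeat apply Rmult_lt_0_compat; try lra; apply pow_lt; lra. }
    field_simplify_eq; [|repeat split; lra].
    replace (c ^ 2) with (1 - k ^ 2) by lra.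
    ring.
Qed.

Lemma is_derive_weight3_form k : 0 < k < 1 ->
  let c := compl_modulus k in
  let K := ellipticK k in
  let E := ellipticE k in
  is_derive eisenstein_value k
    (- (2 * sqrt 2 / PI ^ 3) *
      (3 * K ^ 2 * ((E / c ^ 2 - K) / k) * (c * (2 + c) * sqrt (1 + c))
       + K ^ 3 * (- k / c) * (2 * (1 + c) * sqrt (1 + c) + c * (2 + c) / (2 * sqrt (1 + c))))).
Proof.
  intros Hk c K E. destruct (compl_modulus_facts k Hk) as [Hk' Ec]. fold c in Hk', Ec.
  pose proof (is_derive_ellipticK k Hk) as D1. rewrite <- Ec in D1.
  pose proof (is_derive_compl_modulus k Hk) as D3.
  pose proof PI_RGT_0 as HPI.
  assert (Hs : 0 < sqrt (1 + c)) by (apply sqrt_lt_R0; lra).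
  unfold eisenstein_value. auto_derive.
  - fold c. repeat split; try (eexists; eassumption); try lra.
  - rewrite_Derive ellipticK k ((E / c ^ 2 - K) / k) D1.
    rewrite_Derive compl_modulus k (- k / c) D3.
    fold c K. field. repeat split; lra.
Qed.

(** Both sides have the square [2 (1 + k')]. *)
Lemma sqrt_sum k : 0 < k < 1 ->
  sqrt (1 - k) + sqrt (1 + k) = sqrt 2 * sqrt (1 + compl_modulus k).
Proof.
  intros Hk. destruct (compl_modulus_facts k Hk) as [Hk' _].
  rewrite <- sqrt_mult by lra.
  assert (Ha : 0 < sqrt (1 - k)) by (apply sqrt_lt_R0; lra).
  assert (Hb : 0 < sqrt (1 + k)) by (apply sqrt_lt_R0; lra).
  rewrite <- (sqrt_pow2 (sqrt (1 - k) + sqrt (1 + k))) by lra. f_equal.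
  assert (E : sqrt (1 - k) * sqrt (1 + k) = compl_modulus k).
  { rewrite <- sqrt_mult by lra. unfold compl_modulus. f_equal. ring. }
  rewrite <- E.
  pose proof (pow2_sqrt (1 - k) ltac:(lra)). pose proof (pow2_sqrt (1 + k) ltac:(lra)). lra.
Qed.

Lemma modulus_times_sqrt_diff k : 0 < k < 1 ->
  k * (sqrt (1 + k) - sqrt (1 - k))
  = (sqrt (1 - k) + sqrt (1 + k)) * (1 - compl_modulus k).
Proof.
  intros Hk.
  assert (E : sqrt (1 - k) * sqrt (1 + k) = compl_modulus k).
  { rewrite <- sqrt_mult by lra. unfold compl_modulus. f_equal. ring. }
  rewrite <- E.
  pose proof (pow2_sqrt (1 - k) ltac:(lra)) as Ha. pose proof (pow2_sqrt (1 + k) ltac:(lra)) as Hb.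
  set (a := sqrt (1 - k)) in *. set (b := sqrt (1 + k)) in *.
  replace k with ((b ^ 2 - a ^ 2) / 2) by lra.
  replace 1 with ((a ^ 2 + b ^ 2) / 2) at 1 by lra. field.
Qed.

Lemma coefA_compl k : 0 < k < 1 ->
  coefA k = - (sqrt (1 - k) + sqrt (1 + k)) * (1 + compl_modulus k) * (2 + compl_modulus k).
Proof.
  intros Hk. destruct (compl_modulus_facts k Hk) as [_ Ec].
  pose proof (modulus_times_sqrt_diff k Hk) as E. unfold coefA.
  set (a := sqrt (1 - k)) in *. set (b := sqrt (1 + k)) in *. set (c := compl_modulus k) in *.
  transitivity (k ^ 2 * (a + b) + 3 * (k * (b - a)) - 6 * (a + b)). ring.
  rewrite E. replace (k ^ 2) with (1 - c ^ 2) by lra. ring.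
Qed.

Lemma coefB_compl k : 0 < k < 1 ->
  let c := compl_modulus k in
  coefB k = (sqrt (1 - k) + sqrt (1 + k))
    * (18 + 18 * c + (1 - c ^ 2) * (1 - c ^ 2 + 8 * (1 - c) - 23)).
Proof.
  intros Hk c. destruct (compl_modulus_facts k Hk) as [_ Ec].
  pose proof (modulus_times_sqrt_diff k Hk) as E. unfold coefB.
  set (a := sqrt (1 - k)) in *. set (b := sqrt (1 + k)) in *. fold c in Ec, E.
  transitivity (36 * (a + b) - 18 * (k * (b - a))
    + k ^ 2 * (k ^ 2 * (a + b) + 8 * (k * (b - a)) - 23 * (a + b))). ring.
  rewrite E. replace (k ^ 2) with (1 - c ^ 2) by lra. ring.
Qed.

Definition csch_series (y : R) : R :=
  Series (fun n => chi n * odd_num n ^ 3 * csch (odd_num n * y / 2) ^ 2).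

(** Both sides of [eisenstein_closed_form] are differentiated in [k]; the chain rule
    on the left produces the series and the denominator. *)
Lemma csch_series_pos_modulus k : 0 < k < 1 ->
  csch_series (period_ratio k) =
    4 * compl_modulus k * ellipticK k ^ 4
      * (6 * coefA k * ellipticE k + coefB k * ellipticK k)
    / (PI ^ 4 * (compl_modulus k + 1) * legendre k).
Proof.
  intros Hk. destruct (compl_modulus_facts k Hk) as [Hk' Ec].
  pose proof PI_RGT_0 as HPI. pose proof (ellipticK_pos k ltac:(lra)) as HK.
  pose proof (legendre_pos k Hk) as HW.
  assert (Hy : 0 < period_ratio k).
  { apply Rmult_lt_0_compat; auto. apply Rdiv_lt_0_compat; auto; apply ellipticK_pos; lra. }
  pose proof (is_derive_comp eisenstein period_ratio k _ _
    (is_derive_eisenstein _ Hy) (is_derive_period_ratio k Hk)) as D1.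
  assert (D2 : is_derive eisenstein_value k
     (scal (- (PI * legendre k / (k * compl_modulus k ^ 2 * ellipticK k ^ 2)))
        (- (1 / 4) * csch_series (period_ratio k)))).
  { refine (is_derive_ext_loc _ _ _ _ _ D1).
    assert (Hr : 0 < Rmin k (1 - k)) by (apply Rmin_pos; lra).
    exists (mkposreal _ Hr). intros t Ht. apply eisenstein_closed_form.
    change (Rabs (t - k) < Rmin k (1 - k)) in Ht. apply Rabs_lt_between in Ht.
    pose proof (Rmin_l k (1 - k)). pose proof (Rmin_r k (1 - k)). lra. }
  pose proof (is_derive_unique _ _ _ (is_derive_weight3_form k Hk)) as U1.
  pose proof (is_derive_unique _ _ _ D2) as U2.
  rewrite U1 in U2.
  change (scal ?a ?b) with (a * b) in U2.
  rewrite (coefA_compl k Hk), (coefB_compl k Hk), (sqrt_sum k Hk).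
  set (c := compl_modulus k) in *. set (K := ellipticK k) in *. set (E := ellipticE k) in *.
  set (W := legendre k) in *. set (S := csch_series (period_ratio k)) in *.
  assert (Hs : 0 < sqrt (1 + c)) by (apply sqrt_lt_R0; lra).
  assert (Hs2 : 1 + c = sqrt (1 + c) ^ 2) by (symmetry; apply pow2_sqrt; lra).
  set (s := sqrt (1 + c)) in *.
  assert (ES : S = 4 * k * c ^ 2 * K ^ 2 / (PI * W) *
     (- (2 * sqrt 2 / PI ^ 3) *
      (3 * K ^ 2 * ((E / c ^ 2 - K) / k) * (c * (2 + c) * s)
       + K ^ 3 * (- k / c) * (2 * (1 + c) * s + c * (2 + c) / (2 * s))))).
  { rewrite U2. field. repeat split; lra. }
  rewrite ES.
  transitivity (4 * c ^ 2 * K ^ 2 / (PI * W) *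
     (- (2 * sqrt 2 / PI ^ 3) *
      (3 * K ^ 2 * (E / c ^ 2 - K) * (c * (2 + c) * s)
       + K ^ 3 * (- k ^ 2 / c) * (2 * (1 + c) * s + c * (2 + c) / (2 * s))))).
  field. repeat split; lra.
  replace (k ^ 2) with (1 - c ^ 2) by lra.
  replace (c * (2 + c) / (2 * s)) with (c * (2 + c) * s / (2 * (1 + c))).
  2:{ rewrite Hs2. field. lra. }
  field. repeat split; lra.
Qed.

Lemma csch_series_modulus k : 0 < k ^ 2 < 1 ->
  csch_series (period_ratio k) =
    4 * compl_modulus k * ellipticK k ^ 4
      * (6 * coefA k * ellipticE k + coefB k * ellipticK k)
    / (PI ^ 4 * (compl_modulus k + 1) * legendre k).
Proof.
  intros Hk. destruct (Rlt_dec 0 k) as [Hpos|Hneg].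
  { apply csch_series_pos_modulus. nra. }
  assert (Hm : 0 < - k < 1) by nra.
  assert (E2 : (- k) ^ 2 = k ^ 2) by ring.
  assert (EK : ellipticK (- k) = ellipticK k) by (unfold ellipticK; rewrite E2; auto).
  assert (EE : ellipticE (- k) = ellipticE k) by (unfold ellipticE; rewrite E2; auto).
  assert (EC : compl_modulus (- k) = compl_modulus k) by (unfold compl_modulus; rewrite E2; auto).
  assert (EA : coefA (- k) = coefA k).
  { unfold coefA. replace (1 - - k) with (1 + k) by ring. replace (1 + - k) with (1 - k) by ring. ring. }
  assert (EB : coefB (- k) = coefB k).
  { unfold coefB. replace (1 - - k) with (1 + k) by ring. replace (1 + - k) with (1 - k) by ring. ring. }
  pose proof (csch_series_pos_modulus (- k) Hm) as H.
  unfold period_ratio, legendre in *. rewrite EK, EE, EC, EA, EB in H. exact H.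
Qed.

Theorem theorem6 :
  forall k : R, 0 < k ^ 2 < 1 ->
  let k' := compl_modulus k in
  let K := ellipticK k in
  let E := ellipticE k in
  let K' := ellipticK k' in
  let E' := ellipticE k' in
  let A := coefA k in
  let B := coefB k in
  let a := fun n : nat =>
    (-1) ^ (n / 2)%nat * (2 * INR n + 1) ^ 3
    * csch ((2 * INR n + 1) / 2 * (K' / K) * PI) ^ 2 in
  ex_series a ->
  Series a =
    4 * k' * K ^ 4 * (6 * A * E + B * K)
    / (PI ^ 4 * (k' + 1) * (K' * (E - K) + E' * K)).
Proof.
  intros k Hk k' K E K' E' A B a _.
  rewrite <- (csch_series_modulus k Hk : _ = 4 * k' * K ^ 4 * (6 * A * E + B * K)
    / (PI ^ 4 * (k' + 1) * (K' * (E - K) + E' * K))).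
  apply Series_ext. intros n. unfold a, chi, odd_num, period_ratio. fold k' K'. fold K.
  do 3 f_equal. unfold Rdiv. ring.
Qed.
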